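(* There exists $\delta>0$ such that for any $\mu>0$ the following holds. Let $a_0\in C^3([-\pi,\pi])$ satisfy $\int_{-\pi}^\pi a_0(x)\,dx=0$ and $$\|a_0-\mu\cos(\cdot)\|_{C^3([-\pi,\pi])}=\sigma\le\delta\mu .$$ Then the Proudman–Johnson equation $$\partial_t a+\Big(\int_{-\pi}^x a(t,\bar x)\,d\bar x\Big)\partial_x a-a^2+\frac1\pi\int_{-\pi}^{\pi}a^2\,dx=0,\qquad x\in[-\pi,\pi],$$ with $\int_{-\pi}^\pi a(t,x)dx=0$, has a unique global-in-time $C^3$ solution $a$ with $a(0,\cdot)=a_0$. Moreover, for all $t\ge0$, $$\|a(t,\cdot)-\mu_*\cos(\cdot)\|_{C^1([-\pi,\pi])}\lesssim\sigma e^{-\mu t/2},$$ where $\mu_*=-\partial_x^2a_0(x_0^* )$, with $x_0^*$ the point at which $a_0$ attains its maximum, and $\mu_*=\mu+O(\sigma)$.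
   Context: $\lesssim$ and $O(\cdot)$ denote bounds up to constants not depending on $a_0,\sigma,t$. *)

(* Defs.v *)
From Stdlib Require Import Reals.
From Coquelicot Require Import Coquelicot.
Open Scope R_scope.

(** [f] is of class C^k on the closed interval [-pi,pi]: f is continuous on
    [-pi,pi], its derivatives up to order k exist on (-pi,pi), and each of
    them extends continuously to [-pi,pi] (here: agrees on (-pi,pi) with a
    continuous function on R). *)
Definition CkI (k : nat) (f : R -> R) : Prop :=
  forall j : nat, (j <= k)%nat ->
    exists h : R -> R,
      (forall x, continuous h x) /\
      (forall x, -PI < x < PI -> ex_derive_n f j x /\ Derive_n f j x = h x) /\
      (j = 0%nat -> forall x, -PI <= x <= PI -> h x = f x).

(** sup_{x in (-pi,pi)} |g x|  (equals the sup over [-pi,pi] for continuous g) *)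
Definition supI (g : R -> R) : Rbar :=
  Lub_Rbar (fun y => exists x, -PI < x < PI /\ y = Rabs (g x)).

Fixpoint CkNorm (k : nat) (f : R -> R) : Rbar :=
  match k with
  | O => supI f
  | S k' => Rbar_plus (CkNorm k' f) (supI (Derive_n f (S k')))
  end.

Definition PJ_rhs (a : R -> R -> R) (t x : R) : R :=
  - (RInt (a t) (-PI) x) * Derive (a t) x + (a t x) ^ 2
  - / PI * RInt (fun y => (a t y) ^ 2) (-PI) PI.

(** Classical C^3 solution on [0,oo) x [-pi,pi] with initial datum a0:
    a, d_x a, d_x^2 a, d_x^3 a exist (in x, for each t >= 0) and are jointly
    continuous on [0,oo) x [-pi,pi]; a(t) has zero mean; a(0) = a0; and for
    every x in [-pi,pi], t |-> a(t,x) is differentiable on [0,oo) (one-sided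
    at t = 0) with derivative given by the equation.
    (At x = -pi and x = pi the transport coefficient int_{-pi}^x a vanishes,
    so the value of [Derive] there is irrelevant.) *)
Definition PJ_solution (a0 : R -> R) (a : R -> R -> R) : Prop :=
  (forall j : nat, (j <= 3)%nat ->
    exists H : R -> R -> R,
      (forall p : R * R, continuous (fun q : R * R => H (fst q) (snd q)) p) /\
      (forall t x, 0 <= t -> -PI < x < PI ->
          ex_derive_n (a t) j x /\ Derive_n (a t) j x = H t x) /\
      (j = 0%nat -> forall t x, 0 <= t -> -PI <= x <= PI -> H t x = a t x)) /\
  (forall t, 0 <= t -> RInt (a t) (-PI) PI = 0) /\
  (forall x, -PI <= x <= PI -> a 0 x = a0 x) /\
  (forall x, -PI <= x <= PI ->
     (forall t, 0 < t -> is_derive (fun s => a s x) t (PJ_rhs a t x)) /\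
     filterlim (fun h => (a h x - a 0 x) / h) (at_right 0)
               (locally (PJ_rhs a 0 x))).

(* Main.v *)
(** Along the flow [X] of the velocity [int_{-pi}^x a], the inverse Jacobian [1 / X_z] solves a
    linear second order ODE in [t], so it is an affine combination of [1] and [a0(z)]; normalising
    the total length gives [X_z = 1 / (K(s) (1 - s a0(z)))] with
    [K(s) = (1/2pi) int dz / (1 - s a0(z))], where [s(t)] solves [s' = K(s)^{-2}], [s(0) = 0].
    All quantities are explicit in [s], and [s] increases to [1 / max a0] as [t] tends to infinity.

    Near its maximum [x0] the datum equals [b + kap cos (z - x0)] up to a cubically small error
    [O(sigma |z - x0|^3)], and for the data [b + kap cos] the map [X] is an explicit Moebius map of the
    circle.  With [eps = 1 - s max a0] the comparison costs [O(sigma sqrt eps log (1/eps))], while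
    [eps = O(exp (- (4/3) mu t))], which leaves room for the rate [exp (- mu t / 2)].

    Uniqueness is an [L^2] energy estimate for the difference of two solutions. *)

Require Import Defs.
From Stdlib Require Import Reals Lra Lia Psatz ClassicalEpsilon.
From Coquelicot Require Import Coquelicot.
Open Scope R_scope.

(** * Continuity, monotonicity and parametric integrals *)

(** The linear equation comes from the fact that, along the flow, [a] solves [d/dt a = a^2 - c(t)]
    with [c = (1/pi) int a^2] common to all labels: [psi = 1 / X_z] has [psi_t = - a psi], hence
    [psi_tt = c(t) psi]. Writing [psi = alpha - beta a0], where [alpha] and [beta] solve the same
    equation with Wronskian 1, and setting [K = alpha], [s = beta / alpha], gives [s' = K^{-2}]. As
    [s] tends to [1 / max a0] the flow stretches an ever smaller neighbourhood of the maximum over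
    the whole interval, so only the second order Taylor polynomial there survives. This is why the
    limit amplitude is [- a0''(x0)], and the third derivative is what bounds the remainder. The
    comparison is made on [a_x]; the bound on [a] then follows from the zero mean. No periodicity is
    assumed, and derivatives of the datum are known only in the open interval: functions are
    therefore extended by constants beyond [-pi] and [pi] to make continuity global, and mean value
    arguments use interior derivatives only. Scaling reduces the analysis to [mu = 1]; the numerical
    constants are not optimised. *)

Notation cont2 f p := (continuous (fun q : R * R => f (fst q) (snd q)) p).

(* [RInt] produces equations in the carrier of a normed module, which [ring] and
   [field] do not recognise as [R]. *)
Ltac eqR := lazymatch goal with |- @eq _ ?a ?b => change (@eq R a b) end.

Lemma continuous_Rplus {U : UniformSpace} (f g : U -> R) u :
  continuous f u -> continuous g u -> continuous (fun v => f v + g v) u.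
Proof. exact (continuous_plus f g u). Qed.

Lemma continuous_Rminus {U : UniformSpace} (f g : U -> R) u :
  continuous f u -> continuous g u -> continuous (fun v => f v - g v) u.
Proof. exact (continuous_minus f g u). Qed.

Lemma continuous_Ropp {U : UniformSpace} (f : U -> R) u :
  continuous f u -> continuous (fun v => - f v) u.
Proof. exact (continuous_opp f u). Qed.

Lemma continuous_Rmult {U : UniformSpace} (f g : U -> R) u :
  continuous f u -> continuous g u -> continuous (fun v => f v * g v) u.
Proof. exact (continuous_mult f g u). Qed.

Lemma continuous_Rinv_fun {U : UniformSpace} (f : U -> R) u :
  continuous f u -> f u <> 0 -> continuous (fun v => / f v) u.
Proof.
  intros Hf H0. apply (continuous_comp f Rinv); [exact Hf|].
  now apply continuous_Rinv.
Qed.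

Lemma continuous_Rdiv {U : UniformSpace} (f g : U -> R) u :
  continuous f u -> continuous g u -> g u <> 0 ->
  continuous (fun v => f v / g v) u.
Proof.
  intros Hf Hg H0. apply continuous_Rmult; [exact Hf|].
  now apply continuous_Rinv_fun.
Qed.

Lemma continuous_Rpow {U : UniformSpace} (f : U -> R) n u :
  continuous f u -> continuous (fun v => f v ^ n) u.
Proof.
  intros Hf. induction n as [|n IH]; simpl.
  - apply continuous_const.
  - now apply continuous_Rmult.
Qed.

Lemma continuous_Rcos {U : UniformSpace} (f : U -> R) u :
  continuous f u -> continuous (fun v => cos (f v)) u.
Proof.
  intros Hf. apply (continuous_comp f cos); [exact Hf|].
  apply continuous_cos.
Qed.

Lemma continuous_Rsin {U : UniformSpace} (f : U -> R) u :
  continuous f u -> continuous (fun v => sin (f v)) u.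
Proof.
  intros Hf. apply (continuous_comp f sin); [exact Hf|].
  apply continuous_sin.
Qed.

Lemma continuous_comp1 {U : UniformSpace} (h : R -> R) (f : U -> R) u :
  continuous f u -> continuous h (f u) -> continuous (fun v => h (f v)) u.
Proof. exact (continuous_comp f h u). Qed.

Lemma cont2_comp {U : UniformSpace} (h : R -> R -> R) (f g : U -> R) u :
  continuous f u -> continuous g u -> cont2 h (f u, g u) ->
  continuous (fun v => h (f v) (g v)) u.
Proof. exact (continuous_comp_2 f g h u). Qed.

Lemma cont2_slice (f : R -> R -> R) s z : cont2 f (s, z) -> continuous (f s) z.
Proof.
  intros H. apply (cont2_comp f (fun _ => s) (fun v => v));
    [apply continuous_const | apply continuous_id | exact H].
Qed.

Ltac cont1 :=
  first
  [ assumption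
  | lazymatch goal with
    | |- continuous (fun _ => ?c) _ => apply continuous_const
    | |- continuous (fun v => v) _ => apply continuous_id
    | |- continuous cos _ => apply continuous_cos
    | |- continuous sin _ => apply continuous_sin
    | |- continuous fst _ => apply continuous_fst
    | |- continuous snd _ => apply continuous_snd
    | |- continuous (fun v => fst v) _ => apply continuous_fst
    | |- continuous (fun v => snd v) _ => apply continuous_snd
    | |- continuous (fun v => _ + _) _ => apply continuous_Rplus
    | |- continuous (fun v => _ - _) _ => apply continuous_Rminus
    | |- continuous (fun v => - _) _ => apply continuous_Ropp
    | |- continuous (fun v => _ / _) _ => apply continuous_Rdiv
    | |- continuous (fun v => _ * _) _ => apply continuous_Rmult
    | |- continuous (fun v => / _) _ => apply continuous_Rinv_fun
    | |- continuous (fun v => _ ^ _) _ => apply continuous_Rpow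
    | |- continuous (fun v => cos _) _ => apply continuous_Rcos
    | |- continuous (fun v => sin _) _ => apply continuous_Rsin
    end ].

Ltac cont := cbv beta; repeat (cont1; cbv beta).

(** [auto_derive] leaves the derivative of an abstract function in the eta-expanded form
    [Derive (fun y => u y) x]; the pattern has to match it syntactically. *)
Ltac rewrite_Derive u D :=
  lazymatch type of D with is_derive _ ?x ?l =>
    replace (Derive (fun y => u y) x) with l by (symmetry; apply is_derive_unique, D)
  end.

Lemma continuous_pt (f : R -> R) x : continuous f x <-> continuity_pt f x.
Proof. symmetry. apply continuity_pt_filterlim. Qed.

Lemma is_derive_continuous (f : R -> R) (x l : R) : is_derive f x l -> continuous f x.
Proof. intros H. apply (ex_derive_continuous f x). now exists l. Qed.

Lemma is_derive_val (f : R -> R) (x l l' : R) : is_derive f x l -> l = l' -> is_derive f x l'.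
Proof. now intros H <-. Qed.

Lemma ex_RInt_cont (f : R -> R) a b : (forall x, continuous f x) -> ex_RInt f a b.
Proof. intros H. apply (ex_RInt_continuous (V := R_CompleteNormedModule)). auto. Qed.

Lemma is_derive_RInt_cont (f : R -> R) a x :
  (forall y, continuous f y) -> is_derive (fun z => RInt f a z) x (f x).
Proof.
  intros H. apply (is_derive_RInt f _ a x); [|apply H].
  apply filter_forall. intros z. apply (RInt_correct f).
  now apply ex_RInt_cont.
Qed.

Lemma RInt_split (f : R -> R) a b c :
  (forall y, continuous f y) -> RInt f a c = RInt f a b + RInt f b c.
Proof.
  intros H. symmetry. apply (RInt_Chasles f); now apply ex_RInt_cont.
Qed.

Lemma RInt_scale (f : R -> R) c a b :
  (forall y, continuous f y) -> RInt (fun y => c * f y) a b = c * RInt f a b.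
Proof. intros H. apply (RInt_scal f). now apply ex_RInt_cont. Qed.

Lemma RInt_lin (f g : R -> R) c d a b :
  (forall y, continuous f y) -> (forall y, continuous g y) ->
  RInt (fun y => c * f y + d * g y) a b = c * RInt f a b + d * RInt g a b.
Proof.
  intros Hf Hg. rewrite <- (RInt_scale f c), <- (RInt_scale g d) by assumption.
  apply (RInt_plus (fun y => c * f y) (fun y => d * g y));
    apply ex_RInt_cont; intros; cont; auto.
Qed.

Lemma Rabs_RInt_le (f : R -> R) a b M :
  (forall y, continuous f y) ->
  (forall y, Rmin a b <= y <= Rmax a b -> Rabs (f y) <= M) ->
  Rabs (RInt f a b) <= Rabs (b - a) * M.
Proof.
  intros Hf HM. destruct (Rle_dec a b) as [Hab|Hab].
  - rewrite (Rabs_pos_eq (b - a)) by lra.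
    apply abs_RInt_le_const; [lra | now apply ex_RInt_cont |].
    rewrite Rmin_left, Rmax_right in HM by lra. exact HM.
  - rewrite <- (opp_RInt_swap f) by now apply ex_RInt_cont.
    change (Rabs (- RInt f b a) <= Rabs (b - a) * M).
    rewrite Rabs_Ropp, (Rabs_left (b - a)) by lra.
    replace (- (b - a)) with (a - b) by ring.
    apply abs_RInt_le_const; [lra | now apply ex_RInt_cont |].
    rewrite Rmin_right, Rmax_left in HM by lra. exact HM.
Qed.

(** * Mean value inequalities with derivatives on the open interval *)

Lemma MVT_open (f df : R -> R) a b :
  a <= b -> (forall x, continuous f x) ->
  (forall x, a < x < b -> is_derive f x (df x)) ->
  exists c, a <= c <= b /\ f b - f a = df c * (b - a).
Proof.
  intros Hab Hf Hd.
  destruct (MVT_gen f a b df) as [c Hc].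
  - rewrite Rmin_left, Rmax_right by lra. exact Hd.
  - intros x _. apply continuous_pt, Hf.
  - rewrite Rmin_left, Rmax_right in Hc by lra. now exists c.
Qed.

(* In [MVT_open] the intermediate point may be an endpoint, where nothing is
   known about [df]; the versions below only use bounds on the open interval. *)
Lemma incr_open (f df : R -> R) a b :
  a <= b -> (forall x, a <= x <= b -> continuous f x) ->
  (forall x, a < x < b -> is_derive f x (df x)) ->
  (forall x, a < x < b -> 0 <= df x) -> f a <= f b.
Proof.
  intros Hab Hf Hd Hp. destruct (Req_dec a b) as [->|Hne]; [lra|].
  (* The derivative is given the value 0 off the open interval, so an intermediate point falling on
     an endpoint only yields [f b - f a = 0]. *)
  destruct (MVT_gen f a b (fun x => if Rlt_dec a x then if Rlt_dec x b then df x else 0 else 0))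
    as [c [Hc E]].
  - rewrite Rmin_left, Rmax_right by lra. intros x Hx.
    destruct (Rlt_dec a x); [|lra]. destruct (Rlt_dec x b); [|lra]. now apply Hd.
  - rewrite Rmin_left, Rmax_right by lra.
    intros x Hx. apply continuous_pt, Hf, Hx.
  - enough (0 <= f b - f a) by lra. rewrite E.
    apply Rmult_le_pos; [|lra].
    destruct (Rlt_dec a c); [|lra]. destruct (Rlt_dec c b); [|lra]. now apply Hp.
Qed.

Lemma diff_le_open (f df g dg : R -> R) a b :
  a <= b -> (forall x, a <= x <= b -> continuous f x) ->
  (forall x, a <= x <= b -> continuous g x) ->
  (forall x, a < x < b -> is_derive f x (df x)) ->
  (forall x, a < x < b -> is_derive g x (dg x)) ->
  (forall x, a < x < b -> df x <= dg x) -> f b - f a <= g b - g a.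
Proof.
  intros Hab Hf Hg Hdf Hdg Hle.
  enough (g a - f a <= g b - f b) by lra.
  apply (incr_open (fun x => g x - f x) (fun x => dg x - df x)); auto.
  - intros x Hx. cont; auto.
  - intros x Hx. apply (is_derive_minus g f); auto.
  - intros x Hx. specialize (Hle x Hx). lra.
Qed.

Lemma Rabs_diff_le_open (f df g dg : R -> R) a b :
  a <= b -> (forall x, a <= x <= b -> continuous f x) ->
  (forall x, a <= x <= b -> continuous g x) ->
  (forall x, a < x < b -> is_derive f x (df x)) ->
  (forall x, a < x < b -> is_derive g x (dg x)) ->
  (forall x, a < x < b -> Rabs (df x) <= dg x) -> Rabs (f b - f a) <= g b - g a.
Proof.
  intros Hab Hf Hg Hdf Hdg Hle. apply Rabs_le. split.
  - enough ((fun x => - f x) b - (fun x => - f x) a <= g b - g a) by (simpl in *; lra).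
    apply (diff_le_open (fun x => - f x) (fun x => - df x) g dg); auto.
    + intros x Hx. cont; auto.
    + intros x Hx. apply (is_derive_opp f); auto.
    + intros x Hx. specialize (Hle x Hx). apply Rabs_le_between in Hle. lra.
  - apply (diff_le_open f df g dg); auto.
    intros x Hx. specialize (Hle x Hx). apply Rabs_le_between in Hle. lra.
Qed.

(** The primitive of [g] is differentiable everywhere, so its difference with [f] is continuous up
    to the endpoints with zero derivative inside, hence constant. *)
Lemma FTC_open (f g : R -> R) a b :
  a <= b -> (forall x, a <= x <= b -> continuous f x) -> (forall x, continuous g x) ->
  (forall x, a < x < b -> is_derive f x (g x)) -> RInt g a b = f b - f a.
Proof.
  intros Hab Hf Hg Hd.
  assert (HI : forall x, is_derive (fun z => RInt g a z) x (g x))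
    by (intros x; now apply is_derive_RInt_cont).
  assert (H0 : RInt g a a = 0) by apply (RInt_point a g).
  assert (Rabs ((fun x => f x - RInt g a x) b - (fun x => f x - RInt g a x) a)
          <= (fun _ => 0) b - (fun _ => 0) a).
  { apply (Rabs_diff_le_open (fun x => f x - RInt g a x) (fun x => g x - g x) (fun _ => 0) (fun _ => 0)); auto.
    - intros x Hx. cont; auto. eapply is_derive_continuous, HI.
    - intros x Hx. cont.
    - intros x Hx. apply (is_derive_minus f (fun x => RInt g a x)); auto.
    - intros x Hx. apply (is_derive_const (V := R_NormedModule) 0).
    - intros x _. rewrite Rminus_diag, Rabs_R0. lra. }
  simpl in H. rewrite H0 in H.
  replace (f b - RInt g a b - (f a - 0)) with (f b - RInt g a b - f a) in H by ring.
  apply Rabs_le_between in H. lra.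
Qed.

(** * Joint continuity, parametric integrals and implicit functions *)

Lemma cont2_eps (f : R -> R -> R) s z :
  cont2 f (s, z) <->
  (forall eps, 0 < eps -> exists d, 0 < d /\
     forall u v, Rabs (u - s) < d -> Rabs (v - z) < d -> Rabs (f u v - f s z) < eps).
Proof.
  split.
  - intros H eps Heps. apply continuity_2d_pt_filterlim in H.
    destruct (H (mkposreal eps Heps)) as [d Hd].
    exists d. split; [apply cond_pos | exact Hd].
  - intros H. apply (proj1 (continuity_2d_pt_filterlim f s z)). intros eps.
    destruct (H eps (cond_pos eps)) as [d [Hd0 Hd]].
    exists (mkposreal d Hd0). exact Hd.
Qed.

Lemma continuous_eps (f : R -> R) x :
  continuous f x <->
  (forall eps, 0 < eps -> exists d, 0 < d /\
     forall u, Rabs (u - x) < d -> Rabs (f u - f x) < eps).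
Proof.
  split.
  - intros H eps Heps.
    destruct (proj1 (filterlim_locally f (f x)) H (mkposreal eps Heps)) as [d Hd].
    exists d. split; [apply cond_pos | exact Hd].
  - intros H. apply (proj2 (filterlim_locally f (f x))). intros eps.
    destruct (H eps (cond_pos eps)) as [d [Hd0 Hd]].
    exists (mkposreal d Hd0). exact Hd.
Qed.

Lemma locally_eps (P : R -> Prop) x :
  locally x P <-> exists d, 0 < d /\ forall u, Rabs (u - x) < d -> P u.
Proof.
  split.
  - intros [d Hd]. exists d. split; [apply cond_pos | exact Hd].
  - intros [d [H0 Hd]]. exists (mkposreal d H0). exact Hd.
Qed.

Lemma locally_Ioo (a b x : R) (P : R -> Prop) :
  a < x < b -> (forall u, a < u < b -> P u) -> locally x P.
Proof.
  intros Hx HP. apply locally_eps. exists (Rmin (x - a) (b - x)). split.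
  - apply Rmin_pos; lra.
  - intros u Hu. apply HP. apply Rabs_lt_between in Hu.
    pose proof (Rmin_l (x - a) (b - x)). pose proof (Rmin_r (x - a) (b - x)). lra.
Qed.

Lemma is_derive_RInt_param2 (f df : R -> R -> R) a b x :
  locally x (fun s => forall y, is_derive (fun u => f u y) s (df s y)) ->
  locally x (fun s => forall y, continuous (f s) y) ->
  (forall y, cont2 df (x, y)) ->
  is_derive (fun s => RInt (f s) a b) x (RInt (df x) a b).
Proof.
  intros Hd Hi Hc.
  assert (E : RInt (df x) a b = RInt (fun y => Derive (fun u => f u y) x) a b).
  { apply RInt_ext. intros y _. symmetry. apply is_derive_unique.
    now apply (locally_singleton _ _ Hd). }
  rewrite E. apply (is_derive_RInt_param f a b x).
  - apply (filter_imp _ _ (fun s H y _ => ex_intro _ _ (H y)) Hd).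
  - intros y _. apply continuity_2d_pt_ext_loc with (f := df).
    + apply locally_eps in Hd. destruct Hd as [d [H0 Hd]].
      exists (mkposreal d H0). intros u v Hu _. symmetry.
      apply is_derive_unique, Hd, Hu.
    + apply continuity_2d_pt_filterlim, Hc.
  - apply (filter_imp _ _ (fun s H => ex_RInt_cont (f s) a b H) Hi).
Qed.

(** The increment splits into the integral of [f s - f s0], uniformly small on the compact window
    [[lo, hi]] that contains [a] and every [z] within 1 of [z0], and an increment of the primitive
    of [f s0]. *)
Lemma cont2_RInt (f : R -> R -> R) a s0 z0 :
  (forall y, cont2 f (s0, y)) ->
  locally s0 (fun s => forall y, continuous (f s) y) ->
  cont2 (fun s z => RInt (f s) a z) (s0, z0).
Proof.
  intros Hf Hl.
  assert (Hf0 : forall y, continuous (f s0) y) by (intros y; apply cont2_slice, Hf).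
  apply cont2_eps. intros eps Heps.
  set (lo := Rmin a (z0 - 1)). set (hi := Rmax a (z0 + 1)).
  assert (Hlo : lo <= a /\ lo <= z0 - 1) by (split; [apply Rmin_l | apply Rmin_r]).
  assert (Hhi : a <= hi /\ z0 + 1 <= hi) by (split; [apply Rmax_l | apply Rmax_r]).
  set (e' := eps / 2 / (hi - lo)).
  assert (He' : 0 < e').
  { unfold e'. apply Rdiv_lt_0_compat; lra. }
  destruct (uniform_continuity_2d_1d' f lo hi s0
              (fun y _ => proj2 (continuity_2d_pt_filterlim _ _ _) (Hf y))
              (mkposreal e' He')) as [d1 Hd1]. simpl in Hd1.
  apply locally_eps in Hl. destruct Hl as [d2 [Hd2 Hl]].
  destruct (proj1 (continuous_eps (fun z => RInt (f s0) a z) z0)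
              (is_derive_continuous _ _ _ (is_derive_RInt_cont (f s0) a z0 Hf0))
              (eps / 2) ltac:(lra)) as [d3 [Hd3 Hc]].
  pose proof (cond_pos d1) as Hd1p.
  exists (Rmin (Rmin d1 d2) (Rmin d3 1)). split.
  { repeat apply Rmin_pos; lra. }
  intros s z Hs Hz.
  pose proof (Rmin_l (Rmin d1 d2) (Rmin d3 1)). pose proof (Rmin_r (Rmin d1 d2) (Rmin d3 1)).
  pose proof (Rmin_l d1 d2). pose proof (Rmin_r d1 d2).
  pose proof (Rmin_l d3 1). pose proof (Rmin_r d3 1).
  assert (Hsc : forall y, continuous (f s) y) by (apply Hl; lra).
  assert (E : RInt (f s) a z = RInt (fun y => f s y - f s0 y) a z + RInt (f s0) a z).
  { rewrite <- (RInt_plus (fun y => f s y - f s0 y) (f s0)).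
    - apply RInt_ext. intros y _. unfold plus; simpl. lra.
    - apply ex_RInt_cont. intros; cont; auto.
    - now apply ex_RInt_cont. }
  rewrite E.
  assert (Hz' : lo <= z <= hi) by (apply Rabs_lt_between in Hz; lra).
  assert (B : Rabs (RInt (fun y => f s y - f s0 y) a z) <= Rabs (z - a) * e').
  { apply Rabs_RInt_le; [intros; cont; auto|].
    intros y Hy. left.
    assert (lo <= y <= hi).
    { unfold Rmin, Rmax in Hy. destruct (Rle_dec a z); lra. }
    apply Hd1; try lra.
    - apply Rabs_lt_between in Hs. lra.
    - rewrite Rminus_diag, Rabs_R0. lra. }
  assert (Rabs (z - a) * e' <= eps / 2).
  { apply Rle_trans with ((hi - lo) * e').
    - apply Rmult_le_compat_r; [lra|]. apply Rabs_le. lra.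
    - unfold e'. right. field. lra. }
  specialize (Hc z ltac:(lra)).
  replace (RInt (fun y => f s y - f s0 y) a z + RInt (f s0) a z - RInt (f s0) a z0)
    with (RInt (fun y => f s y - f s0 y) a z + (RInt (f s0) a z - RInt (f s0) a z0)) by ring.
  eapply Rle_lt_trans; [apply Rabs_triang|]. lra.
Qed.

(** Uniform continuity with step [d] allows a walk from [(s, z)] to the origin along the ray: the
    contraction by [n / (n + 1)] moves each coordinate by less than [d], so every step changes [f]
    by at most 1. *)
Lemma cont2_bounded (f : R -> R -> R) r :
  (forall p, cont2 f p) ->
  exists M, forall s z, Rabs s <= r -> Rabs z <= r -> Rabs (f s z) <= M.
Proof.
  intros Hf. destruct (Rle_dec 0 r) as [Hr|Hr].
  2:{ exists 0. intros s z Hs _. pose proof (Rabs_pos s). lra. }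
  destruct (uniform_continuity_2d f (-r) r (-r) r
    (fun x y _ _ => proj2 (continuity_2d_pt_filterlim _ _ _) (Hf (x, y)))
    (mkposreal 1 Rlt_0_1)) as [d Hd]. simpl in Hd.
  pose proof (cond_pos d) as Hdp.
  assert (S : forall n s z, Rabs s <= r -> Rabs z <= r ->
            Rabs s < INR n * d -> Rabs z < INR n * d ->
            Rabs (f s z) <= Rabs (f 0 0) + INR n).
  { induction n as [|n IH]; intros s z Hs Hz Hs' Hz'.
    - simpl in *. pose proof (Rabs_pos s). lra.
    - rewrite S_INR in *. pose proof (pos_INR n) as Hn.
      set (l := INR n / (INR n + 1)).
      assert (Hl : 0 <= l < 1 /\ 1 - l = / (INR n + 1)).
      { unfold l. split; [split|].
        - apply Rdiv_le_0_compat; lra.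
        - apply Rlt_div_l; lra.
        - field. lra. }
      destruct Hl as [Hl Hl'].
      assert (sm : forall t, Rabs t < (INR n + 1) * d -> Rabs (t - l * t) < d).
      { intros t Ht. replace (t - l * t) with (t * / (INR n + 1)) by (rewrite <- Hl'; ring).
        rewrite Rabs_mult, Rabs_inv, (Rabs_pos_eq (INR n + 1)) by lra.
        apply Rlt_div_l; lra. }
      assert (le : forall t, Rabs t <= r -> Rabs (l * t) <= r).
      { intros t Ht. rewrite Rabs_mult, (Rabs_pos_eq l) by lra.
        pose proof (Rabs_pos t). nra. }
      assert (H1 : Rabs (f s z - f (l * s) (l * z)) < 1).
      { apply Hd; auto; apply Rabs_le_between; auto. }
      assert (H2 : Rabs (f (l * s) (l * z)) <= Rabs (f 0 0) + INR n).
      { destruct (Req_dec (INR n) 0) as [E|E].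
        - unfold l. rewrite E. replace (0 / (0 + 1)) with 0 by field.
          rewrite !Rmult_0_l. lra.
        - assert (lt : forall t, Rabs t < (INR n + 1) * d -> Rabs (l * t) < INR n * d).
          { intros t Ht. rewrite Rabs_mult, (Rabs_pos_eq l) by lra.
            apply Rlt_le_trans with (l * ((INR n + 1) * d)).
            - apply Rmult_lt_compat_l; [|lra]. unfold l. apply Rdiv_lt_0_compat; lra.
            - right. unfold l. field. lra. }
          apply IH; auto. }
      replace (f s z) with ((f s z - f (l * s) (l * z)) + f (l * s) (l * z)) by ring.
      eapply Rle_trans; [apply Rabs_triang|]. lra. }
  destruct (nfloor_ex (r / d)) as [n Hn]; [apply Rdiv_le_0_compat; lra|].
  exists (Rabs (f 0 0) + INR (n + 1)). intros s z Hs Hz.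
  assert (r < INR (n + 1) * d).
  { rewrite plus_INR. simpl. apply Rlt_div_l; lra. }
  apply S; lra.
Qed.

(* Mean value form of the implicit function theorem: the difference quotient
   of [Z] is [-(F s z0 - F s0 z0) / (s - s0)] divided by an intermediate value
   of [J]. *)
Lemma implicit_derive (F J : R -> R -> R) (Z : R -> R) s0 l d0 :
  0 < d0 ->
  (forall s z, Rabs (s - s0) < d0 -> Rabs (z - Z s0) < d0 -> is_derive (F s) z (J s z)) ->
  (forall s, Rabs (s - s0) < d0 -> F s (Z s) = 0) ->
  cont2 J (s0, Z s0) -> J s0 (Z s0) <> 0 ->
  continuous Z s0 ->
  is_derive (fun s => F s (Z s0)) s0 l ->
  is_derive Z s0 (- l / J s0 (Z s0)).
Proof.
  intros Hd0 HF H0 HJ HJ0 HZ Hl.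
  set (z0 := Z s0) in *. set (j := J s0 z0) in *.
  assert (Hz : F s0 z0 = 0) by (apply H0; rewrite Rminus_diag, Rabs_R0; lra).
  apply is_derive_Reals. apply is_derive_Reals in Hl.
  intros eps Heps.
  (* Continuity of the quotient at [(l, j)] converts an approximate numerator and an approximate [J]
     into the limit; the tolerance [Rabs j / 2] below keeps [J] away from 0. *)
  assert (HQ : cont2 (fun q w => - q / w) (l, j)) by cont.
  destruct (proj1 (cont2_eps _ _ _) HQ eps Heps) as [e1 [He1 Q]].
  assert (Hj : 0 < Rabs j) by now apply Rabs_pos_lt.
  destruct (proj1 (cont2_eps _ _ _) HJ (Rmin e1 (Rabs j / 2))) as [e3 [He3 HJe]].
  { apply Rmin_pos; lra. }
  destruct (proj1 (continuous_eps _ _) HZ (Rmin e3 d0)) as [e4 [He4 HZe]].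
  { apply Rmin_pos; lra. }
  destruct (Hl e1 He1) as [e5 Hle]. pose proof (cond_pos e5) as He5.
  set (d := Rmin (Rmin e3 d0) (Rmin e4 e5)).
  assert (Hd : 0 < d) by (repeat apply Rmin_pos; lra).
  exists (mkposreal d Hd). simpl. intros h Hh Hhd.
  assert (Hdd : d <= e3 /\ d <= d0 /\ d <= e4 /\ d <= e5).
  { unfold d.
    pose proof (Rmin_l (Rmin e3 d0) (Rmin e4 e5)). pose proof (Rmin_r (Rmin e3 d0) (Rmin e4 e5)).
    pose proof (Rmin_l e3 d0). pose proof (Rmin_r e3 d0).
    pose proof (Rmin_l e4 e5). pose proof (Rmin_r e4 e5). lra. }
  set (s := s0 + h).
  assert (Hs : Rabs (s - s0) < d) by (unfold s; now replace (s0 + h - s0) with h by ring).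
  assert (Hzs : Rabs (Z s - z0) < e3 /\ Rabs (Z s - z0) < d0).
  { pose proof (HZe s ltac:(lra)). pose proof (Rmin_l e3 d0). pose proof (Rmin_r e3 d0).
    fold z0 in H. lra. }
  destruct (MVT_gen (F s) z0 (Z s) (J s)) as [c [Hc E]].
  - intros x Hx. apply HF; [lra|].
    unfold Rmin, Rmax in Hx. destruct Hzs as [_ Hzs]. apply Rabs_lt_between in Hzs.
    apply Rabs_lt_between. destruct (Rle_dec z0 (Z s)); lra.
  - intros x Hx. apply continuous_pt, (is_derive_continuous _ _ (J s x)), HF; [lra|].
    unfold Rmin, Rmax in Hx. destruct Hzs as [_ Hzs]. apply Rabs_lt_between in Hzs.
    apply Rabs_lt_between. destruct (Rle_dec z0 (Z s)); lra.
  - rewrite H0 in E by lra.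
    assert (Hcz : Rabs (c - z0) < e3).
    { destruct Hzs as [Hzs _]. apply Rabs_lt_between in Hzs. apply Rabs_lt_between.
      unfold Rmin, Rmax in Hc. destruct (Rle_dec z0 (Z s)); lra. }
    pose proof (HJe s c ltac:(lra) Hcz) as Hw. fold j in Hw.
    pose proof (Rmin_l e1 (Rabs j / 2)). pose proof (Rmin_r e1 (Rabs j / 2)).
    assert (Hw0 : J s c <> 0).
    { intros C. rewrite C in Hw. replace (0 - j) with (- j) in Hw by ring.
      rewrite Rabs_Ropp in Hw. lra. }
    specialize (Hle h Hh ltac:(lra)). fold s in Hle. rewrite Hz in Hle.
    pose proof (Q ((F s z0 - 0) / h) (J s c) Hle ltac:(lra)) as R.
    replace ((Z s - Z s0) / h) with (- ((F s z0 - 0) / h) / J s c); [exact R|].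
    fold z0. replace (Z s - z0) with ((0 - F s z0) / J s c).
    + field. split; auto.
    + rewrite E. field. exact Hw0.
Qed.

(** Monotonicity replaces differentiability: [F u0] is negative at [Z u0 - e] and positive at
    [Z u0 + e], these signs persist for nearby [u], and the zero [Z u] is trapped between. The
    parameter lives in any uniform space, so the lemma serves both the two-variable inverse [label]
    and the time change [tau]. *)
Lemma implicit_continuous {U : UniformSpace} (F : U -> R -> R) (Z : U -> R) (P : R -> Prop) u0 :
  (forall z, P z -> continuous (fun u => F u z) u0) ->
  locally u0 (fun u => F u (Z u) = 0 /\ P (Z u)) ->
  locally (Z u0) P ->
  locally u0 (fun u => forall z z', P z -> P z' -> z < z' -> F u z < F u z') ->
  continuous Z u0.
Proof.
  intros Hc H0 HP Hi. apply (proj2 (filterlim_locally Z (Z u0))). intros eps.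
  apply locally_eps in HP. destruct HP as [e0 [He0 HP]].
  set (e := Rmin eps (e0 / 2)).
  assert (He : 0 < e /\ e <= eps /\ e < e0).
  { pose proof (cond_pos eps). unfold e.
    pose proof (Rmin_l eps (e0 / 2)). pose proof (Rmin_r eps (e0 / 2)).
    split; [apply Rmin_pos; lra | lra]. }
  destruct (locally_singleton _ _ H0) as [E0 P0].
  pose proof (locally_singleton _ _ Hi) as Hi0. cbv beta in Hi0.
  assert (Pp : P (Z u0 + e)).
  { apply HP. replace (Z u0 + e - Z u0) with e by ring. rewrite Rabs_pos_eq; lra. }
  assert (Pm : P (Z u0 - e)).
  { apply HP. replace (Z u0 - e - Z u0) with (- e) by ring.
    rewrite Rabs_Ropp, Rabs_pos_eq; lra. }
  assert (Hp : 0 < F u0 (Z u0 + e)) by (rewrite <- E0; apply Hi0; auto; lra).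
  assert (Hm : 0 < - F u0 (Z u0 - e)).
  { specialize (Hi0 _ _ Pm P0 ltac:(lra)). lra. }
  pose proof (proj1 (filterlim_locally _ _) (Hc _ Pp) (mkposreal _ Hp)) as L1.
  pose proof (proj1 (filterlim_locally _ _) (Hc _ Pm) (mkposreal _ Hm)) as L2.
  generalize (filter_and _ _ (filter_and _ _ L1 L2) (filter_and _ _ H0 Hi)).
  apply filter_imp. intros u [[A B] [[C PC] D]].
  change (Rabs (F u (Z u0 + e) - F u0 (Z u0 + e)) < F u0 (Z u0 + e)) in A.
  change (Rabs (F u (Z u0 - e) - F u0 (Z u0 - e)) < - F u0 (Z u0 - e)) in B.
  change (Rabs (Z u - Z u0) < eps).
  apply Rabs_lt_between in A. apply Rabs_lt_between in B. apply Rabs_lt_between.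
  split.
  - apply Rnot_le_lt. intros L.
    destruct (Rle_lt_or_eq_dec (Z u) (Z u0 - e) ltac:(lra)) as [L'|L'].
    + specialize (D _ _ PC Pm L'). lra.
    + rewrite <- L' in B. lra.
  - apply Rnot_le_lt. intros L.
    destruct (Rle_lt_or_eq_dec (Z u0 + e) (Z u) ltac:(lra)) as [L'|L'].
    + specialize (D _ _ Pp PC L'). lra.
    + rewrite L' in A. lra.
Qed.

(** Composition with [clamp] extends a function on the closed interval by its boundary values, so
    that continuity can be stated on the whole line or plane. *)
Definition clamp (x : R) : R := Rmax (- PI) (Rmin x PI).

Lemma clamp_range x : - PI <= clamp x <= PI.
Proof.
  pose proof PI_RGT_0. split; [apply Rmax_l|].
  apply Rmax_lub; [lra | apply Rmin_r].
Qed.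

Lemma clamp_id x : - PI <= x <= PI -> clamp x = x.
Proof. intros H. unfold clamp. rewrite Rmin_left, Rmax_right; lra. Qed.

Lemma Rabs_clamp x y : Rabs (clamp x - clamp y) <= Rabs (x - y).
Proof.
  pose proof PI_RGT_0. unfold clamp, Rmin.
  destruct (Rle_dec x PI); destruct (Rle_dec y PI); unfold Rmax, Rabs;
    repeat match goal with |- context [if ?d then _ else _] => destruct d end; lra.
Qed.

Lemma continuous_clamp {U : UniformSpace} (f : U -> R) u :
  continuous f u -> continuous (fun v => clamp (f v)) u.
Proof.
  intros H. apply (continuous_comp1 clamp f); [exact H|].
  apply continuous_eps. intros eps He. exists eps. split; [lra|].
  intros v Hv. eapply Rle_lt_trans; [apply Rabs_clamp | exact Hv].
Qed.

Lemma continuous_Rmax0 {U : UniformSpace} (f : U -> R) u :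
  continuous f u -> continuous (fun v => Rmax 0 (f v)) u.
Proof.
  intros H. apply (continuous_comp1 (Rmax 0) f); [exact H|].
  apply continuous_eps. intros eps He. exists eps. split; [lra|].
  intros v Hv. eapply Rle_lt_trans; [|exact Hv].
  unfold Rmax, Rabs.
  repeat match goal with |- context [if ?d then _ else _] => destruct d end; lra.
Qed.

(** * Uniqueness *)

Lemma RInt_mono (f g : R -> R) a b :
  a <= b -> (forall x, continuous f x) -> (forall x, continuous g x) ->
  (forall x, a <= x <= b -> f x <= g x) -> RInt f a b <= RInt g a b.
Proof.
  intros Hab Hf Hg H. apply RInt_le; auto; try now apply ex_RInt_cont.
  intros x Hx. apply H. lra.
Qed.

Lemma RInt_const_R (c a b : R) : RInt (fun _ => c) a b = (b - a) * c.
Proof. apply (RInt_const a b c). Qed.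

Lemma RInt_ext_le (f g : R -> R) a b :
  a <= b -> (forall x, a <= x <= b -> f x = g x) -> RInt f a b = RInt g a b.
Proof.
  intros Hab H. apply RInt_ext. rewrite Rmin_left, Rmax_right by lra.
  intros x Hx. apply H. lra.
Qed.

Lemma RInt_ext_all (f g : R -> R) a b :
  (forall x, f x = g x) -> RInt f a b = RInt g a b.
Proof. intros H. apply RInt_ext. auto. Qed.

Lemma RInt_sqr_zero (f : R -> R) a b :
  a < b -> (forall x, continuous f x) -> RInt (fun x => f x ^ 2) a b <= 0 ->
  forall x, a <= x <= b -> f x = 0.
Proof.
  intros Hab Hf HI x Hx. destruct (Req_dec (f x) 0) as [E|E]; [exact E|exfalso].
  assert (Hf2 : forall x, continuous (fun x => f x ^ 2) x) by (intros; cont; auto).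
  assert (Hp : 0 < Rabs (f x)) by now apply Rabs_pos_lt.
  destruct (proj1 (continuous_eps f x) (Hf x) (Rabs (f x) / 2) ltac:(lra)) as [d [Hd H]].
  set (c := Rmax a (x - d / 2)). set (e := Rmin b (x + d / 2)).
  assert (Hce : a <= c /\ x - d / 2 <= c /\ c <= x /\ x <= e /\ e <= b /\ e <= x + d / 2 /\ c < e).
  { unfold c, e, Rmax, Rmin.
    repeat match goal with |- context [if ?d then _ else _] => destruct d end; lra. }
  assert (P : 0 < RInt (fun x => f x ^ 2) c e).
  { apply RInt_gt_0; [lra| |auto].
    intros y Hy. specialize (H y). rewrite Rabs_lt_between in H.
    specialize (H ltac:(lra)). simpl. rewrite Rmult_1_r.
    apply Rlt_0_sqr. intros C. rewrite C in H.
    replace (0 - f x) with (- f x) in H by ring. rewrite Rabs_Ropp in H. lra. }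
  rewrite (RInt_split _ a c b), (RInt_split _ c e b) in HI by exact Hf2.
  assert (N : forall u v, u <= v -> 0 <= RInt (fun x => f x ^ 2) u v).
  { intros u v Huv. apply RInt_ge_0; [lra | now apply ex_RInt_cont |].
    intros; apply pow2_ge_0. }
  pose proof (N a c ltac:(lra)). pose proof (N e b ltac:(lra)). lra.
Qed.

(** Expands the nonnegative integral of [(f - c)^2] with [c] the mean of [f]. *)
Lemma RInt_Cauchy_Schwarz (f : R -> R) a b :
  a < b -> (forall x, continuous f x) ->
  RInt f a b ^ 2 <= (b - a) * RInt (fun x => f x ^ 2) a b.
Proof.
  intros Hab Hf. set (J := RInt f a b). set (c := J / (b - a)).
  assert (Hf2 : forall x, continuous (fun x => f x ^ 2) x) by (intros; cont; auto).
  assert (P : 0 <= RInt (fun x => (f x - c) ^ 2) a b).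
  { apply RInt_ge_0; [lra | apply ex_RInt_cont; intros; cont; auto |].
    intros; apply pow2_ge_0. }
  assert (E : RInt (fun x => (f x - c) ^ 2) a b
            = 1 * RInt (fun x => f x ^ 2) a b + 1 * RInt (fun x => (-2 * c) * f x + c ^ 2 * 1) a b).
  { rewrite <- RInt_lin; [|auto|intros; cont; auto].
    apply RInt_ext_all. intros x. ring. }
  rewrite (RInt_lin f (fun _ => 1)) in E; [|auto|intros; cont].
  rewrite RInt_const_R in E. fold J in E. rewrite E in P.
  apply Rmult_le_compat_l with (r := b - a) in P; [|lra].
  replace ((b - a) * (1 * RInt (fun x => f x ^ 2) a b +
             1 * (-2 * c * J + c ^ 2 * ((b - a) * 1))))
    with ((b - a) * RInt (fun x => f x ^ 2) a b - J ^ 2) in P; [lra|].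
  unfold c. field. lra.
Qed.

Lemma Gronwall_zero (E dE : R -> R) C T :
  0 <= T -> (forall t, 0 <= t <= T -> continuous E t) ->
  (forall t, 0 < t < T -> is_derive E t (dE t)) ->
  (forall t, 0 < t < T -> dE t <= C * E t) -> E 0 <= 0 -> E T <= 0.
Proof.
  intros HT Hc Hd Hle H0.
  assert (X : forall t, is_derive (fun t => exp (- C * t)) t (- C * exp (- C * t))).
  { intros t. auto_derive; auto. ring. }
  assert (M : (fun t => E t * exp (- C * t)) T - (fun t => E t * exp (- C * t)) 0
            <= (fun _ => 0) T - (fun _ => 0) 0).
  { apply (diff_le_open (fun t => E t * exp (- C * t))
      (fun t => dE t * exp (- C * t) + E t * (- C * exp (- C * t))) (fun _ => 0) (fun _ => 0)); auto.
    - intros t Ht. cont; auto. eapply is_derive_continuous, X.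
    - intros t Ht. cont.
    - intros t Ht. apply (is_derive_mult E (fun t => exp (- C * t))); auto.
      intros; apply Rmult_comm.
    - intros t Ht. apply (is_derive_const (V := R_NormedModule) 0).
    - intros t Ht. pose proof (exp_pos (- C * t)). specialize (Hle t Ht).
      replace (dE t * exp (- C * t) + E t * (- C * exp (- C * t)))
        with (- ((C * E t - dE t) * exp (- C * t))) by ring.
      assert (0 <= (C * E t - dE t) * exp (- C * t)); [|lra].
      apply Rmult_le_pos; lra. }
  cbv beta in M. replace (- C * 0) with 0 in M by ring. rewrite exp_0 in M.
  pose proof (exp_pos (- C * T)). apply Rnot_lt_le. intros L.
  pose proof (Rmult_lt_0_compat _ _ L H). lra.
Qed.

(** [PJ_rhs] with [A1] in place of [Derive], which makes it jointly continuous, as differentiation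
    of the energy under the integral sign requires. *)
Definition PJ_field (A A1 : R -> R -> R) (t x : R) : R :=
  - RInt (A t) (- PI) x * A1 t x + A t x ^ 2 - / PI * RInt (fun y => A t y ^ 2) (- PI) PI.

(* A solution together with its x-derivative, both extended continuously to the
   whole plane; [A] is constant in x outside [-pi,pi], hence the [clamp] in [ext_dt]. *)
Record PJ_extension (a0 : R -> R) (a A A1 : R -> R -> R) : Prop := {
  ext_cont : forall p, cont2 A p;
  ext_cont1 : forall p, cont2 A1 p;
  ext_eq : forall t x, 0 <= t -> - PI <= x <= PI -> A t x = a t x;
  ext_dx : forall t x, 0 <= t -> - PI < x < PI -> is_derive (A t) x (A1 t x);
  ext_mean : forall t, 0 <= t -> RInt (A t) (- PI) PI = 0;
  ext_init : forall x, - PI <= x <= PI -> A 0 x = a0 x;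
  ext_dt : forall t x, 0 < t -> is_derive (fun s => A s x) t (PJ_field A A1 t (clamp x)) }.

Lemma PJ_extension_exists a0 a :
  PJ_solution a0 a -> exists A A1, PJ_extension a0 a A A1.
Proof.
  intros [HC [Hm [Hi Ht]]]. pose proof PI_RGT_0 as Hpi.
  destruct (HC 0%nat ltac:(lia)) as [H0 [C0 [_ E0]]].
  destruct (HC 1%nat ltac:(lia)) as [H1 [C1 [D1 _]]].
  specialize (E0 eq_refl).
  exists (fun t x => H0 t (clamp x)), (fun t x => H1 t (clamp x)).
  assert (EQ : forall t x, 0 <= t -> - PI <= x <= PI -> H0 t (clamp x) = a t x).
  { intros t x Ht0 Hx. rewrite clamp_id by lra. now apply E0. }
  assert (EI : forall t x, 0 <= t -> - PI <= x <= PI ->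
            RInt (fun y => H0 t (clamp y)) (- PI) x = RInt (a t) (- PI) x).
  { intros t x Ht0 Hx. apply RInt_ext_le; [lra|]. intros y Hy. apply EQ; lra. }
  assert (CC : forall (f : R -> R -> R) p, (forall p, cont2 f p) -> cont2 (fun t x => f t (clamp x)) p).
  { intros f p Hf. apply (cont2_comp f); [cont | apply continuous_clamp; cont | apply Hf]. }
  assert (DX : forall t x, 0 <= t -> - PI < x < PI -> is_derive (a t) x (H1 t x)).
  { intros t x Ht0 Hx. destruct (D1 t x Ht0 Hx) as [X Y]. simpl in X, Y.
    rewrite <- Y. now apply Derive_correct. }
  constructor; auto.
  - intros t x Ht0 Hx. rewrite clamp_id by lra.
    apply is_derive_ext_loc with (f := a t); [|now apply DX].
    apply (locally_Ioo (- PI) PI); [lra|]. intros u Hu. symmetry. apply EQ; lra.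
  - intros t Ht0. rewrite EI by lra. now apply Hm.
  - intros x Hx. rewrite EQ by lra. now apply Hi.
  - intros t x Ht0. pose proof (clamp_range x) as Hr.
    set (y := clamp x) in *.
    destruct (Ht y Hr) as [D _]. specialize (D t Ht0).
    apply is_derive_ext_loc with (f := fun s => a s y).
    { apply (locally_Ioo 0 (t + 1)); [lra|]. intros u Hu. symmetry. apply E0; lra. }
    apply (is_derive_val _ _ _ _ D).
    unfold PJ_rhs, PJ_field.
    rewrite EI by lra.
    rewrite (RInt_ext_le (fun y => H0 t (clamp y) ^ 2) (fun y => a t y ^ 2));
      [|lra| intros z Hz; rewrite EQ by lra; reflexivity].
    rewrite EQ, (clamp_id y) by lra.
    (* In the interior [A1] is the derivative; at both endpoints the transport coefficient vanishes,
       at [PI] by the zero mean, so the values of [A1] and of [Derive] there need not agree. *)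
    destruct (Rle_lt_or_eq_dec _ _ (proj1 Hr)) as [L|L].
    + destruct (Rle_lt_or_eq_dec _ _ (proj2 Hr)) as [L'|L'].
      * rewrite (is_derive_unique _ _ _ (DX t y ltac:(lra) ltac:(lra))). reflexivity.
      * rewrite L', Hm by lra. ring.
    + rewrite <- L, (RInt_point (- PI) (a t)). unfold zero; simpl. ring.
Qed.

Section Energy.

Variables (a0 : R -> R) (a b A A1 B B1 : R -> R -> R).
Hypothesis HA : PJ_extension a0 a A A1.
Hypothesis HB : PJ_extension a0 b B B1.

Let d t x := A t x - B t x.
Let energy t := RInt (fun x => d t x ^ 2) (- PI) PI.

Lemma cont2_PJ_field a' A' A1' p :
  PJ_extension a0 a' A' A1' -> cont2 (PJ_field A' A1') p.
Proof.
  intros H. unfold PJ_field. destruct p as [t x].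
  assert (CI : forall f : R -> R -> R, (forall p, cont2 f p) ->
      forall t x, cont2 (fun t x => RInt (f t) (- PI) x) (t, x)).
  { intros f Hf t' x'. apply cont2_RInt; [auto|].
    apply filter_forall. intros s y. now apply cont2_slice. }
  cont.
  - apply (CI A'), (ext_cont _ _ _ _ H).
  - apply (ext_cont1 _ _ _ _ H).
  - apply (ext_cont _ _ _ _ H).
  - apply (cont2_comp (fun t x => RInt (fun y => A' t y ^ 2) (- PI) x) fst (fun _ => PI)); cont.
    apply (CI (fun t y => A' t y ^ 2)). intros q. cont. apply (ext_cont _ _ _ _ H).
Qed.

Let cd : forall p, cont2 d p.
Proof.
  intros p. unfold d. cont; [apply (ext_cont _ _ _ _ HA) | apply (ext_cont _ _ _ _ HB)].
Qed.

Lemma energy_continuous t : continuous energy t.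
Proof.
  unfold energy.
  apply (cont2_comp (fun t x => RInt (fun y => d t y ^ 2) (- PI) x) (fun t => t) (fun _ => PI)); cont.
  assert (c2 : forall p, cont2 (fun t y => d t y ^ 2) p) by (intros; cont; apply cd).
  apply (cont2_RInt (fun t y => d t y ^ 2)); [auto|].
  apply filter_forall. intros s y. now apply (cont2_slice (fun t y => d t y ^ 2)).
Qed.

Let dE t := RInt (fun x => 2 * d t x * (PJ_field A A1 t (clamp x) - PJ_field B B1 t (clamp x))) (- PI) PI.

Lemma energy_derive t : 0 < t -> is_derive energy t (dE t).
Proof.
  intros Ht. unfold energy, dE.
  apply (is_derive_RInt_param2 (fun t x => d t x ^ 2)
    (fun t x => 2 * d t x * (PJ_field A A1 t (clamp x) - PJ_field B B1 t (clamp x)))).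
  - apply (locally_Ioo 0 (t + 1)); [lra|]. intros s Hs y.
    pose proof (ext_dt _ _ _ _ HA s y ltac:(lra)) as DA.
    pose proof (ext_dt _ _ _ _ HB s y ltac:(lra)) as DB.
    pose proof (is_derive_minus _ _ _ _ _ DA DB) as D.
    apply (is_derive_pow _ 2) in D. apply (is_derive_val _ _ _ _ D).
    unfold d, minus, plus, opp; simpl. ring.
  - apply filter_forall. intros s y.
    apply (cont2_slice (fun t y => d t y ^ 2)). cont. apply cd.
  - intros y. cont; try apply cd.
    + apply (cont2_comp (PJ_field A A1)); [cont | apply continuous_clamp; cont |].
      now apply (cont2_PJ_field a).
    + apply (cont2_comp (PJ_field B B1)); [cont | apply continuous_clamp; cont |].
      now apply (cont2_PJ_field b).
Qed.

(** Write [F] and [D] for the primitives of [A] and of [d = A - B]. The transport difference is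
    [F d_x + D B1]. Integrating [2 F d d_x] by parts ([g1] is the derivative of [F d^2], and [F]
    vanishes at both ends) removes [d_x], so no derivative of [d] is left; the nonlocal terms differ
    by a constant [c], which the zero mean of [d] kills. What remains is [g2]. Its quadratic part
    contributes [5 M]; the term with [D] contributes [2 M J^2], where
    [J^2 <= 2 pi * energy <= 8 * energy], and [5 + 16 = 21]. *)
Lemma energy_inequality t M :
  0 < t -> (forall x, - PI <= x <= PI -> Rabs (A t x) <= M) ->
  (forall x, - PI <= x <= PI -> Rabs (B t x) <= M) ->
  (forall x, - PI <= x <= PI -> Rabs (B1 t x) <= M) -> dE t <= 21 * M * energy t.
Proof.
  intros Ht MA MB MB1. pose proof PI_RGT_0 as Hpi. pose proof PI_4 as Hpi4.
  assert (HM : 0 <= M).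
  { specialize (MA 0 ltac:(lra)). pose proof (Rabs_pos (A t 0)). lra. }
  assert (cA : forall x, continuous (A t) x) by (intros; apply cont2_slice, (ext_cont _ _ _ _ HA)).
  assert (cB : forall x, continuous (B t) x) by (intros; apply cont2_slice, (ext_cont _ _ _ _ HB)).
  assert (cA1 : forall x, continuous (A1 t) x) by (intros; apply cont2_slice, (ext_cont1 _ _ _ _ HA)).
  assert (cB1 : forall x, continuous (B1 t) x) by (intros; apply cont2_slice, (ext_cont1 _ _ _ _ HB)).
  assert (cdt : forall x, continuous (d t) x) by (intros; apply cont2_slice, cd).
  set (F := fun x => RInt (A t) (- PI) x).
  set (D := fun x => RInt (d t) (- PI) x).
  assert (dF : forall x, is_derive F x (A t x)) by (intros; now apply is_derive_RInt_cont).
  assert (dD : forall x, is_derive D x (d t x)) by (intros; now apply is_derive_RInt_cont).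
  assert (cF : forall x, continuous F x) by (intros x; eapply is_derive_continuous, dF).
  assert (cD : forall x, continuous D x) by (intros x; eapply is_derive_continuous, dD).
  set (c := / PI * RInt (fun y => A t y ^ 2) (- PI) PI - / PI * RInt (fun y => B t y ^ 2) (- PI) PI).
  set (g1 := fun x => A t x * d t x ^ 2 + 2 * F x * d t x * (A1 t x - B1 t x)).
  set (g2 := fun x => A t x * d t x ^ 2 + 2 * (A t x + B t x) * d t x ^ 2 - 2 * D x * B1 t x * d t x).
  assert (c1 : forall x, continuous g1 x) by (intros; unfold g1; cont; auto).
  assert (c2 : forall x, continuous g2 x) by (intros; unfold g2; cont; auto).
  assert (ED : forall x, D x = F x - RInt (B t) (- PI) x).
  { intros x. unfold D, F. rewrite <- (Rmult_1_l (RInt (A t) _ _)).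
    replace (1 * RInt (A t) (- PI) x - RInt (B t) (- PI) x)
      with (1 * RInt (A t) (- PI) x + (-1) * RInt (B t) (- PI) x) by ring.
    rewrite <- RInt_lin by auto. apply RInt_ext_all. intros y. unfold d. ring. }
  assert (I1 : RInt g1 (- PI) PI = 0).
  { rewrite (FTC_open (fun x => F x * d t x ^ 2)); auto; [|lra| intros; cont; auto|].
    - unfold F at 1. rewrite (ext_mean _ _ _ _ HA) by lra.
      unfold F. rewrite (RInt_point (- PI) (A t)). unfold zero; simpl. ring.
    - intros x Hx.
      pose proof (ext_dx _ _ _ _ HA t x ltac:(lra) Hx) as DA.
      pose proof (ext_dx _ _ _ _ HB t x ltac:(lra) Hx) as DB.
      pose proof (is_derive_minus _ _ _ _ _ DA DB) as Dd.
      apply (is_derive_pow _ 2) in Dd.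
      pose proof (is_derive_mult _ _ _ _ _ (dF x) Dd Rmult_comm) as P.
      apply (is_derive_val _ _ _ _ P).
      unfold g1, d, minus, plus, opp, mult; simpl. ring. }
  assert (I3 : RInt (d t) (- PI) PI = 0).
  { change (D PI = 0). rewrite ED. unfold F.
    rewrite (ext_mean _ _ _ _ HA), (ext_mean _ _ _ _ HB) by lra. eqR. ring. }
  assert (E : dE t = RInt g2 (- PI) PI).
  { unfold dE.
    rewrite (RInt_ext_le _ (fun x => 1 * (-1 * g1 x + 1 * g2 x) + (-2 * c) * d t x)).
    - rewrite (RInt_lin (fun x => -1 * g1 x + 1 * g2 x)), RInt_lin, I1, I3; auto; [eqR; ring|].
      intros; cont; auto.
    - lra.
    - intros x Hx. rewrite clamp_id by lra. unfold PJ_field, g1, g2. rewrite ED.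
      fold (F x). unfold c, d. ring. }
  rewrite E.
  set (J := RInt (fun x => Rabs (d t x)) (- PI) PI).
  assert (cab : forall x, continuous (fun x => Rabs (d t x)) x).
  { intros x. apply (continuous_comp (d t) Rabs); [auto | apply continuous_Rabs]. }
  assert (HD : forall x, - PI <= x <= PI -> Rabs (D x) <= J).
  { intros x Hx. unfold D, J. rewrite (RInt_split _ (- PI) x PI) by auto.
    assert (0 <= RInt (fun x => Rabs (d t x)) x PI).
    { apply RInt_ge_0; [lra | now apply ex_RInt_cont | intros; apply Rabs_pos]. }
    assert (Rabs (RInt (d t) (- PI) x) <= RInt (fun x => Rabs (d t x)) (- PI) x); [|lra].
    apply abs_RInt_le; [lra|]. now apply ex_RInt_cont. }
  assert (CS : J ^ 2 <= 2 * PI * energy t).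
  { replace (2 * PI) with (PI - - PI) by ring.
    replace (energy t) with (RInt (fun x => Rabs (d t x) ^ 2) (- PI) PI).
    - apply (RInt_Cauchy_Schwarz (fun x => Rabs (d t x))); [lra | auto].
    - apply RInt_ext_all. intros x. now rewrite pow2_abs. }
  assert (EN : 0 <= energy t).
  { apply RInt_ge_0; [lra | apply ex_RInt_cont; intros; cont; auto | intros; apply pow2_ge_0]. }
  apply Rle_trans with (RInt (fun x => (5 * M) * d t x ^ 2 + (2 * M * J) * Rabs (d t x)) (- PI) PI).
  - apply RInt_mono; [lra | auto | intros; cont; auto |].
    intros x Hx. unfold g2.
    specialize (MA x Hx). specialize (MB x Hx). specialize (MB1 x Hx). specialize (HD x Hx).
    assert (X1 : (A t x + 2 * (A t x + B t x)) * d t x ^ 2 <= 5 * M * d t x ^ 2).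
    { apply Rmult_le_compat_r; [apply pow2_ge_0|].
      apply Rabs_le_between in MA. apply Rabs_le_between in MB. lra. }
    assert (X2 : - (2 * D x * B1 t x * d t x) <= 2 * M * J * Rabs (d t x)).
    { eapply Rle_trans; [apply Rle_abs|]. rewrite Rabs_Ropp, !Rabs_mult.
      rewrite (Rabs_pos_eq 2) by lra.
      apply Rmult_le_compat_r; [apply Rabs_pos|].
      pose proof (Rmult_le_compat _ _ _ _ (Rabs_pos (D x)) (Rabs_pos (B1 t x)) HD MB1). lra. }
    lra.
  - rewrite (RInt_lin (fun x => d t x ^ 2) (fun x => Rabs (d t x))); auto; [|intros; cont; auto].
    fold J. fold (energy t).
    assert (M * J ^ 2 <= M * (8 * energy t)).
    { apply Rmult_le_compat_l; [lra|]. nra. }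
    lra.
Qed.

Lemma PJ_extension_unique t x : 0 <= t -> - PI <= x <= PI -> A t x = B t x.
Proof.
  intros Ht Hx. pose proof PI_RGT_0 as Hpi. pose proof PI_4 as Hpi4.
  (* The radius [t + 4] covers all times up to [t] as well as [[-pi, pi]], since [PI <= 4]. *)
  destruct (cont2_bounded A (t + 4) (ext_cont _ _ _ _ HA)) as [MA BA].
  destruct (cont2_bounded B (t + 4) (ext_cont _ _ _ _ HB)) as [MB BB].
  destruct (cont2_bounded B1 (t + 4) (ext_cont1 _ _ _ _ HB)) as [MB1 BB1].
  set (M := Rmax MA (Rmax MB MB1)).
  assert (HM : MA <= M /\ MB <= M /\ MB1 <= M).
  { unfold M. pose proof (Rmax_l MA (Rmax MB MB1)). pose proof (Rmax_r MA (Rmax MB MB1)).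
    pose proof (Rmax_l MB MB1). pose proof (Rmax_r MB MB1). lra. }
  enough (d t x = 0) by (unfold d in *; lra).
  apply (RInt_sqr_zero (d t) (- PI) PI); [lra | intros; apply cont2_slice, cd | | exact Hx].
  apply (Gronwall_zero energy dE (21 * M) t); auto.
  - intros s _. apply energy_continuous.
  - intros s Hs. apply energy_derive; lra.
  - intros s Hs. apply energy_inequality; [lra | | |]; intros y Hy.
    + specialize (BA s y). rewrite !Rabs_le_between in BA. apply Rabs_le_between.
      specialize (BA ltac:(lra) ltac:(lra)). lra.
    + specialize (BB s y). rewrite !Rabs_le_between in BB. apply Rabs_le_between.
      specialize (BB ltac:(lra) ltac:(lra)). lra.
    + specialize (BB1 s y). rewrite !Rabs_le_between in BB1. apply Rabs_le_between.
      specialize (BB1 ltac:(lra) ltac:(lra)). lra.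
  - unfold energy. rewrite (RInt_ext_le _ (fun _ => 0)); [|lra|].
    + rewrite RInt_const_R. lra.
    + intros y Hy. unfold d.
      rewrite (ext_init _ _ _ _ HA), (ext_init _ _ _ _ HB) by lra. ring.
Qed.

End Energy.

Lemma PJ_unique a0 a b :
  PJ_solution a0 a -> PJ_solution a0 b ->
  forall t x, 0 <= t -> - PI <= x <= PI -> a t x = b t x.
Proof.
  intros Ha Hb t x Ht Hx.
  destruct (PJ_extension_exists a0 a Ha) as [A [A1 HA]].
  destruct (PJ_extension_exists a0 b Hb) as [B [B1 HB]].
  rewrite <- (ext_eq _ _ _ _ HA), <- (ext_eq _ _ _ _ HB) by lra.
  now apply (PJ_extension_unique a0 a b A A1 B B1).
Qed.

(** * The explicit solution *)

Section Explicit.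

Variables (G g1 g2 g3 : R -> R) (m : R).
Hypothesis cG : forall x, continuous G x.
Hypothesis cg1 : forall x, continuous g1 x.
Hypothesis cg2 : forall x, continuous g2 x.
Hypothesis cg3 : forall x, continuous g3 x.
Hypothesis dG : forall x, - PI < x < PI -> is_derive G x (g1 x).
Hypothesis dg1 : forall x, - PI < x < PI -> is_derive g1 x (g2 x).
Hypothesis dg2 : forall x, - PI < x < PI -> is_derive g2 x (g3 x).
Hypothesis m_pos : 0 < m.
Hypothesis G_le : forall x, G x <= m.
Hypothesis G_ge : forall x, - (3 / 2) <= G x.
Hypothesis G_mean : RInt G (- PI) PI = 0.

Definition dom (s : R) : Prop := - / 2 < s < / m.

(* [X s] is the flow map at the rescaled time [s], with Jacobian [J], and [label s] is its
   inverse on [-pi,pi]; [Xs], [K1], [K2] are derivatives in [s], and [h1], [h2], [h3] are the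
   x-derivatives of the solution [h0]. *)
Definition r (s z : R) : R := 1 - s * G z.
Definition I0 (s z : R) : R := RInt (fun y => / r s y) (- PI) z.
Definition I1 (s z : R) : R := RInt (fun y => G y / r s y ^ 2) (- PI) z.
Definition I2 (s z : R) : R := RInt (fun y => 2 * G y ^ 2 / r s y ^ 3) (- PI) z.
Definition K (s : R) : R := I0 s PI / (2 * PI).
Definition K1 (s : R) : R := I1 s PI / (2 * PI).
Definition K2 (s : R) : R := I2 s PI / (2 * PI).
Definition X (s z : R) : R := I0 s z / K s - PI.
Definition Xs (s z : R) : R := I1 s z / K s - I0 s z * K1 s / K s ^ 2.
Definition J (s z : R) : R := / (K s * r s z).
Definition label (s x : R) : R := epsilon (inhabits 0) (fun z => - PI <= z <= PI /\ X s z = clamp x).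

(** [h0] is [- psi_t / psi] read at the label, with [psi = K r] the inverse Jacobian and
    [d/dt = K^{-2} d/ds]. Each further [h] arises from the previous one through [d/dx = K r d/dz];
    the identity [r + s G = 1] simplifies [h1]. *)
Definition h0 (s x : R) : R := (G (label s x) / r s (label s x) - K1 s / K s) / K s ^ 2.
Definition h1 (s x : R) : R := g1 (label s x) / (K s * r s (label s x)).
Definition h2 (s x : R) : R := g2 (label s x) + s * g1 (label s x) ^ 2 / r s (label s x).
Definition h3 (s x : R) : R := K s * (g3 (label s x) * r s (label s x) + 2 * s * g1 (label s x) * g2 (label s x)
                            + s ^ 2 * g1 (label s x) ^ 3 / r s (label s x)).

Lemma locally_dom s : dom s -> locally s dom.
Proof. intros H. apply (locally_Ioo (- / 2) (/ m)); auto. Qed.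

Lemma dom_m s : dom s -> m * s < 1.
Proof.
  intros [_ H]. apply Rmult_lt_compat_l with (r := m) in H; [|exact m_pos].
  rewrite Rinv_r in H; lra.
Qed.

Lemma r_pos s z : dom s -> 0 < r s z.
Proof.
  intros H. pose proof (dom_m s H). destruct H as [H _]. unfold r.
  pose proof (G_le z). pose proof (G_ge z).
  destruct (Rle_dec 0 s); nra.
Qed.

Lemma r_neq s z : dom s -> r s z <> 0.
Proof. intros H. pose proof (r_pos s z H). lra. Qed.

Lemma cont2_r p : cont2 r p.
Proof.
  unfold r. cont. apply (continuous_comp1 G snd); [cont | apply cG].
Qed.

Lemma continuous_r s z : continuous (r s) z.
Proof. apply cont2_slice, cont2_r. Qed.

Lemma cont2_inv_r s z : dom s -> cont2 (fun s y => / r s y) (s, z).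
Proof.
  intros H. cont; [apply cont2_r | now apply r_neq].
Qed.

Lemma cont_inv_r s y : dom s -> continuous (fun y => / r s y) y.
Proof. intros H. now apply (cont2_slice (fun s y => / r s y)), cont2_inv_r. Qed.

Lemma cont_I1 s y : dom s -> continuous (fun y => G y / r s y ^ 2) y.
Proof.
  intros H. cont; auto; [apply continuous_r | now apply pow_nonzero, r_neq].
Qed.

Lemma cont_I2 s y : dom s -> continuous (fun y => 2 * G y ^ 2 / r s y ^ 3) y.
Proof.
  intros H. cont; auto; [apply continuous_r | now apply pow_nonzero, r_neq].
Qed.

Lemma is_derive_I0 s z : dom s -> is_derive (fun s => I0 s z) s (I1 s z).
Proof.
  intros H. apply (is_derive_RInt_param2 (fun s y => / r s y) (fun s y => G y / r s y ^ 2)).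
  - apply (filter_imp dom); [|now apply locally_dom]. intros u Hu y.
    pose proof (r_neq u y Hu) as N. unfold r in *. auto_derive; [exact N|].
    field. exact N.
  - apply (filter_imp dom); [|now apply locally_dom]. intros u Hu y. now apply cont_inv_r.
  - intros y. cont.
    + apply (continuous_comp1 G snd); [cont | apply cG].
    + apply cont2_r.
    + now apply pow_nonzero, r_neq.
Qed.

Lemma is_derive_I1 s z : dom s -> is_derive (fun s => I1 s z) s (I2 s z).
Proof.
  intros H. apply (is_derive_RInt_param2 (fun s y => G y / r s y ^ 2)
                                         (fun s y => 2 * G y ^ 2 / r s y ^ 3)).
  - apply (filter_imp dom); [|now apply locally_dom]. intros u Hu y.
    pose proof (r_neq u y Hu) as N. unfold r in *. auto_derive.
    + rewrite Rmult_1_r. now apply Rmult_integral_contrapositive.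
    + field. exact N.
  - apply (filter_imp dom); [|now apply locally_dom]. intros u Hu y. now apply cont_I1.
  - intros y. cont.
    + apply (continuous_comp1 G snd); [cont | apply cG].
    + apply cont2_r.
    + now apply pow_nonzero, r_neq.
Qed.

Lemma is_derive_K s : dom s -> is_derive K s (K1 s).
Proof.
  intros H. unfold K, K1, Rdiv.
  apply (is_derive_ext (fun s => / (2 * PI) * I0 s PI)); [intros; apply Rmult_comm|].
  rewrite (Rmult_comm (I1 s PI)). apply is_derive_scal. now apply is_derive_I0.
Qed.

Lemma is_derive_K1 s : dom s -> is_derive K1 s (K2 s).
Proof.
  intros H. unfold K1, K2, Rdiv.
  apply (is_derive_ext (fun s => / (2 * PI) * I1 s PI)); [intros; apply Rmult_comm|].
  rewrite (Rmult_comm (I2 s PI)). apply is_derive_scal. now apply is_derive_I1.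
Qed.

Lemma continuous_K s : dom s -> continuous K s.
Proof. intros H. eapply is_derive_continuous, is_derive_K, H. Qed.

Lemma continuous_K1 s : dom s -> continuous K1 s.
Proof. intros H. eapply is_derive_continuous, is_derive_K1, H. Qed.

Lemma K_pos s : dom s -> 0 < K s.
Proof.
  intros H. pose proof PI_RGT_0. apply Rdiv_lt_0_compat; [|lra].
  apply RInt_gt_0; [lra | |].
  - intros x _. apply Rinv_0_lt_compat. now apply r_pos.
  - intros x _. now apply cont_inv_r.
Qed.

Lemma I0_PI s : I0 s PI = 2 * PI * K s.
Proof. pose proof PI_RGT_0. unfold K. field. lra. Qed.

Lemma I1_PI s : I1 s PI = 2 * PI * K1 s.
Proof. pose proof PI_RGT_0. unfold K1. field. lra. Qed.

Lemma I2_PI s : I2 s PI = 2 * PI * K2 s.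
Proof. pose proof PI_RGT_0. unfold K2. field. lra. Qed.

Lemma J_pos s z : dom s -> 0 < J s z.
Proof.
  intros H. apply Rinv_0_lt_compat, Rmult_lt_0_compat; [now apply K_pos | now apply r_pos].
Qed.

(** * The flow map and its inverse *)

Lemma is_derive_X s z : dom s -> is_derive (X s) z (J s z).
Proof.
  intros H. pose proof (K_pos s H). unfold X.
  pose proof (is_derive_RInt_cont (fun y => / r s y) (- PI) z (fun y => cont_inv_r s y H)) as D.
  apply (is_derive_scal _ _ (/ K s)) in D.
  pose proof (is_derive_minus _ _ _ _ _ D (is_derive_const PI z)) as D'.
  apply (is_derive_ext (fun y => minus (/ K s * RInt (fun y0 => / r s y0) (- PI) y) PI)).
  - intros t. unfold I0, Rdiv. rewrite Rmult_comm. reflexivity.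
  - apply (is_derive_val _ _ _ _ D'). unfold J, minus, plus, opp, zero; simpl.
    pose proof (r_pos s z H). field. lra.
Qed.

Lemma X_incr s z z' : dom s -> z < z' -> X s z < X s z'.
Proof.
  intros H Hz.
  destruct (MVT_open (X s) (J s) z z') as [c [_ E]]; [lra | | |].
  - intros x. eapply is_derive_continuous, is_derive_X, H.
  - intros x _. now apply is_derive_X.
  - pose proof (J_pos s c H). nra.
Qed.

Lemma X_left s : X s (- PI) = - PI.
Proof.
  unfold X, I0. rewrite (RInt_point (- PI) (fun y => / r s y)).
  unfold zero; simpl. unfold Rdiv. ring.
Qed.

Lemma X_right s : dom s -> X s PI = PI.
Proof.
  intros H. pose proof (K_pos s H). unfold X. rewrite I0_PI. field. lra.
Qed.

Lemma label_spec s x : dom s -> - PI <= label s x <= PI /\ X s (label s x) = clamp x.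
Proof.
  intros H. unfold label.
  apply (epsilon_spec (inhabits 0) (fun z => - PI <= z <= PI /\ X s z = clamp x)).
  pose proof PI_RGT_0.
  destruct (IVT_gen (X s) (- PI) PI (clamp x)) as [z [Hz E]].
  - intros y. apply continuous_pt. eapply is_derive_continuous, is_derive_X, H.
  - rewrite X_left, X_right, Rmin_left, Rmax_right by (auto; lra). apply clamp_range.
  - rewrite Rmin_left, Rmax_right in Hz by lra. now exists z.
Qed.

Lemma label_eq s x z : dom s -> X s z = clamp x -> label s x = z.
Proof.
  intros H E. destruct (label_spec s x H) as [_ E'].
  destruct (Rtotal_order (label s x) z) as [L|[L|L]]; auto.
  - apply (X_incr s) in L; auto. lra.
  - apply (X_incr s) in L; auto. lra.
Qed.

Lemma label_left s : dom s -> label s (- PI) = - PI.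
Proof.
  intros H. apply label_eq; [auto|]. pose proof PI_RGT_0. rewrite clamp_id, X_left by lra. lra.
Qed.

Lemma label_right s : dom s -> label s PI = PI.
Proof.
  intros H. apply label_eq; [auto|]. pose proof PI_RGT_0. rewrite clamp_id, X_right by (auto; lra). lra.
Qed.

Lemma label_interior s x : dom s -> - PI < x < PI -> - PI < label s x < PI.
Proof.
  intros H Hx. destruct (label_spec s x H) as [[A B] E]. rewrite clamp_id in E by lra.
  split.
  - destruct A as [A|A]; [exact A|]. rewrite <- A, X_left in E. lra.
  - destruct B as [B|B]; [exact B|]. rewrite B, X_right in E by exact H. lra.
Qed.

(** The pair [(s, x)] is the parameter of the implicit equation [X s z = clamp x]; strict
    monotonicity of [X s] does the rest. *)
Lemma cont2_label s x : dom s -> cont2 label (s, x).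
Proof.
  intros H.
  assert (L : locally (s, x) (fun u : R * R => dom (fst u)))
    by exact (continuous_fst (U := R_UniformSpace) (V := R_UniformSpace) s x dom (locally_dom s H)).
  apply (implicit_continuous (fun u z => X (fst u) z - clamp (snd u))
           (fun u => label (fst u) (snd u)) (fun _ => True)).
  - intros z _. apply continuous_Rminus; [|apply continuous_clamp; cont].
    unfold X. cont.
    + apply (continuous_comp1 (fun s => I0 s z) fst); [cont|].
      eapply is_derive_continuous, is_derive_I0, H.
    + apply (continuous_comp1 K fst); [cont | now apply continuous_K].
    + pose proof (K_pos s H). simpl. lra.
  - revert L. apply filter_imp. intros u Hu. split; [|exact I].
    exact (Rminus_diag_eq _ _ (proj2 (label_spec _ (snd u) Hu))).
  - now apply filter_forall.
  - revert L. apply filter_imp. intros u Hu z z' _ _ Hz.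
    apply (X_incr (fst u)) in Hz; auto. lra.
Qed.

Lemma cont2_J s z : dom s -> cont2 J (s, z).
Proof.
  intros H. unfold J. pose proof (K_pos s H). pose proof (r_pos s z H). cont.
  - apply (continuous_comp1 K fst); [cont | now apply continuous_K].
  - apply cont2_r.
  - simpl. nra.
Qed.

Lemma is_derive_label_x s x : dom s -> - PI < x < PI -> is_derive (label s) x (K s * r s (label s x)).
Proof.
  intros H Hx. pose proof (K_pos s H). pose proof (r_pos s (label s x) H). pose proof (J_pos s (label s x) H).
  set (d := Rmin (x + PI) (PI - x)).
  assert (Hd : 0 < d /\ d <= x + PI /\ d <= PI - x).
  { unfold d. pose proof (Rmin_l (x + PI) (PI - x)). pose proof (Rmin_r (x + PI) (PI - x)).
    split; [apply Rmin_pos; lra | lra]. }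
  apply (is_derive_val _ _ (- (-1) / J s (label s x))).
  - apply (implicit_derive (fun x z => X s z - x) (fun _ z => J s z) (label s) x (-1) d); [lra| | | | | |].
    + intros u z _ _.
      pose proof (is_derive_minus _ _ _ _ _ (is_derive_X s z H) (is_derive_const u z)) as D.
      apply (is_derive_val _ _ _ _ D). unfold minus, plus, opp, zero; simpl. ring.
    + intros u Hu. rewrite (proj2 (label_spec s u H)). apply Rabs_lt_between in Hu.
      rewrite clamp_id by lra. ring.
    + apply (cont2_comp J (fun _ => s) snd); [cont | cont | now apply cont2_J].
    + lra.
    + now apply cont2_slice, cont2_label.
    + auto_derive; auto; ring.
  - unfold J. field. lra.
Qed.

Lemma is_derive_X_s s z : dom s -> is_derive (fun s => X s z) s (Xs s z).
Proof.
  intros H. pose proof (K_pos s H). unfold X, Xs.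
  pose proof (is_derive_I0 s z H) as D0. pose proof (is_derive_K s H) as DK.
  pose proof (is_derive_div (fun s => I0 s z) K s _ _ D0 DK ltac:(lra)) as D.
  pose proof (is_derive_minus _ _ _ _ _ D (is_derive_const PI s)) as D'.
  apply (is_derive_val _ _ _ _ D'). unfold minus, plus, opp, zero; simpl. field. lra.
Qed.

Lemma is_derive_label_s s x : dom s -> is_derive (fun s => label s x) s (- Xs s (label s x) * (K s * r s (label s x))).
Proof.
  intros H. pose proof (K_pos s H). pose proof (r_pos s (label s x) H). pose proof (J_pos s (label s x) H).
  pose proof (locally_dom s H) as L. apply locally_eps in L. destruct L as [d [Hd L]].
  apply (is_derive_val _ _ (- Xs s (label s x) / J s (label s x))).
  - apply (implicit_derive (fun s z => X s z - clamp x) J (fun s => label s x) s _ d); [lra| | | | | |].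
    + intros u z Hu _.
      pose proof (is_derive_minus _ _ _ _ _ (is_derive_X u z (L u Hu)) (is_derive_const (clamp x) z)) as D.
      apply (is_derive_val _ _ _ _ D). unfold minus, plus, opp, zero; simpl. ring.
    + intros u Hu. rewrite (proj2 (label_spec u x (L u Hu))). ring.
    + now apply cont2_J.
    + lra.
    + apply (cont2_comp label (fun s => s) (fun _ => x)); [cont | cont | now apply cont2_label].
    + pose proof (is_derive_minus _ _ _ _ _ (is_derive_X_s s (label s x) H) (is_derive_const (clamp x) s)) as D.
      apply (is_derive_val _ _ _ _ D). unfold minus, plus, opp, zero; simpl. ring.
  - unfold J. field. lra.
Qed.

Lemma Xs_left s : Xs s (- PI) = 0.
Proof.
  unfold Xs, I0, I1. rewrite (RInt_point (- PI) (fun y => / r s y)).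
  rewrite (RInt_point (- PI) (fun y => G y / r s y ^ 2)).
  unfold zero; simpl. unfold Rdiv. ring.
Qed.

Lemma Xs_right s : dom s -> Xs s PI = 0.
Proof.
  intros H. pose proof (K_pos s H). unfold Xs. rewrite I0_PI, I1_PI. field. lra.
Qed.

(* At [x = -pi, pi] the composition [G (label s x)] is constant in [s]; [G] itself need not be
   differentiable there. *)
Lemma is_derive_GZ s x : dom s -> - PI <= x <= PI ->
  is_derive (fun s => G (label s x)) s (- Xs s (label s x) * (K s * r s (label s x)) * g1 (label s x)).
Proof.
  intros H Hx.
  assert (E : forall x0, Xs s x0 = 0 -> (forall s, dom s -> label s x0 = x0) ->
    is_derive (fun s => G (label s x0)) s (- Xs s (label s x0) * (K s * r s (label s x0)) * g1 (label s x0))).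
  { intros x0 E0 EZ. apply (is_derive_ext_loc (fun _ => G x0)).
    - apply (filter_imp dom); [|now apply locally_dom]. intros u Hu. now rewrite EZ.
    - rewrite EZ, E0 by exact H.
      replace (- 0 * (K s * r s x0) * g1 x0) with 0 by ring.
      apply (is_derive_const (V := R_NormedModule)). }
  destruct (Req_dec x (- PI)) as [->|N1]; [apply E; [apply Xs_left | apply label_left]|].
  destruct (Req_dec x PI) as [->|N2]; [apply E; [now apply Xs_right | apply label_right]|].
  apply (is_derive_comp G (fun s => label s x)).
  - apply dG, label_interior; [exact H | lra].
  - now apply is_derive_label_s.
Qed.

Lemma cont2_hZ (f : R -> R) s x : dom s -> (forall y, continuous f y) ->
  cont2 (fun s x => f (label s x)) (s, x).
Proof.
  intros H Hf. apply (continuous_comp1 f (fun q => label (fst q) (snd q))); [now apply cont2_label | apply Hf].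
Qed.

Lemma cont2_rZ s x : dom s -> cont2 (fun s x => r s (label s x)) (s, x).
Proof.
  intros H. apply (cont2_comp r fst (fun q => label (fst q) (snd q)));
    [cont | now apply cont2_label | apply cont2_r].
Qed.

Lemma cont2_K s x : dom s -> cont2 (fun s _ => K s) (s, x).
Proof. intros H. apply (continuous_comp1 K fst); [cont | now apply continuous_K]. Qed.

Lemma cont2_K1 s x : dom s -> cont2 (fun s _ => K1 s) (s, x).
Proof. intros H. apply (continuous_comp1 K1 fst); [cont | now apply continuous_K1]. Qed.

Ltac contZ H :=
  cont;
  lazymatch goal with
  | |- continuous (fun q => K _) _ => now apply cont2_K
  | |- continuous (fun q => K1 _) _ => now apply cont2_K1
  | |- continuous (fun q => r _ _) _ => now apply cont2_rZ
  | |- continuous (fun q => ?f (label _ _)) _ => now apply (cont2_hZ f)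
  | |- _ => idtac
  end.

Lemma cont2_h0 s x : dom s -> cont2 h0 (s, x).
Proof.
  intros H. pose proof (K_pos s H). pose proof (r_pos s (label s x) H). unfold h0.
  contZ H; simpl; nra.
Qed.

Lemma cont2_h1 s x : dom s -> cont2 h1 (s, x).
Proof.
  intros H. pose proof (K_pos s H). pose proof (r_pos s (label s x) H). unfold h1.
  contZ H; simpl; nra.
Qed.

Lemma cont2_h2 s x : dom s -> cont2 h2 (s, x).
Proof.
  intros H. pose proof (K_pos s H). pose proof (r_pos s (label s x) H). unfold h2.
  contZ H; simpl; nra.
Qed.

Lemma cont2_h3 s x : dom s -> cont2 h3 (s, x).
Proof.
  intros H. pose proof (K_pos s H). pose proof (r_pos s (label s x) H). unfold h3.
  contZ H; simpl; nra.
Qed.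

(** * Derivatives of the explicit solution in Eulerian coordinates *)

Lemma is_derive_fZ (f df : R -> R) s x : dom s -> - PI < x < PI ->
  (forall x, - PI < x < PI -> is_derive f x (df x)) ->
  is_derive (fun x => f (label s x)) x (K s * r s (label s x) * df (label s x)).
Proof.
  intros H Hx Hf. apply (is_derive_comp f (label s)).
  - apply Hf, label_interior; auto.
  - now apply is_derive_label_x.
Qed.

Lemma is_derive_h0 s x : dom s -> - PI < x < PI -> is_derive (h0 s) x (h1 s x).
Proof.
  intros H Hx. pose proof (K_pos s H). pose proof (r_pos s (label s x) H) as Hr.
  pose proof (is_derive_fZ G g1 s x H Hx dG) as D. unfold h0, h1, r in *.
  set (u := fun x => G (label s x)) in *. change (G (label s x)) with (u x) in *.
  assert (ex_derive u x) by (eexists; exact D).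
  apply (is_derive_ext (fun x => (u x / (1 - s * u x) - K1 s / K s) / K s ^ 2)); [reflexivity|].
  auto_derive.
  - repeat split; auto; lra.
  - rewrite_Derive u D. field. lra.
Qed.

Lemma is_derive_h1 s x : dom s -> - PI < x < PI -> is_derive (h1 s) x (h2 s x).
Proof.
  intros H Hx. pose proof (K_pos s H). pose proof (r_pos s (label s x) H) as Hr.
  pose proof (is_derive_fZ G g1 s x H Hx dG) as D.
  pose proof (is_derive_fZ g1 g2 s x H Hx dg1) as D1. unfold h1, h2, r in *.
  set (u := fun x => G (label s x)) in *. change (G (label s x)) with (u x) in *.
  set (u1 := fun x => g1 (label s x)) in *. change (g1 (label s x)) with (u1 x) in *.
  assert (ex_derive u x) by (eexists; exact D).
  assert (ex_derive u1 x) by (eexists; exact D1).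
  apply (is_derive_ext (fun x => u1 x / (K s * (1 - s * u x)))); [reflexivity|].
  auto_derive.
  - repeat split; auto. nra.
  - rewrite_Derive u D; rewrite_Derive u1 D1. field. lra.
Qed.

Lemma is_derive_h2 s x : dom s -> - PI < x < PI -> is_derive (h2 s) x (h3 s x).
Proof.
  intros H Hx. pose proof (K_pos s H). pose proof (r_pos s (label s x) H) as Hr.
  pose proof (is_derive_fZ G g1 s x H Hx dG) as D.
  pose proof (is_derive_fZ g1 g2 s x H Hx dg1) as D1.
  pose proof (is_derive_fZ g2 g3 s x H Hx dg2) as D2. unfold h2, h3, r in *.
  set (u := fun x => G (label s x)) in *. change (G (label s x)) with (u x) in *.
  set (u1 := fun x => g1 (label s x)) in *. change (g1 (label s x)) with (u1 x) in *.
  set (u2 := fun x => g2 (label s x)) in *. change (g2 (label s x)) with (u2 x) in *.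
  assert (ex_derive u x) by (eexists; exact D).
  assert (ex_derive u1 x) by (eexists; exact D1).
  assert (ex_derive u2 x) by (eexists; exact D2).
  apply (is_derive_ext (fun x => u2 x + s * u1 x ^ 2 / (1 - s * u x))); [reflexivity|].
  auto_derive.
  - repeat split; auto; lra.
  - rewrite_Derive u D; rewrite_Derive u1 D1; rewrite_Derive u2 D2.
    field. lra.
Qed.

Lemma continuous_label s x : dom s -> continuous (label s) x.
Proof. intros H. now apply cont2_slice, cont2_label. Qed.

Lemma continuous_h0 s x : dom s -> continuous (h0 s) x.
Proof. intros H. now apply cont2_slice, cont2_h0. Qed.

(* The Eulerian integral of [h0] is the velocity [X_t = Xs / K^2] along the flow. *)
Lemma RInt_h0 s x : dom s -> - PI <= x <= PI -> RInt (h0 s) (- PI) x = Xs s (label s x) / K s ^ 2.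
Proof.
  intros H Hx. pose proof (K_pos s H) as HK.
  assert (DI0 : forall z, is_derive (I0 s) z (/ r s z)).
  { intros z. apply (is_derive_RInt_cont (fun y => / r s y)). intros; now apply cont_inv_r. }
  assert (DI1 : forall z, is_derive (I1 s) z (G z / r s z ^ 2)).
  { intros z. apply (is_derive_RInt_cont (fun y => G y / r s y ^ 2)). intros; now apply cont_I1. }
  assert (D : forall z, is_derive (Xs s) z (G z / r s z ^ 2 / K s - / r s z * K1 s / K s ^ 2)).
  { intros z. unfold Xs.
    assert (ex_derive (I0 s) z) by (eexists; apply DI0).
    assert (ex_derive (I1 s) z) by (eexists; apply DI1).
    auto_derive; [auto|].
    rewrite_Derive (I0 s) (DI0 z).
    rewrite_Derive (I1 s) (DI1 z).
    pose proof (r_neq s z H). field. lra. }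
  rewrite (FTC_open (fun x => Xs s (label s x) / K s ^ 2)).
  - rewrite label_left, Xs_left by exact H. unfold Rdiv. eqR. ring.
  - lra.
  - intros y _. cont. 2: apply pow_nonzero; lra.
    apply (continuous_comp1 (Xs s) (label s)); [now apply continuous_label|].
    eapply is_derive_continuous, D.
  - intros y. now apply continuous_h0.
  - intros y Hy.
    pose proof (is_derive_comp (Xs s) (label s) y _ _ (D (label s y)) (is_derive_label_x s y H ltac:(lra))) as C.
    apply (is_derive_scal _ _ (/ K s ^ 2)) in C.
    apply (is_derive_ext (fun x => / K s ^ 2 * Xs s (label s x))).
    { intros t. unfold Rdiv. apply Rmult_comm. }
    apply (is_derive_val _ _ _ _ C). unfold h0, scal; simpl; unfold mult; simpl.
    pose proof (r_neq s (label s y) H). field. lra.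
Qed.

(** After the change of variables [x = X s z] the integrand is a combination of those of [I0], [I1],
    [I2], with primitive [P]. The result says that [(1/pi) int a^2] equals [K_tt / K] in physical
    time: [K] solves the same linear equation as the inverse Jacobian. *)
Lemma RInt_h0_sqr s : dom s ->
  RInt (fun x => h0 s x ^ 2) (- PI) PI = PI / K s ^ 5 * (K2 s - 2 * K1 s ^ 2 / K s).
Proof.
  intros H. pose proof (K_pos s H) as HK. pose proof PI_RGT_0.
  set (k := K1 s / K s).
  set (P := fun z => / K s ^ 5 * (/ 2 * I2 s z - 2 * k * I1 s z + k ^ 2 * I0 s z)).
  assert (DP : forall z, is_derive P z (((G z / r s z - k) / K s ^ 2) ^ 2 / (K s * r s z))).
  { intros z.
    assert (D0 : is_derive (I0 s) z (/ r s z)).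
    { apply (is_derive_RInt_cont (fun y => / r s y)). intros; now apply cont_inv_r. }
    assert (D1 : is_derive (I1 s) z (G z / r s z ^ 2)).
    { apply (is_derive_RInt_cont (fun y => G y / r s y ^ 2)). intros; now apply cont_I1. }
    assert (D2 : is_derive (I2 s) z (2 * G z ^ 2 / r s z ^ 3)).
    { apply (is_derive_RInt_cont (fun y => 2 * G y ^ 2 / r s y ^ 3)). intros; now apply cont_I2. }
    assert (ex_derive (I0 s) z) by (eexists; apply D0).
    assert (ex_derive (I1 s) z) by (eexists; apply D1).
    assert (ex_derive (I2 s) z) by (eexists; apply D2).
    unfold P. auto_derive; [auto|].
    rewrite_Derive (I0 s) D0.
    rewrite_Derive (I1 s) D1.
    rewrite_Derive (I2 s) D2.
    pose proof (r_neq s z H). field. lra. }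
  rewrite (FTC_open (fun x => P (label s x))).
  - rewrite label_left, label_right by exact H. unfold P. rewrite I0_PI, I1_PI, I2_PI.
    unfold I0, I1, I2. rewrite (RInt_point (- PI) (fun y => / r s y)).
    rewrite (RInt_point (- PI) (fun y => G y / r s y ^ 2)).
    rewrite (RInt_point (- PI) (fun y => 2 * G y ^ 2 / r s y ^ 3)).
    unfold zero; simpl. unfold k. field. lra.
  - lra.
  - intros y _. apply (continuous_comp1 P (label s)); [now apply continuous_label|].
    eapply is_derive_continuous, DP.
  - intros y. cont. now apply continuous_h0.
  - intros y Hy.
    pose proof (is_derive_comp P (label s) y _ _ (DP (label s y)) (is_derive_label_x s y H ltac:(lra))) as C.
    apply (is_derive_val _ _ _ _ C). unfold h0, scal; simpl; unfold mult; simpl.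
    pose proof (r_neq s (label s y) H). unfold k. field. lra.
Qed.

(** The equation in rescaled time; the factor [K s ^ 2] is [dt/ds]. The endpoints are included,
    which the pointwise equation for the solution needs. *)
Lemma is_derive_h0_s s x : dom s -> - PI <= x <= PI ->
  is_derive (fun s => h0 s x) s
    (K s ^ 2 * (- RInt (h0 s) (- PI) x * h1 s x + h0 s x ^ 2
                - / PI * RInt (fun y => h0 s y ^ 2) (- PI) PI)).
Proof.
  intros H Hx. pose proof (K_pos s H) as HK. pose proof PI_RGT_0.
  pose proof (is_derive_GZ s x H Hx) as D.
  pose proof (is_derive_K s H) as DK. pose proof (is_derive_K1 s H) as DK1.
  pose proof (r_pos s (label s x) H) as Hr.
  rewrite RInt_h0, RInt_h0_sqr by auto.
  unfold h0, h1, r in *.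
  set (u := fun s => G (label s x)) in *. change (G (label s x)) with (u s) in *.
  assert (ex_derive u s) by (eexists; exact D).
  assert (ex_derive K s) by (eexists; exact DK).
  assert (ex_derive K1 s) by (eexists; exact DK1).
  apply (is_derive_ext (fun s => (u s / (1 - s * u s) - K1 s / K s) / K s ^ 2)); [reflexivity|].
  auto_derive.
  - repeat split; auto; try lra. rewrite Rmult_1_r. nra.
  - rewrite_Derive u D.
    rewrite_Derive K DK.
    rewrite_Derive K1 DK1.
    field. lra.
Qed.

(** * Initial values and the return to physical time *)

Lemma dom_0 : dom 0.
Proof. unfold dom. pose proof (Rinv_0_lt_compat _ m_pos). lra. Qed.

Lemma K_0 : K 0 = 1.
Proof.
  pose proof PI_RGT_0. unfold K, I0.
  rewrite (RInt_ext_all _ (fun _ => 1)).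
  - rewrite RInt_const_R. field. lra.
  - intros x. unfold r. rewrite Rmult_0_l, Rminus_0_r. apply Rinv_1.
Qed.

Lemma K1_0 : K1 0 = 0.
Proof.
  unfold K1, I1. rewrite (RInt_ext_all _ G).
  - rewrite G_mean. unfold Rdiv. ring.
  - intros x. unfold r. rewrite Rmult_0_l, Rminus_0_r. field.
Qed.

Lemma X_0 z : X 0 z = z.
Proof.
  unfold X, I0. rewrite K_0, (RInt_ext_all _ (fun _ => 1)).
  - rewrite RInt_const_R. field.
  - intros x. unfold r. rewrite Rmult_0_l, Rminus_0_r. apply Rinv_1.
Qed.

Lemma h0_0 x : - PI <= x <= PI -> h0 0 x = G x.
Proof.
  intros Hx. unfold h0, r. rewrite (label_eq 0 x x); [|apply dom_0 | now rewrite X_0, clamp_id].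
  rewrite K1_0, K_0. field.
Qed.

(* The physical time is [t = T s], i.e. [s' = K(s)^{-2}]. *)
Definition T (s : R) : R := RInt (fun u => K u ^ 2) 0 s.

Lemma is_derive_T s : dom s -> is_derive T s (K s ^ 2).
Proof.
  intros H. pose proof dom_0 as D0. apply (is_derive_RInt (fun u => K u ^ 2) T 0 s).
  - apply (filter_imp dom); [|now apply locally_dom]. intros u Hu.
    apply (RInt_correct (fun u => K u ^ 2)).
    apply (ex_RInt_continuous (V := R_CompleteNormedModule)). intros y Hy. cont.
    apply continuous_K. unfold dom, Rmin, Rmax in *. destruct (Rle_dec 0 u); lra.
  - cont. now apply continuous_K.
Qed.

Lemma T_0 : T 0 = 0.
Proof. apply (RInt_point 0 (fun u => K u ^ 2)). Qed.

Lemma T_incr s s' : dom s -> dom s' -> s < s' -> T s < T s'.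
Proof.
  intros H H' L.
  destruct (MVT_gen T s s' (fun s => K s ^ 2)) as [c [Hc E]].
  - rewrite Rmin_left, Rmax_right by lra. intros x Hx. apply is_derive_T. unfold dom in *. lra.
  - rewrite Rmin_left, Rmax_right by lra. intros x Hx. apply continuous_pt.
    eapply is_derive_continuous, is_derive_T. unfold dom in *. lra.
  - rewrite Rmin_left, Rmax_right in Hc by lra.
    assert (Hc' : dom c) by (unfold dom in *; lra).
    pose proof (K_pos c Hc'). assert (0 < K c ^ 2) by (apply pow_lt; lra). nra.
Qed.

Variable c : R.
Hypothesis c_pos : 0 < c.
Hypothesis K_blowup : forall s, 0 <= s -> dom s -> c <= (1 - m * s) * K s ^ 2.

(** The blow-up hypothesis gives [dT/ds = K^2 >= c / (1 - m s)], so [T] grows at least like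
    [- (c / m) ln (1 - m s)]. This is what makes the solution global in time. *)
Lemma T_unbounded t : exists s, dom s /\ 0 < s /\ t < T s.
Proof.
  pose proof (Rinv_0_lt_compat _ m_pos) as Hm'.
  assert (B : forall s, 0 <= s -> dom s -> - (c / m) * ln (1 - m * s) <= T s).
  { intros s Hs H. pose proof (dom_m s H).
    assert (S : (fun s => - (c / m) * ln (1 - m * s)) s - (fun s => - (c / m) * ln (1 - m * s)) 0
              <= T s - T 0).
    { assert (D : forall u, 0 <= u <= s ->
        is_derive (fun s => - (c / m) * ln (1 - m * s)) u (c / (1 - m * u))).
      { intros u Hu. assert (0 < 1 - m * u) by nra. auto_derive; [lra|]. field. lra. }
      apply (diff_le_open (fun s => - (c / m) * ln (1 - m * s)) (fun u => c / (1 - m * u))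
               T (fun u => K u ^ 2)); auto.
      - intros u Hu. eapply is_derive_continuous, D, Hu.
      - intros u Hu. eapply is_derive_continuous, is_derive_T. unfold dom in *. lra.
      - intros u Hu. apply D. lra.
      - intros u Hu. apply is_derive_T. unfold dom in *. lra.
      - intros u Hu. assert (0 < 1 - m * u) by nra. apply Rle_div_l; [lra|].
        rewrite Rmult_comm. apply K_blowup; [lra|]. unfold dom in *. lra. }
    cbv beta in S. rewrite T_0 in S. replace (1 - m * 0) with 1 in S by ring.
    rewrite ln_1 in S. lra. }
  (* Chosen so that the logarithmic lower bound for [T] equals [Rabs t + 1] when [1 - m s = e]. *)
  set (e := exp (- (Rabs t + 1) * (m / c))).
  assert (He : 0 < e < 1).
  { split; [apply exp_pos|]. rewrite <- exp_0. apply exp_increasing.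
    pose proof (Rabs_pos t). pose proof (Rdiv_lt_0_compat m c m_pos c_pos). nra. }
  assert (Hd : dom ((1 - e) / m) /\ 0 < (1 - e) / m).
  { assert (0 < (1 - e) / m) by (apply Rdiv_lt_0_compat; lra).
    unfold dom. split; [|auto]. split; [lra|].
    unfold Rdiv. rewrite <- (Rmult_1_l (/ m)) at 2. apply Rmult_lt_compat_r; lra. }
  exists ((1 - e) / m). split; [tauto|]. split; [tauto|].
  specialize (B ((1 - e) / m) ltac:(lra) ltac:(tauto)).
  replace (1 - m * ((1 - e) / m)) with e in B by (field; lra).
  unfold e in B at 1. rewrite ln_exp in B.
  replace (- (c / m) * (- (Rabs t + 1) * (m / c))) with (Rabs t + 1) in B by (field; lra).
  pose proof (Rle_abs t). lra.
Qed.

Definition tau (t : R) : R := epsilon (inhabits 0) (fun s => dom s /\ T s = t).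

(** A negative time after which [tau] is defined; [- / 4] is just some negative point of [dom]. *)
Definition t_min : R := T (- / 4).

Lemma dom_left : dom (- / 4).
Proof. unfold dom. pose proof (Rinv_0_lt_compat _ m_pos). lra. Qed.

Lemma t_min_neg : t_min < 0.
Proof. rewrite <- T_0. apply T_incr; [apply dom_left | apply dom_0 | lra]. Qed.

Lemma tau_spec t : t_min < t -> dom (tau t) /\ T (tau t) = t.
Proof.
  intros Ht. apply (epsilon_spec (inhabits 0) (fun s => dom s /\ T s = t)).
  pose proof dom_left as DL.
  destruct (T_unbounded t) as [s [Ds [Hs HT]]].
  destruct (Ranalysis5.IVT_interv (fun s => T s - t) (- / 4) s) as [z [Hz E]].
  - intros a Ha. apply continuous_pt. cont.
    eapply is_derive_continuous, is_derive_T. unfold dom in *. lra.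
  - lra.
  - unfold t_min in Ht. lra.
  - lra.
  - exists z. split; [unfold dom in *; lra | lra].
Qed.

Lemma tau_T s : dom s -> t_min < T s -> tau (T s) = s.
Proof.
  intros H Ht. destruct (tau_spec (T s) Ht) as [D E].
  destruct (Rtotal_order (tau (T s)) s) as [L|[L|L]]; auto.
  - apply T_incr in L; auto. lra.
  - apply T_incr in L; auto. lra.
Qed.

Lemma tau_0 : tau 0 = 0.
Proof.
  rewrite <- T_0 at 1. apply tau_T; [apply dom_0|]. rewrite T_0. apply t_min_neg.
Qed.

Lemma tau_nonneg t : 0 <= t -> 0 <= tau t.
Proof.
  intros Ht. pose proof t_min_neg. destruct (tau_spec t ltac:(lra)) as [D E].
  apply Rnot_lt_le. intros L. apply T_incr in L; [|auto|apply dom_0].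
  rewrite T_0 in L. lra.
Qed.

Lemma locally_t_min t : t_min < t -> locally t (fun t => t_min < t).
Proof.
  intros H. apply (locally_Ioo t_min (t + 1)); [lra|]. intros; lra.
Qed.

Lemma continuous_tau t : t_min < t -> continuous tau t.
Proof.
  intros H.
  apply (implicit_continuous (fun t s => T s - t) tau dom t).
  - intros z Hz. cont.
  - apply (filter_imp (fun t => t_min < t)); [|now apply locally_t_min].
    intros u Hu. destruct (tau_spec u Hu) as [D E]. split; [lra | exact D].
  - apply locally_dom, tau_spec, H.
  - apply filter_forall. intros u z z' Hz Hz' L. apply T_incr in L; auto. lra.
Qed.

Lemma is_derive_tau t : t_min < t -> is_derive tau t (/ K (tau t) ^ 2).
Proof.
  intros H. destruct (tau_spec t H) as [D E]. pose proof (K_pos _ D) as HK.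
  assert (HK2 : 0 < K (tau t) ^ 2) by (apply pow_lt; lra).
  destruct (proj1 (locally_eps _ _) (locally_dom _ D)) as [d1 [Hd1 L1]].
  destruct (proj1 (locally_eps _ _) (locally_t_min _ H)) as [d2 [Hd2 L2]].
  apply (is_derive_val _ _ (- (-1) / K (tau t) ^ 2)); [|field; lra].
  apply (implicit_derive (fun t s => T s - t) (fun _ s => K s ^ 2) tau t (-1) (Rmin d1 d2)).
  - apply Rmin_pos; lra.
  - intros u z _ Hz. pose proof (Rmin_l d1 d2).
    pose proof (is_derive_minus _ _ _ _ _ (is_derive_T z (L1 z ltac:(lra))) (is_derive_const u z)) as P.
    apply (is_derive_val _ _ _ _ P). unfold minus, plus, opp, zero; simpl. ring.
  - intros u Hu. pose proof (Rmin_r d1 d2).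
    rewrite (proj2 (tau_spec u (L2 u ltac:(lra)))). ring.
  - apply (continuous_comp1 (fun s => K s ^ 2) snd); [cont|]. cont. now apply continuous_K.
  - lra.
  - now apply continuous_tau.
  - auto_derive; auto; ring.
Qed.

Definition sol (t x : R) : R := h0 (tau t) x.

Lemma is_derive_sol t x : t_min < t -> - PI <= x <= PI ->
  is_derive (fun t => sol t x) t (PJ_rhs sol t x).
Proof.
  intros H Hx. destruct (tau_spec t H) as [D E]. pose proof (K_pos _ D) as HK.
  pose proof (is_derive_comp (fun s => h0 s x) tau t _ _ (is_derive_h0_s _ x D Hx) (is_derive_tau t H)) as P.
  apply (is_derive_val _ _ _ _ P). unfold PJ_rhs, sol, scal; simpl; unfold mult; simpl.
  change (fun x0 => h0 (tau t) x0) with (h0 (tau t)).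
  set (s := tau t) in *.
  assert (N : RInt (h0 s) (- PI) x * h1 s x = RInt (h0 s) (- PI) x * Derive (h0 s) x).
  { destruct (Req_dec x (- PI)) as [->|N1].
    - rewrite (RInt_h0 s), label_left, Xs_left by (auto; lra). unfold Rdiv; ring.
    - destruct (Req_dec x PI) as [->|N2].
      + rewrite (RInt_h0 s), label_right, Xs_right by (auto; lra). unfold Rdiv; ring.
      + rewrite (is_derive_unique _ _ _ (is_derive_h0 s x D ltac:(lra))). reflexivity. }
  rewrite !Rmult_1_r. rewrite Ropp_mult_distr_l_reverse, N.
  field. pose proof PI_RGT_0. lra.
Qed.

(** The identities are proved on the whole open interval at each order, because [Derive_n] of the
    next order at a point depends on the previous one nearby. *)
Lemma Derive_n_chain (f f1 f2 f3 : R -> R) a b :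
  (forall x, a < x < b -> is_derive f x (f1 x)) ->
  (forall x, a < x < b -> is_derive f1 x (f2 x)) ->
  (forall x, a < x < b -> is_derive f2 x (f3 x)) ->
  forall x, a < x < b ->
    (ex_derive_n f 1 x /\ Derive_n f 1 x = f1 x) /\
    (ex_derive_n f 2 x /\ Derive_n f 2 x = f2 x) /\
    (ex_derive_n f 3 x /\ Derive_n f 3 x = f3 x).
Proof.
  intros D1 D2 D3.
  assert (E1 : forall x, a < x < b -> Derive_n f 1 x = f1 x)
    by (intros x Hx; now apply is_derive_unique, D1).
  assert (F2 : forall x, a < x < b -> is_derive (Derive_n f 1) x (f2 x)).
  { intros x Hx. apply (is_derive_ext_loc f1); [|now apply D2].
    apply (locally_Ioo a b); auto. intros u Hu. symmetry. now apply E1. }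
  assert (E2 : forall x, a < x < b -> Derive_n f 2 x = f2 x)
    by (intros x Hx; now apply is_derive_unique, F2).
  assert (F3 : forall x, a < x < b -> is_derive (Derive_n f 2) x (f3 x)).
  { intros x Hx. apply (is_derive_ext_loc f2); [|now apply D3].
    apply (locally_Ioo a b); auto. intros u Hu. symmetry. now apply E2. }
  intros x Hx. repeat split; auto.
  - eexists. now apply D1.
  - eexists. now apply F2.
  - eexists. now apply F3.
  - now apply is_derive_unique, F3.
Qed.

Lemma sol_PJ : PJ_solution G sol.
Proof.
  pose proof t_min_neg as Ht0.
  assert (HT : forall t, 0 <= t -> dom (tau t)) by (intros; apply tau_spec; lra).
  (* Freezing time at 0 for negative [t] provides the extension to the whole plane that
     [PJ_solution] asks for. *)
  assert (CC : forall h : R -> R -> R, (forall s x, dom s -> cont2 h (s, x)) ->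
    forall p, cont2 (fun t x => h (tau (Rmax 0 t)) x) p).
  { intros h Hh [t x]. pose proof (Rmax_l 0 t).
    apply (cont2_comp h (fun q => tau (Rmax 0 (fst q))) snd); [|cont|].
    - apply (continuous_comp1 tau (fun q => Rmax 0 (fst q))).
      + apply continuous_Rmax0. cont.
      + apply continuous_tau. simpl. lra.
    - apply Hh, HT. simpl. lra. }
  assert (DD : forall t x, 0 <= t -> - PI < x < PI -> _)
    by (intros t x Ht; exact (Derive_n_chain (h0 (tau t)) (h1 (tau t)) (h2 (tau t)) (h3 (tau t))
         (- PI) PI (fun x => is_derive_h0 _ x (HT t Ht)) (fun x => is_derive_h1 _ x (HT t Ht))
         (fun x => is_derive_h2 _ x (HT t Ht)) x)).
  split; [|split; [|split]].
  - intros j Hj.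
    destruct j as [|[|[|[|j]]]]; [| | | |lia].
    + exists (fun t x => h0 (tau (Rmax 0 t)) x). split; [apply CC, cont2_h0|].
      split; intros; rewrite Rmax_right by lra; [split; reflexivity | reflexivity].
    + exists (fun t x => h1 (tau (Rmax 0 t)) x). split; [apply CC, cont2_h1|].
      split; [|intros; lia]. intros t x Ht Hx. rewrite Rmax_right by lra. change (sol t) with (h0 (tau t)).
      destruct (DD t x Ht Hx) as [E _]. exact E.
    + exists (fun t x => h2 (tau (Rmax 0 t)) x). split; [apply CC, cont2_h2|].
      split; [|intros; lia]. intros t x Ht Hx. rewrite Rmax_right by lra. change (sol t) with (h0 (tau t)).
      destruct (DD t x Ht Hx) as [_ [E _]]. exact E.
    + exists (fun t x => h3 (tau (Rmax 0 t)) x). split; [apply CC, cont2_h3|].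
      split; [|intros; lia]. intros t x Ht Hx. rewrite Rmax_right by lra. change (sol t) with (h0 (tau t)).
      destruct (DD t x Ht Hx) as [_ [_ E]]. exact E.
  - intros t Ht. pose proof PI_RGT_0. unfold sol.
    change (fun x => h0 (tau t) x) with (h0 (tau t)).
    pose proof (HT t Ht). rewrite RInt_h0, label_right, Xs_right by (auto; lra). unfold Rdiv; eqR; ring.
  - intros x Hx. unfold sol. rewrite tau_0. now apply h0_0.
  - intros x Hx. split.
    + intros t Ht. apply is_derive_sol; [lra | exact Hx].
    (* Since [t_min < 0], the derivative at time 0 exists from both sides; the one-sided limit is
       its restriction. *)
    + pose proof (is_derive_sol 0 x Ht0 Hx) as D. apply is_derive_Reals in D.
      apply filterlim_locally. intros eps.
      destruct (D eps (cond_pos eps)) as [d Hd].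
      exists d. intros h Hh Hpos. specialize (Hd h ltac:(lra)).
      change (Rabs (h - 0) < d) in Hh. rewrite Rminus_0_r in Hh.
      specialize (Hd Hh). rewrite Rplus_0_l in Hd. exact Hd.
Qed.

End Explicit.

(** * The conjugacy for an exact cosine profile *)

Lemma is_derive_zero_const (f : R -> R) a b :
  (forall x, is_derive f x 0) -> f a = f b.
Proof.
  intros H. destruct (MVT_gen f a b (fun _ => 0)) as [c [_ E]].
  - intros x _. apply H.
  - intros x _. apply continuous_pt. eapply is_derive_continuous, H.
  - lra.
Qed.

Lemma PI_gt_3 : 3 < PI.
Proof. pose proof PI2_3_2. lra. Qed.

(** The inequality [cos <= 1], integrated four times from 0. *)
Lemma one_minus_cos_ge_small x : 0 <= x <= 2 -> x ^ 2 / 2 - x ^ 4 / 24 <= 1 - cos x.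
Proof.
  intros Hx.
  assert (D : forall (f df g dg : R -> R), f 0 <= g 0 ->
     (forall x, is_derive f x (df x)) -> (forall x, is_derive g x (dg x)) ->
     (forall x, 0 <= x -> df x <= dg x) -> forall x, 0 <= x -> f x <= g x).
  { intros f df g dg H0 Hf Hg Hle y Hy.
    enough (f y - f 0 <= g y - g 0) by lra.
    apply (diff_le_open f df g dg); auto.
    - intros; eapply is_derive_continuous, Hf.
    - intros; eapply is_derive_continuous, Hg.
    - intros; apply Hle; lra. }
  assert (S1 : forall x, 0 <= x -> sin x <= x).
  { apply (D sin cos (fun x => x) (fun _ => 1)).
    - rewrite sin_0. lra.
    - intros; apply is_derive_sin.
    - intros; apply (is_derive_id (K := R_AbsRing)).
    - intros y _. apply COS_bound. }
  assert (C2 : forall x, 0 <= x -> 1 - x ^ 2 / 2 <= cos x).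
  { apply (D (fun x => 1 - x ^ 2 / 2) (fun x => - x) cos (fun x => - sin x)).
    - rewrite cos_0. lra.
    - intros; auto_derive; auto; field.
    - intros; apply is_derive_cos.
    - intros y Hy. specialize (S1 y Hy). lra. }
  assert (S3 : forall x, 0 <= x -> x - x ^ 3 / 6 <= sin x).
  { apply (D (fun x => x - x ^ 3 / 6) (fun x => 1 - x ^ 2 / 2) sin cos).
    - rewrite sin_0. lra.
    - intros; auto_derive; auto; field.
    - intros; apply is_derive_sin.
    - exact C2. }
  apply (D (fun x => x ^ 2 / 2 - x ^ 4 / 24) (fun x => x - x ^ 3 / 6)
           (fun x => 1 - cos x) sin); [rewrite cos_0; lra | | | exact S3 | lra].
  - intros; auto_derive; auto; field.
  - intros; auto_derive; auto; ring.
Qed.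

(** The window exceeds [PI] because [y] will be [z - x0] with [x0] near 0. Up to 2 the Taylor bound
    suffices; beyond, monotonicity and the reflection about [PI] give
    [1 - cos y >= 1 - cos 2 >= 4/3], while [y^2 / 20 <= 25/20]. *)
Lemma one_minus_cos_ge y : Rabs y <= PI + 1 -> y ^ 2 / 20 <= 1 - cos y.
Proof.
  intros Hy. pose proof PI_gt_3. pose proof PI_4.
  rewrite <- (pow2_abs y).
  replace (cos y) with (cos (Rabs y)).
  2:{ unfold Rabs. destruct (Rcase_abs y); [apply cos_neg | reflexivity]. }
  pose proof (Rabs_pos y) as Hp. set (x := Rabs y) in *.
  destruct (Rle_dec x 2) as [L|L].
  - pose proof (one_minus_cos_ge_small x ltac:(lra)).
    assert (0 <= x ^ 2 <= 4) by (split; nra).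
    replace (x ^ 4) with (x ^ 2 * x ^ 2) in H1 by ring. nra.
  - pose proof (one_minus_cos_ge_small 2 ltac:(lra)) as C2.
    assert (cos x <= cos 2).
    { destruct (Rle_dec x PI) as [L'|L'].
      - apply cos_decr_1; lra.
      - replace (cos x) with (cos (2 * PI - x)).
        + apply cos_decr_1; lra.
        + rewrite cos_minus, cos_2PI, sin_2PI. ring. }
    nra.
Qed.

Lemma sqr_sum_zero a b : a ^ 2 + b ^ 2 = 0 -> a = 0 /\ b = 0.
Proof. intros H. pose proof (pow2_ge_0 a). pose proof (pow2_ge_0 b). split; nra. Qed.

(* [Theta] is the flow map for the datum [b + kap cos y], where [p = 1 - s b], [q = s kap]:
   [tan (Theta / 2) = sqrt ((p + q) / (p - q)) * tan (y / 2)]. *)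
Section Theta.

Variables p q : R.
Hypothesis q_nonneg : 0 <= q.
Hypothesis q_lt_p : q < p.

Definition r0 (y : R) : R := p - q * cos y.
Definition w : R := sqrt (p ^ 2 - q ^ 2).
Definition Theta (y : R) : R := RInt (fun y => w / r0 y) 0 y.

Lemma r0_pos y : 0 < r0 y.
Proof. unfold r0. pose proof (COS_bound y). nra. Qed.

Lemma w_sqr : w ^ 2 = p ^ 2 - q ^ 2.
Proof. unfold w. apply pow2_sqrt. nra. Qed.

Lemma w_pos : 0 < w.
Proof. apply sqrt_lt_R0. nra. Qed.

Lemma continuous_r0 y : continuous r0 y.
Proof. unfold r0. cont. Qed.

Lemma continuous_w_r0 y : continuous (fun y => w / r0 y) y.
Proof. pose proof (r0_pos y). cont; [apply continuous_r0 | lra]. Qed.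

Lemma is_derive_Theta y : is_derive Theta y (w / r0 y).
Proof. apply (is_derive_RInt_cont (fun y => w / r0 y)). apply continuous_w_r0. Qed.

Lemma Theta_0 : Theta 0 = 0.
Proof. apply (RInt_point 0 (fun y => w / r0 y)). Qed.

(** The claimed values [(C, S)] rotate with the same angular speed [w / r0] as
    [(cos Theta, sin Theta)], so the inner product of the two vectors is constant, equal to 1 as at
    [y = 0]. Both being unit vectors, they coincide. *)
Lemma Theta_cos_sin y : cos (Theta y) = (p * cos y - q) / r0 y /\ sin (Theta y) = w * sin y / r0 y.
Proof.
  set (C := fun y => (p * cos y - q) / r0 y). set (S := fun y => w * sin y / r0 y).
  assert (DC : forall y, is_derive C y (- S y * (w / r0 y))).
  { intros x. pose proof (r0_pos x) as H. unfold C, S, r0 in *. auto_derive; [lra|].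
    pose proof (sin2_cos2 x) as T. unfold Rsqr in T. pose proof w_sqr as W.
    replace (- (w * sin x / (p - q * cos x)) * (w / (p - q * cos x)))
      with (- (w ^ 2) * sin x / (p - q * cos x) ^ 2) by (field; lra).
    rewrite W. field. lra. }
  assert (DS : forall y, is_derive S y (C y * (w / r0 y))).
  { intros x. pose proof (r0_pos x) as H. unfold C, S, r0 in *. auto_derive; [lra|].
    pose proof (sin2_cos2 x) as T. unfold Rsqr in T.
    transitivity (w * (p * cos x - q * (sin x * sin x + cos x * cos x)) / (p - q * cos x) ^ 2).
    - field. lra.
    - rewrite T. field. lra. }
  assert (E : cos (Theta y) * C y + sin (Theta y) * S y = 1).
  { transitivity (cos (Theta 0) * C 0 + sin (Theta 0) * S 0).
    - apply (is_derive_zero_const (fun y => cos (Theta y) * C y + sin (Theta y) * S y)).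
      intros x. pose proof (is_derive_Theta x) as DT. pose proof (DC x) as DCx. pose proof (DS x) as DSx.
      assert (ex_derive Theta x) by (eexists; exact DT).
      assert (ex_derive C x) by (eexists; exact DCx).
      assert (ex_derive S x) by (eexists; exact DSx).
      auto_derive; [auto|].
      rewrite_Derive Theta DT. rewrite_Derive C DCx. rewrite_Derive S DSx. ring.
    - rewrite Theta_0. unfold C, S, r0. rewrite cos_0, sin_0. field. lra. }
  assert (N : C y ^ 2 + S y ^ 2 = 1).
  { unfold C, S. pose proof (r0_pos y) as H. unfold r0 in *.
    pose proof (sin2_cos2 y) as T. unfold Rsqr in T.
    apply (Rmult_eq_reg_r ((p - q * cos y) ^ 2)); [|apply pow_nonzero; lra].
    replace ((((p * cos y - q) / (p - q * cos y)) ^ 2 + (w * sin y / (p - q * cos y)) ^ 2) * (p - q * cos y) ^ 2)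
      with ((p * cos y - q) ^ 2 + w ^ 2 * (sin y * sin y)) by (field; lra).
    rewrite w_sqr. replace (sin y * sin y) with (1 - cos y * cos y) by lra. ring. }
  pose proof (sin2_cos2 (Theta y)) as T. unfold Rsqr in T.
  destruct (sqr_sum_zero (cos (Theta y) - C y) (sin (Theta y) - S y)) as [A B].
  - nra.
  - unfold C, S in *. split; lra.
Qed.

Lemma Theta_incr y y' : y < y' -> Theta y < Theta y'.
Proof.
  intros H. destruct (MVT_open Theta (fun y => w / r0 y) y y') as [c [_ E]]; [lra | | |].
  - intros x. eapply is_derive_continuous, is_derive_Theta.
  - intros x _. apply is_derive_Theta.
  - assert (0 < w / r0 c) by (apply Rdiv_lt_0_compat; [apply w_pos | apply r0_pos]). nra.
Qed.

(** The formula gives [cos (Theta PI) = -1], which excludes values in [(0, PI)]. If [Theta PI]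
    exceeded [PI], the value [PI] would be attained inside [(0, PI)], where [sin (Theta y)] is
    positive. *)
Lemma Theta_PI : Theta PI = PI.
Proof.
  pose proof PI_RGT_0. pose proof (r0_pos PI) as Hr. unfold r0 in Hr. rewrite cos_PI in Hr.
  destruct (Theta_cos_sin PI) as [HC HS]. unfold r0 in HC, HS. rewrite cos_PI, sin_PI in *.
  assert (HC' : cos (Theta PI) = -1) by (rewrite HC; field; lra).
  pose proof (Theta_incr 0 PI ltac:(lra)) as P. rewrite Theta_0 in P.
  destruct (Rle_dec (Theta PI) PI) as [L|L].
  - destruct (Req_dec (Theta PI) PI) as [E|E]; [exact E|].
    pose proof (cos_decreasing_1 (Theta PI) PI) as D. rewrite cos_PI, HC' in D. lra.
  - destruct (IVT_gen Theta 0 PI PI) as [y [Hy E]].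
    + intros x. apply continuous_pt. eapply is_derive_continuous, is_derive_Theta.
    + rewrite Theta_0, Rmin_left, Rmax_right; lra.
    + rewrite Rmin_left, Rmax_right in Hy by lra.
      assert (y <> 0) by (intros ->; rewrite Theta_0 in E; lra).
      assert (y <> PI) by (intros ->; lra).
      destruct (Theta_cos_sin y) as [_ HSy]. rewrite E, sin_PI in HSy.
      assert (0 < w * sin y / r0 y); [|lra].
      apply Rdiv_lt_0_compat; [|apply r0_pos].
      apply Rmult_lt_0_compat; [apply w_pos | apply sin_gt_0; lra].
Qed.

Lemma Theta_opp y : Theta (- y) = - Theta y.
Proof.
  assert (E : Theta (- y) + Theta y = Theta (- 0) + Theta 0).
  { apply (is_derive_zero_const (fun y => Theta (- y) + Theta y)). intros x.
    pose proof (is_derive_Theta x) as D. pose proof (is_derive_Theta (- x)) as D'.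
    assert (ex_derive Theta x) by (eexists; exact D).
    assert (ex_derive Theta (- x)) by (eexists; exact D').
    auto_derive; [auto|].
    rewrite_Derive Theta D. rewrite_Derive Theta D'. unfold r0. rewrite cos_neg. ring. }
  rewrite Ropp_0, Theta_0 in E. lra.
Qed.

Lemma Theta_mPI : Theta (- PI) = - PI.
Proof. rewrite Theta_opp, Theta_PI. reflexivity. Qed.

End Theta.

(** * Comparison with the cosine profile *)

(** Makes every relative error small at all times: in particular [11200 * 36 * delta0 < 1/100],
    which is used in [E_bounds]. *)
Definition delta0 : R := / 100000000.

(* [eta] is the relative size [sigma / mu] of the perturbation. *)
Record cos_perturbation (G g1 g2 g3 : R -> R) (eta : R) : Prop := {
  cp_c0 : forall x, continuous G x;
  cp_c1 : forall x, continuous g1 x;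
  cp_c2 : forall x, continuous g2 x;
  cp_c3 : forall x, continuous g3 x;
  cp_d0 : forall x, - PI < x < PI -> is_derive G x (g1 x);
  cp_d1 : forall x, - PI < x < PI -> is_derive g1 x (g2 x);
  cp_d2 : forall x, - PI < x < PI -> is_derive g2 x (g3 x);
  cp_b0 : forall x, - PI <= x <= PI -> Rabs (G x - cos x) <= eta;
  cp_b1 : forall x, - PI <= x <= PI -> Rabs (g1 x + sin x) <= eta;
  cp_b2 : forall x, - PI <= x <= PI -> Rabs (g2 x + cos x) <= eta;
  cp_b3 : forall x, - PI <= x <= PI -> Rabs (g3 x - sin x) <= eta;
  cp_clamp : forall x, G (clamp x) = G x;
  cp_mean : RInt G (- PI) PI = 0;
  cp_eta : 0 <= eta <= delta0 }.

Lemma Rabs_sin_minus a b : Rabs (sin a - sin b) <= Rabs (a - b).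
Proof.
  destruct (MVT_gen sin b a cos) as [c [_ E]].
  - intros; apply is_derive_sin.
  - intros; apply continuous_pt, continuous_sin.
  - rewrite E, Rabs_mult. pose proof (Rabs_pos (a - b)).
    assert (Rabs (cos c) <= 1) by (apply Rabs_le; apply COS_bound). nra.
Qed.

(** Integration from the zero [x0] gains one power of [|z - x0|]. Since [df] is controlled only at
    distance at most [|z - x0|], the constant [M] may itself depend on [z], and three applications
    lead from the third derivative to the cubic error. *)
Lemma growth_bound (f df : R -> R) x0 M z :
  - PI < x0 < PI -> - PI <= z <= PI -> (forall x, continuous f x) ->
  (forall x, - PI < x < PI -> is_derive f x (df x)) -> f x0 = 0 ->
  (forall x, - PI < x < PI -> Rabs (x - x0) <= Rabs (z - x0) -> Rabs (df x) <= M) ->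
  Rabs (f z) <= M * Rabs (z - x0).
Proof.
  intros Hx0 Hz Hc Hd H0 HM.
  assert (DM : forall x, is_derive (fun x => M * x) x M) by (intros; auto_derive; auto; ring).
  destruct (Rle_dec x0 z) as [L|L].
  - assert (B : Rabs (f z - f x0) <= (fun x => M * x) z - (fun x => M * x) x0).
    { apply (Rabs_diff_le_open f df (fun x => M * x) (fun _ => M)); auto.
      - intros; eapply is_derive_continuous, DM.
      - intros x Hx. apply Hd. lra.
      - intros x Hx. apply HM; [lra|]. rewrite !Rabs_pos_eq; lra. }
    rewrite H0, Rminus_0_r in B. rewrite (Rabs_pos_eq (z - x0)) by lra. lra.
  - assert (B : Rabs (f x0 - f z) <= (fun x => M * x) x0 - (fun x => M * x) z).
    { apply (Rabs_diff_le_open f df (fun x => M * x) (fun _ => M)); auto; [lra | | |].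
      - intros; eapply is_derive_continuous, DM.
      - intros x Hx. apply Hd. lra.
      - intros x Hx. apply HM; [lra|]. rewrite !Rabs_left; lra. }
    rewrite H0, Rminus_0_l, Rabs_Ropp in B. rewrite (Rabs_left (z - x0)) by lra. lra.
Qed.

(** With zero mean, [f x] is the average of [f x - f y] over [y], hence at most the oscillation, and
    [2 PI <= 8]. *)
Lemma mean_zero_bound (f df : R -> R) B x :
  (forall x, continuous f x) -> (forall x, - PI < x < PI -> is_derive f x (df x)) ->
  (forall x, - PI < x < PI -> Rabs (df x) <= B) -> RInt f (- PI) PI = 0 ->
  - PI <= x <= PI -> Rabs (f x) <= 8 * B.
Proof.
  intros Hc Hd HB H0 Hx. pose proof PI_gt_3. pose proof PI_4.
  assert (HB0 : 0 <= B) by (pose proof (HB 0 ltac:(lra)); pose proof (Rabs_pos (df 0)); lra).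
  assert (DM : forall x, is_derive (fun x => B * x) x B) by (intros; auto_derive; auto; ring).
  assert (M : forall a b, - PI <= a -> a <= b -> b <= PI -> Rabs (f b - f a) <= 8 * B).
  { intros a b Ha Hab Hb.
    assert (L : Rabs (f b - f a) <= (fun x => B * x) b - (fun x => B * x) a).
    { apply (Rabs_diff_le_open f df (fun x => B * x) (fun _ => B)); auto.
      - intros; eapply is_derive_continuous, DM.
      - intros y Hy. apply Hd. lra.
      - intros y Hy. apply HB. lra. }
    cbv beta in L. nra. }
  assert (I : RInt (fun y => f x - f y) (- PI) PI = 2 * PI * f x).
  { rewrite (RInt_ext_all _ (fun y => f x * 1 + (-1) * f y)) by (intros; ring).
    rewrite (RInt_lin (fun _ => 1) f), RInt_const_R, H0; [eqR; ring | intros; cont | auto]. }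
  assert (A : Rabs (RInt (fun y => f x - f y) (- PI) PI) <= Rabs (PI - - PI) * (8 * B)).
  { apply Rabs_RInt_le; [intros; cont; auto|].
    rewrite Rmin_left, Rmax_right by lra. intros y Hy.
    destruct (Rle_dec y x); [apply M; lra|].
    rewrite Rabs_minus_sym. apply M; lra. }
  rewrite I, Rabs_mult, (Rabs_pos_eq (2 * PI)), (Rabs_pos_eq (PI - - PI)) in A by lra.
  apply Rmult_le_reg_l with (2 * PI); [lra|].
  replace (2 * PI * (8 * B)) with ((PI - - PI) * (8 * B)) by ring. exact A.
Qed.

Lemma ln_le_minus_1 x : 0 < x -> ln x <= x - 1.
Proof.
  intros Hx. pose proof (exp_ineq1_le (ln x)) as H. rewrite exp_ln in H by lra. lra.
Qed.

Section Perturbation.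

Variables (G g1 g2 g3 : R -> R) (eta x0 m kap : R).
Hypothesis HP : cos_perturbation G g1 g2 g3 eta.
Hypothesis Hx0 : - PI < x0 < PI.
Hypothesis Hmax : forall x, G x <= G x0.
Hypothesis Em : m = G x0.
Hypothesis Ekap : kap = - g2 x0.

Lemma eta_bounds : 0 <= eta <= / 100000000.
Proof. apply (cp_eta _ _ _ _ _ HP). Qed.

Lemma critical_point : g1 x0 = 0.
Proof.
  pose proof (cp_d0 _ _ _ _ _ HP x0 Hx0) as D.
  apply is_derive_Reals in D.
  exact (deriv_maximum G (- PI) PI x0 (exist _ _ D) (proj1 Hx0) (proj2 Hx0) (fun x _ _ => Hmax x)).
Qed.

(** Comparing [G x0 >= G 0] with the cosine gives [cos x0 >= 1 - 2 eta], which places [x0] in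
    [(- PI/2, PI/2)]; the critical point equation gives [|sin x0| <= eta], and [sin u >= u cos u]
    turns this into a bound on [x0]. *)
Lemma max_point_bounds :
  Rabs x0 <= 2 * eta /\ 1 - 2 * eta <= cos x0 /\ 1 - eta <= m <= 1 + eta /\ Rabs (kap - 1) <= 3 * eta.
Proof.
  pose proof eta_bounds as He. pose proof PI_gt_3.
  pose proof (cp_b0 _ _ _ _ _ HP x0 ltac:(lra)) as B. apply Rabs_le_between in B.
  pose proof (cp_b0 _ _ _ _ _ HP 0 ltac:(lra)) as B0. apply Rabs_le_between in B0. rewrite cos_0 in B0.
  pose proof (cp_b1 _ _ _ _ _ HP x0 ltac:(lra)) as B1. rewrite critical_point, Rplus_0_l in B1.
  pose proof (cp_b2 _ _ _ _ _ HP x0 ltac:(lra)) as B2. apply Rabs_le_between in B2.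
  pose proof (Hmax 0). pose proof (COS_bound x0).
  split; [|split; [lra | split; [lra | apply Rabs_le; lra]]].
  set (u := Rabs x0). assert (Hu : 0 <= u < PI) by (unfold u; split; [apply Rabs_pos | apply Rabs_lt_between; lra]).
  assert (Cu : cos u = cos x0) by (unfold u, Rabs; destruct (Rcase_abs x0); [apply cos_neg | reflexivity]).
  assert (Su : sin u <= eta).
  { unfold u. apply Rabs_le_between in B1.
    unfold Rabs; destruct (Rcase_abs x0); [rewrite sin_neg|]; lra. }
  assert (Hu2 : u < PI / 2).
  { apply Rnot_le_lt. intros L. pose proof (cos_le_0 u ltac:(lra) ltac:(lra)). lra. }
  destruct (MVT_open sin cos 0 u) as [c [Hc E]]; [lra | intros; apply continuous_sin | intros; apply is_derive_sin |].
  rewrite sin_0 in E. assert (cos u <= cos c) by (apply cos_decr_1; lra). nra.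
Qed.

(** The 6 is [1 + 2 + 3]: the distance of [g3] to [sin], the shift of the sine by [x0], and the
    replacement of amplitude 1 by [kap]. *)
Lemma e2_bound z : - PI <= z <= PI -> Rabs (g2 z + kap * cos (z - x0)) <= 6 * eta * Rabs (z - x0).
Proof.
  intros Hz. destruct max_point_bounds as [Bx [_ [_ Bk]]]. pose proof PI_gt_3.
  apply (growth_bound (fun z => g2 z + kap * cos (z - x0)) (fun z => g3 z - kap * sin (z - x0)) x0); auto.
  - intros x. cont. apply (cp_c2 _ _ _ _ _ HP).
  - intros x Hx. pose proof (cp_d2 _ _ _ _ _ HP x Hx) as D.
    assert (ex_derive g2 x) by (eexists; exact D).
    auto_derive; [auto|]. rewrite_Derive g2 D. unfold Rminus. ring.
  - rewrite Rminus_diag, cos_0, Ekap. ring.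
  - intros x Hx _. pose proof (cp_b3 _ _ _ _ _ HP x ltac:(lra)) as B.
    pose proof (Rabs_sin_minus x (x - x0)) as S. replace (x - (x - x0)) with x0 in S by ring.
    assert (S2 : Rabs ((kap - 1) * sin (x - x0)) <= 3 * eta).
    { rewrite Rabs_mult. assert (Rabs (sin (x - x0)) <= 1) by (apply Rabs_le, SIN_bound).
      pose proof (Rabs_pos (kap - 1)). pose proof (Rabs_pos (sin (x - x0))). nra. }
    apply Rabs_le_between in B. apply Rabs_le_between in S2. pose proof (Rabs_le_between (sin x - sin (x - x0)) (2 * eta)) as Q.
    assert (Q' : Rabs (sin x - sin (x - x0)) <= 2 * eta) by lra.
    apply Q in Q'. apply Rabs_le. lra.
Qed.

Lemma e1_bound z : - PI <= z <= PI -> Rabs (g1 z + kap * sin (z - x0)) <= 6 * eta * (z - x0) ^ 2.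
Proof.
  intros Hz. rewrite <- pow2_abs.
  replace (6 * eta * Rabs (z - x0) ^ 2) with ((6 * eta * Rabs (z - x0)) * Rabs (z - x0)) by ring.
  pose proof eta_bounds as He.
  apply (growth_bound (fun z => g1 z + kap * sin (z - x0)) (fun z => g2 z + kap * cos (z - x0)) x0); auto.
  - intros x. cont. apply (cp_c1 _ _ _ _ _ HP).
  - intros x Hx. pose proof (cp_d1 _ _ _ _ _ HP x Hx) as D.
    assert (ex_derive g1 x) by (eexists; exact D).
    auto_derive; [auto|]. rewrite_Derive g1 D. unfold Rminus. ring.
  - rewrite Rminus_diag, sin_0, critical_point. ring.
  - intros x Hx Hd. pose proof (e2_bound x ltac:(lra)). nra.
Qed.

Lemma e0_bound z : - PI <= z <= PI ->
  Rabs (G z - (m - kap) - kap * cos (z - x0)) <= 6 * eta * Rabs (z - x0) ^ 3.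
Proof.
  intros Hz.
  replace (6 * eta * Rabs (z - x0) ^ 3) with ((6 * eta * Rabs (z - x0) ^ 2) * Rabs (z - x0)) by ring.
  pose proof eta_bounds as He.
  apply (growth_bound (fun z => G z - (m - kap) - kap * cos (z - x0)) (fun z => g1 z + kap * sin (z - x0)) x0); auto.
  - intros x. cont. apply (cp_c0 _ _ _ _ _ HP).
  - intros x Hx. pose proof (cp_d0 _ _ _ _ _ HP x Hx) as D.
    assert (ex_derive G x) by (eexists; exact D).
    auto_derive; [auto|]. rewrite_Derive G D. unfold Rminus. ring.
  - rewrite Rminus_diag, cos_0, Em. ring.
  - intros x Hx Hd. pose proof (e1_bound x ltac:(lra)) as B. rewrite <- pow2_abs in B.
    pose proof (Rabs_pos (x - x0)).
    apply Rle_trans with (1 := B). apply Rmult_le_compat_l; [lra|]. nra.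
Qed.

Lemma m_pos : 0 < m.
Proof. pose proof max_point_bounds. pose proof eta_bounds. lra. Qed.

Lemma G_le x : G x <= m.
Proof. rewrite Em. apply Hmax. Qed.

Lemma G_ge x : - (3 / 2) <= G x.
Proof.
  rewrite <- (cp_clamp _ _ _ _ _ HP). pose proof (cp_b0 _ _ _ _ _ HP _ (clamp_range x)) as B.
  apply Rabs_le_between in B. pose proof eta_bounds. pose proof (COS_bound (clamp x)). lra.
Qed.

(** * Error bounds at a fixed rescaled time *)

Section Slice.

Variable s : R.
Hypothesis Hs : 0 <= s.
Hypothesis Ds : dom m s.

Local Notation p := (1 - s * (m - kap)).
Local Notation q := (s * kap).
Local Notation eps := (1 - m * s).
Local Notation ww := (w p q).
Local Notation Th := (Theta p q).
Local Notation rr := (r0 p q).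
Local Notation Lam := (22 - ln eps).
(* All errors at time [s] are bounded by numerical multiples of [E]. *)
Local Notation E := (11200 * eta * (ww * Lam)).

Lemma param_bounds :
  0 <= q /\ q < p /\ 0 < eps <= 1 /\ s <= 101 / 100 /\ p - q = eps /\
  99 / 100 <= p + q <= 22 / 10 /\ 99 / 100 * (1 - eps) <= q.
Proof.
  pose proof eta_bounds as He. destruct max_point_bounds as [_ [_ [Bm Bk]]].
  apply Rabs_le_between in Bk. pose proof (dom_m m m_pos s Ds) as D.
  assert (S1 : s <= 101 / 100) by nra.
  assert (S2 : s * (m - kap) <= 1 / 100) by nra.
  assert (S3 : - (1 / 100) <= s * (m - kap)) by nra.
  assert (S4 : 0 <= s * kap) by nra.
  assert (S5 : s * kap <= 103 / 100) by nra.
  repeat split; try nra.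
Qed.

Lemma q_nonneg : 0 <= q.
Proof. apply param_bounds. Qed.

Lemma q_lt_p : q < p.
Proof. apply param_bounds. Qed.

(** Here [r0 = eps + q (1 - cos y)]. When [q] is small, [eps] is close to 1 and dominates
    [y^2 <= 25]; this makes the bound uniform in [s]. *)
Lemma r0_lower y : Rabs y <= PI + 1 -> (eps + y ^ 2) / 30 <= rr y.
Proof.
  intros Hy. pose proof (one_minus_cos_ge y Hy) as C. pose proof PI_4.
  destruct param_bounds as [Q [_ [Eb [_ [PQ [_ QE]]]]]].
  assert (Y : y ^ 2 <= 25) by (rewrite <- pow2_abs; pose proof (Rabs_pos y); nra).
  pose proof (pow2_ge_0 y).
  unfold r0. replace (p - q * cos y) with (eps + q * (1 - cos y)) by (rewrite <- PQ; ring).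
  set (Y2 := y ^ 2) in *.
  assert (99 / 100 * (1 - eps) * (Y2 / 20) <= q * (1 - cos y)).
  { apply Rmult_le_compat; lra. }
  nra.
Qed.

Lemma y_bound z : - PI <= z <= PI -> Rabs (z - x0) <= PI + 1.
Proof.
  intros Hz. destruct max_point_bounds as [Bx _]. pose proof eta_bounds.
  apply Rabs_le_between in Bx. apply Rabs_le. lra.
Qed.

Lemma r_r0 z : r G s z = rr (z - x0) - s * (G z - (m - kap) - kap * cos (z - x0)).
Proof. unfold r, r0. ring. Qed.

Lemma se_bound z : - PI <= z <= PI ->
  Rabs (s * (G z - (m - kap) - kap * cos (z - x0))) <= 606 / 100 * eta * Rabs (z - x0) ^ 3.
Proof.
  intros Hz. pose proof (e0_bound z Hz) as B. destruct param_bounds as [_ [_ [_ [S _]]]].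
  rewrite Rabs_mult, (Rabs_pos_eq s) by exact Hs.
  replace (606 / 100 * eta * Rabs (z - x0) ^ 3) with (101 / 100 * (6 * eta * Rabs (z - x0) ^ 3)) by field.
  apply Rmult_le_compat; auto. apply Rabs_pos.
Qed.

Lemma r_lower z : - PI <= z <= PI -> (eps + (z - x0) ^ 2) / 60 <= r G s z.
Proof.
  intros Hz. pose proof (r0_lower _ (y_bound z Hz)) as B. pose proof (se_bound z Hz) as S.
  pose proof (y_bound z Hz) as Y. pose proof PI_4. pose proof eta_bounds as He.
  destruct param_bounds as [_ [_ [Eb _]]].
  rewrite r_r0. apply Rabs_le_between in S. rewrite <- (pow2_abs (z - x0)) in *.
  pose proof (Rabs_pos (z - x0)). set (a := Rabs (z - x0)) in *.
  assert (606 / 100 * eta * a ^ 3 <= a ^ 2 / 60); [|lra].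
  replace (606 / 100 * eta * a ^ 3) with ((606 / 100 * eta * a) * a ^ 2) by ring.
  assert (606 / 100 * eta * a <= / 60) by nra. pose proof (pow2_ge_0 a). nra.
Qed.

(** The cubic remainder is divided by two denominators of size [R^2 = eps + (z - x0)^2], which
    leaves [1 / R], whose integral is only logarithmic in [eps]. The constant covers
    [6.06 * 60 * 30 = 10908]. *)
Lemma inv_diff_bound z : - PI <= z <= PI ->
  Rabs (/ r G s z - / rr (z - x0)) <= 11000 * eta / sqrt (eps + (z - x0) ^ 2).
Proof.
  intros Hz. pose proof (r0_lower _ (y_bound z Hz)) as B0. pose proof (r_lower z Hz) as B.
  pose proof (se_bound z Hz) as S. pose proof eta_bounds as He.
  destruct param_bounds as [_ [_ [Eb _]]]. pose proof (pow2_ge_0 (z - x0)) as Y.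
  assert (HR : 0 < sqrt (eps + (z - x0) ^ 2)) by (apply sqrt_lt_R0; lra).
  assert (HR2 : sqrt (eps + (z - x0) ^ 2) ^ 2 = eps + (z - x0) ^ 2) by (apply pow2_sqrt; lra).
  assert (Ha : Rabs (z - x0) <= sqrt (eps + (z - x0) ^ 2)).
  { rewrite <- sqrt_Rsqr_abs. apply sqrt_le_1_alt. unfold Rsqr. nra. }
  set (R := sqrt (eps + (z - x0) ^ 2)) in *. rewrite <- HR2 in B0, B.
  assert (HR2p : 0 < R ^ 2) by (apply pow_lt; lra).
  assert (P0 : 0 < rr (z - x0)) by lra. assert (P : 0 < r G s z) by lra.
  replace (/ r G s z - / rr (z - x0))
    with (s * (G z - (m - kap) - kap * cos (z - x0)) * / (r G s z * rr (z - x0)))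
    by (rewrite r_r0 in *; field; lra).
  rewrite Rabs_mult.
  assert (I : Rabs (/ (r G s z * rr (z - x0))) <= 1800 / R ^ 4).
  { rewrite Rabs_inv, Rabs_pos_eq by nra.
    replace (1800 / R ^ 4) with (/ ((R ^ 2 / 60) * (R ^ 2 / 30))) by (field; lra).
    apply Rinv_le_contravar; [nra|]. apply Rmult_le_compat; lra. }
  assert (S' : Rabs (s * (G z - (m - kap) - kap * cos (z - x0))) <= 606 / 100 * eta * R ^ 3).
  { apply Rle_trans with (1 := S). apply Rmult_le_compat_l; [lra|].
    apply pow_incr. split; [apply Rabs_pos | exact Ha]. }
  apply Rle_trans with ((606 / 100 * eta * R ^ 3) * (1800 / R ^ 4)).
  - apply Rmult_le_compat; auto; apply Rabs_pos.
  - replace ((606 / 100 * eta * R ^ 3) * (1800 / R ^ 4)) with (10908 * eta / R) by (field; lra).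
    apply Rmult_le_compat_r; [left; apply Rinv_0_lt_compat; lra | lra].
Qed.

Lemma Lam_ge : 22 <= Lam.
Proof.
  destruct param_bounds as [_ [_ [Eb _]]]. pose proof (ln_le_minus_1 eps ltac:(lra)). lra.
Qed.

Lemma ww_pos : 0 < ww.
Proof. apply w_pos; [apply q_nonneg | apply q_lt_p]. Qed.

(** The logarithm is a primitive of [1 / sqrt (eps + y^2)]. At the left end its argument nearly
    cancels; rationalised, it is at least [eps / 12], the source of [- ln eps]. The 22 bounds
    [2 ln 12]. *)
Lemma asinh_increment z : - PI <= z <= PI ->
  ln ((z - x0) + sqrt (eps + (z - x0) ^ 2)) - ln ((- PI - x0) + sqrt (eps + (- PI - x0) ^ 2)) <= Lam.
Proof.
  intros Hz. destruct param_bounds as [_ [_ [Eb _]]]. pose proof PI_4. pose proof PI_gt_3.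
  assert (U : forall y, Rabs y <= 5 -> sqrt (eps + y ^ 2) <= 6 /\ sqrt (eps + y ^ 2) ^ 2 = eps + y ^ 2
                        /\ 0 < sqrt (eps + y ^ 2)).
  { intros y Hy. assert (y ^ 2 <= 25) by (rewrite <- pow2_abs; pose proof (Rabs_pos y); nra).
    pose proof (pow2_ge_0 y). split; [|split; [apply pow2_sqrt; lra | apply sqrt_lt_R0; lra]].
    replace 6 with (sqrt (6 ^ 2)) by (apply sqrt_pow2; lra). apply sqrt_le_1_alt. lra. }
  pose proof (y_bound z Hz) as Y1. pose proof (y_bound (- PI) ltac:(lra)) as Y2.
  destruct (U (z - x0) ltac:(lra)) as [A1 [A2 A3]].
  destruct (U (- PI - x0) ltac:(lra)) as [B1 [B2 B3]].
  apply Rabs_le_between in Y1. apply Rabs_le_between in Y2.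
  set (R1 := sqrt (eps + (z - x0) ^ 2)) in *. set (R2 := sqrt (eps + (- PI - x0) ^ 2)) in *.
  assert (P1 : 0 < z - x0 + R1) by nra.
  assert (P2 : eps / 12 <= - PI - x0 + R2).
  { apply Rle_div_l; [lra|].
    apply Rle_trans with ((- PI - x0 + R2) * (R2 - (- PI - x0))); [right; nra|].
    apply Rmult_le_compat_l; [nra | lra]. }
  pose proof (ln_le (z - x0 + R1) 12 ltac:(lra) ltac:(lra)) as L1.
  pose proof (ln_le (eps / 12) _ ltac:(lra) P2) as L2.
  rewrite ln_div in L2 by lra.
  pose proof (ln_le_minus_1 12 ltac:(lra)). lra.
Qed.

Lemma I0_bound z : - PI <= z <= PI ->
  Rabs (I0 G s z - (Th (z - x0) - Th (- PI - x0)) / ww) <= 11000 * eta * Lam.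
Proof.
  intros Hz. pose proof ww_pos as Hw. pose proof eta_bounds as He. pose proof PI_gt_3.
  destruct param_bounds as [_ [_ [Eb _]]].
  assert (DT : forall x, is_derive (fun z => Th (z - x0) / ww) x (/ rr (x - x0))).
  { intros x. pose proof (is_derive_Theta p q q_nonneg q_lt_p (x - x0)) as D.
    assert (ex_derive Th (x - x0)) by (eexists; exact D).
    auto_derive; [exact H0|]. replace (x + - x0) with (x - x0) by ring.
    rewrite_Derive (Theta p q) D. pose proof (r0_pos p q q_nonneg q_lt_p (x - x0)). field. lra. }
  assert (DI : forall x, is_derive (I0 G s) x (/ r G s x)).
  { intros x. apply (is_derive_RInt_cont (fun y => / r G s y)). intros y.
    apply (cont_inv_r G m (cp_c0 _ _ _ _ _ HP) m_pos G_le G_ge s y Ds). }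
  assert (DL : forall x, is_derive (fun z => 11000 * eta * ln ((z - x0) + sqrt (eps + (z - x0) ^ 2))) x
                         (11000 * eta / sqrt (eps + (x - x0) ^ 2))).
  { intros x. pose proof (pow2_ge_0 (x - x0)).
    assert (HR : 0 < sqrt (eps + (x - x0) ^ 2)) by (apply sqrt_lt_R0; lra).
    assert (HR2 : sqrt (eps + (x - x0) ^ 2) ^ 2 = eps + (x - x0) ^ 2) by (apply pow2_sqrt; lra).
    assert (P : 0 < x - x0 + sqrt (eps + (x - x0) ^ 2)) by nra.
    auto_derive.
    - replace (1 + - (m * s) + (x + - x0) * ((x + - x0) * 1)) with (eps + (x - x0) ^ 2) by ring.
      split; [lra|]. split; [|auto]. exact P.
    - replace (1 + - (m * s) + (x + - x0) * ((x + - x0) * 1)) with (eps + (x - x0) ^ 2) by ring.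
      replace (x + - x0) with (x - x0) by ring. change ((x - x0) * ((x - x0) * 1)) with ((x - x0) ^ 2).
      set (R := sqrt (eps + (x - x0) ^ 2)) in *. field. lra. }
  assert (B : Rabs ((fun z => I0 G s z - Th (z - x0) / ww) z - (fun z => I0 G s z - Th (z - x0) / ww) (- PI))
     <= (fun z => 11000 * eta * ln ((z - x0) + sqrt (eps + (z - x0) ^ 2))) z
      - (fun z => 11000 * eta * ln ((z - x0) + sqrt (eps + (z - x0) ^ 2))) (- PI)).
  { apply (Rabs_diff_le_open (fun z => I0 G s z - Th (z - x0) / ww) (fun x => / r G s x - / rr (x - x0))
             (fun z => 11000 * eta * ln ((z - x0) + sqrt (eps + (z - x0) ^ 2)))
             (fun x => 11000 * eta / sqrt (eps + (x - x0) ^ 2))); [lra | | | | |].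
    - intros x _. apply continuous_Rminus; eapply is_derive_continuous; [apply DI | apply DT].
    - intros x _. eapply is_derive_continuous, DL.
    - intros x _. apply (is_derive_minus (I0 G s) (fun z => Th (z - x0) / ww)); auto.
    - intros x _. apply DL.
    - intros x Hx. apply inv_diff_bound. lra. }
  cbv beta in B. unfold I0 in B at 2.
  rewrite (RInt_point (- PI) (fun y => / r G s y)) in B. unfold zero in B; simpl in B.
  pose proof (asinh_increment z Hz) as A.
  assert (0 <= 11000 * eta) by lra.
  replace (I0 G s z - (Th (z - x0) - Th (- PI - x0)) / ww)
    with (I0 G s z - Th (z - x0) / ww - (0 - Th (- PI - x0) / ww)) by (unfold Rdiv; ring).
  apply Rle_trans with (1 := B). simpl in A. nra.
Qed.

(** The profile is centred at [x0], the interval at 0. Near the ends [r0 >= 1/30], so [Th] has slope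
    at most [30 ww] there, and the shift [|x0| <= 2 eta] costs [60 eta ww]. *)
Lemma Theta_shift a : Rabs a = PI -> Rabs (Th (a - x0) - Th a) <= 60 * eta * ww.
Proof.
  intros Ha. pose proof ww_pos as Hw. pose proof eta_bounds as He. pose proof PI_gt_3. pose proof PI_4.
  destruct max_point_bounds as [Bx _]. destruct param_bounds as [_ [_ [Eb _]]].
  destruct (MVT_gen Th a (a - x0) (fun y => ww / rr y)) as [c [Hc EQ]].
  - intros; apply is_derive_Theta; [apply q_nonneg | apply q_lt_p].
  - intros; apply continuous_pt. eapply is_derive_continuous, is_derive_Theta; [apply q_nonneg | apply q_lt_p].
  - rewrite EQ. replace (a - x0 - a) with (- x0) by ring.
    assert (Cc : Rabs (c - a) <= 1 / 2).
    { apply Rabs_le_between in Bx. apply Rabs_le. unfold Rmin, Rmax in Hc.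
      destruct (Rle_dec a (a - x0)); lra. }
    assert (C1 : 1 <= c ^ 2 /\ Rabs c <= PI + 1).
    { apply Rabs_le_between in Cc. unfold Rabs in Ha. split.
      - destruct (Rcase_abs a); nra.
      - apply Rabs_le. destruct (Rcase_abs a); lra. }
    pose proof (r0_lower c (proj2 C1)) as B.
    assert (Q : 0 <= ww / rr c <= 30 * ww).
    { split; [apply Rdiv_le_0_compat; lra|]. apply Rle_div_l; [lra|]. nra. }
    rewrite Rabs_mult, Rabs_Ropp, (Rabs_pos_eq (ww / rr c)) by lra.
    pose proof (Rabs_pos x0). nra.
Qed.

Lemma Theta_ends : Rabs (Th (PI - x0) - PI) <= 60 * eta * ww /\ Rabs (Th (- PI - x0) + PI) <= 60 * eta * ww.
Proof.
  pose proof PI_RGT_0. split.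
  - pose proof (Theta_shift PI ltac:(apply Rabs_pos_eq; lra)) as B.
    rewrite Theta_PI in B by (apply q_nonneg || apply q_lt_p). exact B.
  - pose proof (Theta_shift (- PI) ltac:(rewrite Rabs_Ropp; apply Rabs_pos_eq; lra)) as B.
    rewrite Theta_mPI in B by (apply q_nonneg || apply q_lt_p).
    now replace (Th (- PI - x0) + PI) with (Th (- PI - x0) - - PI) by ring.
Qed.

(** [ww^2 = eps (p + q)] with [p + q <= 9/4], and [- y ln y <= 1 - y] at [y = sqrt eps]. *)
Lemma w_Lam_bound : ww <= 3 / 2 * sqrt eps /\ sqrt eps * Lam <= 24.
Proof.
  destruct param_bounds as [Q [QP [Eb [_ [PQ [Bpq _]]]]]].
  assert (S : 0 < sqrt eps) by (apply sqrt_lt_R0; lra).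
  assert (S2 : sqrt eps ^ 2 = eps) by (apply pow2_sqrt; lra). split.
  - apply Rnot_lt_le. intros L. pose proof (w_sqr p q Q QP) as W.
    replace (p ^ 2 - q ^ 2) with ((p - q) * (p + q)) in W by ring. rewrite PQ, <- S2 in W.
    assert ((3 / 2 * sqrt eps) ^ 2 < ww ^ 2) by nra. nra.
  - assert (L : ln eps = 2 * ln (sqrt eps)).
    { rewrite <- S2 at 1. replace (sqrt eps ^ 2) with (sqrt eps * sqrt eps) by ring.
      rewrite ln_mult by lra. ring. }
    pose proof (ln_le_minus_1 (/ sqrt eps) (Rinv_0_lt_compat _ S)) as L2.
    rewrite ln_Rinv in L2 by lra.
    assert (sqrt eps <= 1) by nra.
    rewrite L. assert (sqrt eps * (- ln (sqrt eps)) <= sqrt eps * (/ sqrt eps - 1)) by (apply Rmult_le_compat_l; lra).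
    replace (sqrt eps * (/ sqrt eps - 1)) with (1 - sqrt eps) in H0 by (field; lra). lra.
Qed.

(** The first part uses [ww Lam <= 3/2 * 24 = 36]. The second lets endpoint errors of size [eta ww]
    be absorbed, as [Lam >= 22], in the margin between 11000 and 11200. *)
Lemma E_bounds : 0 <= E <= / 100 /\ 200 * (eta * ww) * 22 <= 200 * eta * (ww * Lam).
Proof.
  pose proof eta_bounds as He. pose proof Lam_ge as HL. pose proof ww_pos as Hw.
  destruct w_Lam_bound as [W1 W2].
  destruct param_bounds as [_ [_ [Eb _]]].
  assert (S : 0 < sqrt eps) by (apply sqrt_lt_R0; lra).
  assert (0 <= ww * Lam <= 36).
  { split; [nra|]. apply Rle_trans with (3 / 2 * (sqrt eps * Lam)); [nra | lra]. }
  split; [nra|]. replace (200 * (eta * ww) * 22) with (200 * eta * (ww * 22)) by ring.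
  apply Rmult_le_compat_l; [lra|]. apply Rmult_le_compat_l; lra.
Qed.

(** For the exact profile the total integral of [1 / r0] is [2 PI / ww], that is [K ww = 1]. The
    deviation consists of the integral error at [z = PI] and the two endpoint shifts. *)
Lemma Kw_bound : Rabs (K G s * ww - 1) <= E.
Proof.
  pose proof PI_gt_3. pose proof ww_pos as Hw. pose proof eta_bounds as He.
  pose proof (I0_bound PI ltac:(lra)) as B. destruct Theta_ends as [T1 T2].
  destruct E_bounds as [EB EB']. rewrite I0_PI in B.
  set (k := K G s) in *.
  set (F := 2 * PI * k - (Th (PI - x0) - Th (- PI - x0)) / ww) in *.
  assert (EQ : 2 * PI * (k * ww - 1) = ww * F + (Th (PI - x0) - PI) - (Th (- PI - x0) + PI)).
  { unfold F. field. lra. }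
  assert (BF : Rabs (ww * F) <= 11000 * eta * (ww * Lam)).
  { rewrite Rabs_mult, Rabs_pos_eq by lra. nra. }
  apply Rabs_le_between in BF. apply Rabs_le_between in T1. apply Rabs_le_between in T2.
  assert (Rabs (2 * PI * (k * ww - 1)) <= E) by (rewrite EQ; apply Rabs_le; lra).
  rewrite Rabs_mult, (Rabs_pos_eq (2 * PI)) in H0 by lra.
  pose proof (Rabs_pos (k * ww - 1)). nra.
Qed.

Lemma K_slice_pos : 0 < K G s.
Proof. apply (K_pos G m (cp_c0 _ _ _ _ _ HP) m_pos G_le G_ge s Ds). Qed.

Lemma K_sqr_bounds : 98 / 100 <= K G s ^ 2 * (eps * (p + q)) <= 103 / 100.
Proof.
  pose proof Kw_bound as B. apply Rabs_le_between in B. destruct E_bounds as [EB _].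
  pose proof K_slice_pos as Hk. pose proof ww_pos as Hw.
  destruct param_bounds as [Q [QP [Eb [_ [PQ [Bpq _]]]]]].
  pose proof (w_sqr p q Q QP) as W.
  replace (K G s ^ 2 * (eps * (p + q))) with ((K G s * ww) ^ 2).
  - set (x := K G s * ww) in *. nra.
  - rewrite Rpow_mult_distr, W, <- PQ. ring.
Qed.

(** With [k = 1 / (K ww)], which is within [1.02 E] of 1, the difference splits into the integral
    error, [k - 1] times [Th], [k - 1] times [PI], and the endpoint error; the bounds [|Th| <= 5]
    and [PI <= 4] leave the sum below [21 E]. *)
Lemma X_Theta z : - PI <= z <= PI -> Rabs (X G s z - Th (z - x0)) <= 21 * E.
Proof.
  intros Hz. pose proof PI_gt_3. pose proof PI_4. pose proof ww_pos as Hw. pose proof eta_bounds as He.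
  pose proof (I0_bound z Hz) as B. destruct Theta_ends as [T1 T2].
  destruct E_bounds as [EB EB']. pose proof Kw_bound as BK. pose proof K_slice_pos as Hk.
  assert (HT : Rabs (Th (z - x0)) <= 5).
  { assert (M : forall a b, a <= b -> Th a <= Th b).
    { intros a b [L|L]; [left; apply Theta_incr; auto; [apply q_nonneg | apply q_lt_p] | rewrite L; lra]. }
    pose proof (M (z - x0) (PI - x0) ltac:(lra)). pose proof (M (- PI - x0) (z - x0) ltac:(lra)).
    apply Rabs_le_between in T1. apply Rabs_le_between in T2. apply Rabs_le.
    pose proof Lam_ge. lra. }
  set (k := / (K G s * ww)).
  assert (Hkw : 99 / 100 <= K G s * ww) by (apply Rabs_le_between in BK; lra).
  assert (Hk1 : 0 <= k <= 102 / 100).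
  { unfold k. split; [left; apply Rinv_0_lt_compat; lra|].
    apply Rle_trans with (/ (99 / 100)); [apply Rinv_le_contravar; lra | lra]. }
  assert (Hk2 : Rabs (k - 1) <= 102 / 100 * E).
  { replace (k - 1) with (k * - (K G s * ww - 1)) by (unfold k; field; nra).
    rewrite Rabs_mult, Rabs_Ropp, (Rabs_pos_eq k) by lra.
    pose proof (Rabs_pos (K G s * ww - 1)). nra. }
  set (F := I0 G s z - (Th (z - x0) - Th (- PI - x0)) / ww) in *.
  set (t := Th (- PI - x0) + PI) in *.
  assert (EQ : X G s z - Th (z - x0) = k * (ww * F) + (k - 1) * Th (z - x0) + (k - 1) * PI - k * t).
  { unfold X, F, k, t. field. split; lra. }
  assert (BF : Rabs (ww * F) <= E).
  { rewrite Rabs_mult, Rabs_pos_eq by lra. pose proof Lam_ge.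
    apply Rle_trans with (ww * (11000 * eta * Lam)); [apply Rmult_le_compat_l; lra | nra]. }
  assert (Bt : Rabs t <= E) by nra.
  assert (MM : forall a b A B, Rabs a <= A -> Rabs b <= B -> Rabs (a * b) <= A * B).
  { intros a b A0 B0 H1 H2. rewrite Rabs_mult. apply Rmult_le_compat; auto; apply Rabs_pos. }
  pose proof (MM k (ww * F) _ _ ltac:(rewrite Rabs_pos_eq by lra; apply (proj2 Hk1)) BF) as M1.
  pose proof (MM _ _ _ _ Hk2 HT) as M2.
  pose proof (MM (k - 1) PI _ 4 Hk2 ltac:(rewrite Rabs_pos_eq; lra)) as M3.
  pose proof (MM k t _ _ ltac:(rewrite Rabs_pos_eq by lra; apply (proj2 Hk1)) Bt) as M4.
  rewrite EQ. apply Rabs_le_between in M1. apply Rabs_le_between in M2.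
  apply Rabs_le_between in M3. apply Rabs_le_between in M4. apply Rabs_le. lra.
Qed.

(** For the exact profile [- kap sin y * ww / r0] is [- kap sin Th]. Four replacements cost an
    error: [1 / K] by [ww], [g1] by the sine, [1 / r] by [1 / r0], and [Th] by [X]. Nothing blows up
    as [eps] tends to 0, because [ww <= 3/2 R], [|g1| <= 2 R] and [1 / r <= 60 / R^2] have the
    bounded product 180. *)
Lemma slope_bound z : - PI <= z <= PI ->
  Rabs (g1 z / (K G s * r G s z) + kap * sin (X G s z)) <= 400 * E.
Proof.
  intros Hz. pose proof ww_pos as Hw. pose proof eta_bounds as He.
  pose proof (X_Theta z Hz) as BX. pose proof (e1_bound z Hz) as B1.
  pose proof (inv_diff_bound z Hz) as BI. pose proof (r_lower z Hz) as Br.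
  destruct E_bounds as [EB EB']. pose proof Kw_bound as BK. pose proof K_slice_pos as Hk.
  pose proof (y_bound z Hz) as Y. pose proof PI_4. destruct w_Lam_bound as [W1 _].
  destruct max_point_bounds as [_ [_ [_ Bk]]]. apply Rabs_le_between in Bk.
  destruct param_bounds as [Q [QP [Eb _]]]. pose proof (pow2_ge_0 (z - x0)) as Y0.
  destruct (Theta_cos_sin p q Q QP (z - x0)) as [_ HS].
  pose proof (r0_pos p q Q QP (z - x0)) as Hr0.
  assert (HR : 0 < sqrt (eps + (z - x0) ^ 2)) by (apply sqrt_lt_R0; lra).
  assert (HR2 : sqrt (eps + (z - x0) ^ 2) ^ 2 = eps + (z - x0) ^ 2) by (apply pow2_sqrt; lra).
  assert (Ha : Rabs (z - x0) <= sqrt (eps + (z - x0) ^ 2)).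
  { rewrite <- sqrt_Rsqr_abs. apply sqrt_le_1_alt. unfold Rsqr. nra. }
  assert (Hse : sqrt eps <= sqrt (eps + (z - x0) ^ 2)) by (apply sqrt_le_1_alt; lra).
  set (R := sqrt (eps + (z - x0) ^ 2)) in *. rewrite <- HR2 in Br.
  assert (HR2p : 0 < R ^ 2) by (apply pow_lt; lra).
  assert (Hr : 0 < r G s z) by lra.
  set (k := / (K G s * ww)).
  assert (Hkw : 99 / 100 <= K G s * ww) by (apply Rabs_le_between in BK; lra).
  assert (Hk1 : 0 <= k <= 102 / 100).
  { unfold k. split; [left; apply Rinv_0_lt_compat; lra|].
    apply Rle_trans with (/ (99 / 100)); [apply Rinv_le_contravar; lra | lra]. }
  assert (Hk2 : Rabs (k - 1) <= 102 / 100 * E).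
  { replace (k - 1) with (k * - (K G s * ww - 1)) by (unfold k; field; nra).
    rewrite Rabs_mult, Rabs_Ropp, (Rabs_pos_eq k) by lra.
    pose proof (Rabs_pos (K G s * ww - 1)). nra. }
  set (e1 := g1 z + kap * sin (z - x0)) in *.
  set (di := / r G s z - / rr (z - x0)) in *.
  assert (MM : forall a b A B, Rabs a <= A -> Rabs b <= B -> Rabs (a * b) <= A * B).
  { intros a b A0 B0 H1 H2. rewrite Rabs_mult. apply Rmult_le_compat; auto; apply Rabs_pos. }
  assert (Ir : 0 < / r G s z <= 60 / R ^ 2).
  { split; [apply Rinv_0_lt_compat; lra|].
    replace (60 / R ^ 2) with (/ (R ^ 2 / 60)) by (field; lra).
    apply Rinv_le_contravar; lra. }
  assert (Sy : Rabs (sin (z - x0)) <= Rabs (z - x0)).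
  { pose proof (Rabs_sin_minus (z - x0) 0) as S. now rewrite sin_0, !Rminus_0_r in S. }
  pose proof (Rabs_pos (z - x0)) as Ya.
  rewrite <- pow2_abs in B1. set (a := Rabs (z - x0)) in *.
  assert (Bg : Rabs (g1 z) <= 2 * R).
  { replace (g1 z) with (e1 - kap * sin (z - x0)) by (unfold e1; ring).
    assert (S1 : Rabs (kap * sin (z - x0)) <= 11 / 10 * a).
    { apply MM; [rewrite Rabs_pos_eq; lra | exact Sy]. }
    assert (S2 : 6 * eta * a ^ 2 <= / 10 * a) by nra.
    apply Rle_trans with (2 * a); [|lra].
    apply Rabs_le_between in S1. apply Rabs_le_between in B1. apply Rabs_le. lra. }
  assert (Gr : Rabs (ww * (g1 z * / r G s z)) <= 180).
  { apply Rle_trans with (3 / 2 * R * (2 * R * (60 / R ^ 2))).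
    - apply MM; [rewrite Rabs_pos_eq; lra|]. apply MM; [exact Bg|]. rewrite Rabs_pos_eq; lra.
    - right. field. lra. }
  assert (T1 : Rabs ((k - 1) * (ww * (g1 z * / r G s z))) <= 102 / 100 * E * 180) by (apply MM; auto).
  assert (T2 : Rabs (ww * (e1 * / r G s z)) <= ww * (360 * eta)).
  { apply MM; [rewrite Rabs_pos_eq; lra|].
    apply Rle_trans with (6 * eta * R ^ 2 * (60 / R ^ 2)).
    - apply MM; [|rewrite Rabs_pos_eq; lra]. apply Rle_trans with (1 := B1).
      apply Rmult_le_compat_l; [lra|]. apply pow_incr. lra.
    - right. field. lra. }
  assert (T3 : Rabs (ww * (kap * (sin (z - x0) * di))) <= ww * (12100 * eta)).
  { apply MM; [rewrite Rabs_pos_eq; lra|].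
    apply Rle_trans with (11 / 10 * (R * (11000 * eta / R))).
    - apply MM; [rewrite Rabs_pos_eq; lra|]. apply MM; [lra | exact BI].
    - right. field. lra. }
  assert (T4 : Rabs (kap * (sin (X G s z) - sin (Th (z - x0)))) <= 11 / 10 * (21 * E)).
  { apply MM; [rewrite Rabs_pos_eq; lra|].
    eapply Rle_trans; [apply Rabs_sin_minus | exact BX]. }
  assert (EQ : g1 z / (K G s * r G s z) + kap * sin (X G s z)
     = (k - 1) * (ww * (g1 z * / r G s z)) + ww * (e1 * / r G s z)
       - ww * (kap * (sin (z - x0) * di)) + kap * (sin (X G s z) - sin (Th (z - x0)))).
  { rewrite HS. unfold k, e1, di. field. repeat split; lra. }
  rewrite EQ. apply Rabs_le_between in T1. apply Rabs_le_between in T2.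
  apply Rabs_le_between in T3. apply Rabs_le_between in T4. apply Rabs_le.
  pose proof Lam_ge. assert (12460 * (ww * eta) <= E) by nra. lra.
Qed.

Lemma h1_bound x : - PI < x < PI -> Rabs (h1 G g1 s x + kap * sin x) <= 400 * E.
Proof.
  intros Hx.
  destruct (label_spec G m (cp_c0 _ _ _ _ _ HP) m_pos G_le G_ge s x Ds) as [HZ HX].
  rewrite clamp_id in HX by lra.
  pose proof (slope_bound _ HZ) as B. rewrite HX in B. exact B.
Qed.

Lemma h0_bound x : - PI <= x <= PI -> Rabs (h0 G s x - kap * cos x) <= 8 * (400 * E).
Proof.
  intros Hx. pose proof PI_gt_3.
  pose proof (cp_c0 _ _ _ _ _ HP) as cG.
  assert (DC : forall x, is_derive (fun x => kap * sin x) x (kap * cos x))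
    by (intros; auto_derive; auto; ring).
  apply (mean_zero_bound (fun x => h0 G s x - kap * cos x) (fun x => h1 G g1 s x + kap * sin x)); auto.
  - intros y. cont. now apply (continuous_h0 G m cG m_pos G_le G_ge).
  - intros y Hy.
    pose proof (is_derive_h0 G g1 m cG (cp_d0 _ _ _ _ _ HP) m_pos G_le G_ge s y Ds Hy) as D.
    assert (DC' : is_derive (fun x => kap * cos x) y (- kap * sin y)) by (auto_derive; auto; ring).
    pose proof (is_derive_minus _ _ _ _ _ D DC') as D'.
    apply (is_derive_val _ _ _ _ D'). unfold minus, plus, opp; simpl. ring.
  - intros y Hy. now apply h1_bound.
  - rewrite (RInt_ext_all _ (fun y => 1 * h0 G s y + (-1) * (kap * cos y))) by (intros; ring).
    rewrite (RInt_lin (h0 G s) (fun y => kap * cos y)).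
    + rewrite (RInt_h0 G m cG m_pos G_le G_ge), (label_right G m cG m_pos G_le G_ge),
        (Xs_right G m cG m_pos G_le G_ge) by (auto; lra).
      rewrite (FTC_open (fun x => kap * sin x) (fun y => kap * cos y)); auto.
      * rewrite sin_neg, sin_PI. eqR. unfold Rdiv. ring.
      * lra.
      * intros; cont.
      * intros; cont.
    + intros y. now apply (continuous_h0 G m cG m_pos G_le G_ge).
    + intros; cont.
Qed.

Lemma E_sqrt_bound : E <= 16800 * eta * (sqrt eps * Lam).
Proof.
  destruct w_Lam_bound as [W1 _]. pose proof Lam_ge. pose proof eta_bounds.
  assert (ww * Lam <= 3 / 2 * sqrt eps * Lam) by (apply Rmult_le_compat_r; lra). nra.
Qed.

Lemma K_blowup : 4 / 10 <= (1 - m * s) * K G s ^ 2.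
Proof.
  pose proof K_sqr_bounds as B. destruct param_bounds as [_ [_ [Eb [_ [_ [Bpq _]]]]]].
  set (u := K G s ^ 2) in *. assert (0 <= u) by apply pow2_ge_0.
  assert (u * (eps * (p + q)) <= 22 / 10 * (eps * u)).
  { replace (u * (eps * (p + q))) with ((p + q) * (eps * u)) by ring.
    apply Rmult_le_compat_r; nra. }
  lra.
Qed.

(** The actual size is about [1 / (eps (p + q))], with [p + q] close to [1 + m s]. The factor 3/2
    absorbs all errors, and the right side is the derivative of [3/4 (ln (1 + m s) - ln (1 - m s))];
    this is where the exponent 4/3 originates. *)
Lemma K_sqr_upper : K G s ^ 2 <= 3 / 2 * m / ((1 + m * s) * (1 - m * s)).
Proof.
  pose proof K_sqr_bounds as B. destruct param_bounds as [_ [_ [Eb [S1 [_ [Bpq _]]]]]].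
  pose proof eta_bounds as He. destruct max_point_bounds as [_ [_ [Bm Bk]]]. apply Rabs_le_between in Bk.
  assert (Hms : 0 <= m * s) by nra.
  apply (proj1 (Rle_div_r _ _ _ (Rmult_lt_0_compat (1 + m * s) (1 - m * s) ltac:(lra) ltac:(lra)))).
  set (u := K G s ^ 2) in *. assert (0 <= u) by apply pow2_ge_0.
  assert (C : 103 / 100 * (1 + m * s) <= 3 / 2 * m * (p + q)).
  { assert (99 / 100 * (1 + m * s) <= p + q) by nra. nra. }
  apply Rmult_le_reg_r with (p + q); [lra|].
  replace (u * ((1 + m * s) * eps) * (p + q)) with ((u * (eps * (p + q))) * (1 + m * s)) by ring.
  apply Rle_trans with (103 / 100 * (1 + m * s)); [apply Rmult_le_compat_r; lra | lra].
Qed.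

End Slice.

(** * Decay in physical time *)

Lemma T_upper s : 0 <= s -> dom m s -> T G s <= 3 / 4 * (ln (1 + m * s) - ln (1 - m * s)).
Proof.
  intros Hs Ds. pose proof m_pos as Hm.
  assert (HD : forall u, 0 <= u <= s -> dom m u) by (intros u Hu; unfold dom in *; lra).
  assert (DL : forall u, 0 <= u <= s ->
     is_derive (fun u => 3 / 4 * (ln (1 + m * u) - ln (1 - m * u))) u
               (3 / 2 * m / ((1 + m * u) * (1 - m * u)))).
  { intros u Hu. pose proof (dom_m m Hm u (HD u Hu)). assert (0 <= m * u) by nra.
    auto_derive; [lra|]. field. lra. }
  assert (DT : forall u, 0 <= u <= s -> is_derive (T G) u (K G u ^ 2)).
  { intros u Hu. apply (is_derive_T G m (cp_c0 _ _ _ _ _ HP) Hm G_le G_ge), HD, Hu. }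
  assert (B : T G s - T G 0 <= (fun u => 3 / 4 * (ln (1 + m * u) - ln (1 - m * u))) s
                              - (fun u => 3 / 4 * (ln (1 + m * u) - ln (1 - m * u))) 0).
  { apply (diff_le_open (T G) (fun u => K G u ^ 2) (fun u => 3 / 4 * (ln (1 + m * u) - ln (1 - m * u)))
            (fun u => 3 / 2 * m / ((1 + m * u) * (1 - m * u)))); auto.
    - intros u Hu. eapply is_derive_continuous, DT, Hu.
    - intros u Hu. eapply is_derive_continuous, DL, Hu.
    - intros u Hu. apply DT. lra.
    - intros u Hu. apply DL. lra.
    - intros u Hu. apply K_sqr_upper; [lra | apply HD; lra]. }
  cbv beta in B. replace (1 + m * 0) with 1 in B by ring.
  replace (1 - m * 0) with 1 in B by ring. rewrite T_0, ln_1 in B. lra.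
Qed.

(** With [l = - ln e], the root is [exp (- l/2)] and the logarithmic factor costs [22 exp (l/8)].
    The remaining exponent [3 l / 8] is exactly [t/2] when [l = 4 t / 3]; the additive constant
    costs a factor [exp 1 <= 3], and [66 = 22 * 3]. *)
Lemma sqrt_eps_decay e t : 0 < e <= 1 -> t <= 3 / 4 * (1 - ln e) ->
  sqrt e * (22 - ln e) <= 66 * exp (- (t / 2)).
Proof.
  intros He Ht. set (l := - ln e) in *.
  assert (S : sqrt e = exp (- (l / 2))).
  { apply sqrt_lem_1; [lra | left; apply exp_pos|].
    rewrite <- exp_plus. replace (- (l / 2) + - (l / 2)) with (ln e) by (unfold l; field).
    apply exp_ln. lra. }
  replace (22 - ln e) with (22 + l) by (unfold l; ring). rewrite S.
  pose proof (exp_ineq1_le (l / 8)) as X1. pose proof (exp_pos (l / 8)).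
  pose proof (ln_le_minus_1 e ltac:(lra)) as L0.
  assert (X2 : 22 + l <= 22 * exp (l / 8)).
  { unfold l in *. lra. }
  apply Rle_trans with (exp (- (l / 2)) * (22 * exp (l / 8))).
  - apply Rmult_le_compat_l; [left; apply exp_pos | exact X2].
  - replace (exp (- (l / 2)) * (22 * exp (l / 8))) with (22 * (exp (- (l / 2)) * exp (l / 8))) by ring.
    rewrite <- exp_plus.
    assert (exp (- (l / 2) + l / 8) <= 3 * exp (- (t / 2))).
    { apply Rle_trans with (exp (1 + - (t / 2))).
      - destruct (Req_dec (- (l / 2) + l / 8) (1 + - (t / 2))) as [->|N]; [lra|].
        left. apply exp_increasing. unfold l in *. lra.
      - rewrite exp_plus. apply Rmult_le_compat_r; [left; apply exp_pos | apply exp_le_3]. }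
    lra.
Qed.

Lemma perturbation_PJ : PJ_solution G (sol G m).
Proof.
  apply (sol_PJ G g1 g2 g3 m) with (c := 4 / 10); try (destruct HP; assumption).
  - apply m_pos.
  - apply G_le.
  - apply G_ge.
  - lra.
  - intros s Hs Ds. now apply K_blowup.
Qed.

(** The constant dominates [8 * 400 * 16800 * 66], the factors of [h0_bound], [h1_bound],
    [E_sqrt_bound] and [sqrt_eps_decay]. *)
Lemma perturbation_decay t x : 0 <= t -> - PI < x < PI ->
  Rabs (sol G m t x - kap * cos x) <= 4000000000 * eta * exp (- (t / 2)) /\
  exists d, is_derive (sol G m t) x d /\
    Rabs (d + kap * sin x) <= 4000000000 * eta * exp (- (t / 2)).
Proof.
  intros Ht Hx. pose proof (cp_c0 _ _ _ _ _ HP) as cG. pose proof eta_bounds as He.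
  pose proof (t_min_neg G m cG m_pos G_le G_ge) as Hmin.
  assert (BU : forall s, 0 <= s -> dom m s -> 4 / 10 <= (1 - m * s) * K G s ^ 2)
    by (intros s Hs Ds; now apply K_blowup).
  destruct (tau_spec G m cG m_pos G_le G_ge (4 / 10) ltac:(lra) BU t ltac:(lra)) as [D ET].
  pose proof (tau_nonneg G m cG m_pos G_le G_ge (4 / 10) ltac:(lra) BU t Ht) as N.
  unfold sol. set (s := tau G m t) in *.
  pose proof (dom_m m m_pos s D) as Dm. pose proof m_pos as Hm.
  pose proof (T_upper s N D) as TU. rewrite ET in TU.
  assert (0 <= m * s) by nra.
  pose proof (ln_le_minus_1 (1 + m * s) ltac:(lra)) as L1.
  pose proof (sqrt_eps_decay (1 - m * s) t ltac:(lra) ltac:(lra)) as SD.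
  pose proof (E_sqrt_bound s N D) as ES.
  pose proof (h1_bound s N D x Hx) as B1. pose proof (h0_bound s N D x ltac:(lra)) as B0.
  pose proof (exp_pos (- (t / 2))) as EP.
  assert (16800 * eta * (sqrt (1 - m * s) * (22 - ln (1 - m * s))) <= 16800 * eta * (66 * exp (- (t / 2))))
    by (apply Rmult_le_compat_l; lra).
  assert (0 <= eta * exp (- (t / 2))) by nra.
  split; [lra|]. exists (h1 G g1 s x). split; [|lra].
  apply (is_derive_h0 G g1 m cG (cp_d0 _ _ _ _ _ HP) m_pos G_le G_ge s x D Hx).
Qed.

End Perturbation.

(** * Normalisation and conclusion *)

Lemma supI_ge (g : R -> R) x : - PI < x < PI -> Rbar_le (Rabs (g x)) (supI g).
Proof.
  intros Hx. apply (proj1 (Lub_Rbar_correct _)). now exists x.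
Qed.

Lemma supI_nonneg (g : R -> R) : Rbar_le 0 (supI g).
Proof.
  pose proof PI_RGT_0. apply Rbar_le_trans with (Rabs (g 0)); [apply Rabs_pos|].
  apply supI_ge. lra.
Qed.

Lemma supI_le (g : R -> R) M : (forall x, - PI < x < PI -> Rabs (g x) <= M) -> Rbar_le (supI g) M.
Proof.
  intros H. apply (proj2 (Lub_Rbar_correct _)). intros y [x [Hx ->]]. now apply H.
Qed.

Lemma Rbar_plus_finite_inv (A B : Rbar) s :
  Rbar_le 0 A -> Rbar_le 0 B -> Rbar_plus A B = Finite s ->
  exists a b, A = Finite a /\ B = Finite b /\ 0 <= a /\ 0 <= b /\ a + b = s.
Proof.
  destruct A as [a| |], B as [b| |]; simpl; intros HA HB H; try easy.
  exists a, b. injection H. auto.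
Qed.

Lemma CkNorm_nonneg k f : Rbar_le 0 (CkNorm k f).
Proof.
  induction k as [|k IH]; [apply supI_nonneg|].
  change (Rbar_le 0 (Rbar_plus (CkNorm k f) (supI (Derive_n f (S k))))).
  replace (Finite 0) with (Rbar_plus 0 0) by (simpl; f_equal; ring).
  apply Rbar_plus_le_compat; [exact IH | apply supI_nonneg].
Qed.

Lemma CkNorm_bound k f s : CkNorm k f = Finite s ->
  0 <= s /\ forall j, (j <= k)%nat -> forall x, - PI < x < PI -> Rabs (Derive_n f j x) <= s.
Proof.
  revert s. induction k as [|k IH]; intros s H.
  - simpl in H. split.
    + pose proof (supI_nonneg f) as P. now rewrite H in P.
    + intros j Hj x Hx. replace j with 0%nat by lia.
      pose proof (supI_ge f x Hx) as P. now rewrite H in P.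
  - change (Rbar_plus (CkNorm k f) (supI (Derive_n f (S k))) = Finite s) in H.
    destruct (Rbar_plus_finite_inv _ _ _ (CkNorm_nonneg k f) (supI_nonneg _) H)
      as [a [b [Ha [Hb [Pa [Pb E]]]]]].
    destruct (IH a Ha) as [_ B]. split; [lra|].
    intros j Hj x Hx. destruct (Nat.eq_dec j (S k)) as [->|N].
    + pose proof (supI_ge (Derive_n f (S k)) x Hx) as P. rewrite Hb in P. simpl in P |- *. lra.
    + specialize (B j ltac:(lia) x Hx). lra.
Qed.

Lemma bound_closure (f : R -> R) M :
  (forall x, continuous f x) -> (forall x, - PI < x < PI -> Rabs (f x) <= M) ->
  forall x, - PI <= x <= PI -> Rabs (f x) <= M.
Proof.
  intros Hc HM x Hx. pose proof PI_gt_3. apply Rnot_lt_le. intros L.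
  destruct (proj1 (continuous_eps f x) (Hc x) (Rabs (f x) - M) ltac:(lra)) as [d [Hd H1]].
  set (e := Rmin (d / 2) 1).
  assert (He : 0 < e /\ e <= d / 2 /\ e <= 1).
  { unfold e. pose proof (Rmin_l (d / 2) 1). pose proof (Rmin_r (d / 2) 1).
    split; [apply Rmin_pos; lra | lra]. }
  assert (B : forall y, - PI < y < PI -> Rabs (y - x) < d -> False).
  { intros y Hy Hyd. specialize (H1 y Hyd). specialize (HM y Hy).
    pose proof (Rabs_triang_inv (f x) (f y)). rewrite Rabs_minus_sym in H1. lra. }
  destruct (Rle_dec x 0).
  - apply (B (x + e)); [lra|]. replace (x + e - x) with e by ring. rewrite Rabs_pos_eq; lra.
  - apply (B (x - e)); [lra|]. replace (x - e - x) with (- e) by ring.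
    rewrite Rabs_Ropp, Rabs_pos_eq; lra.
Qed.

Lemma CkI_3_derivatives a0 : CkI 3 a0 ->
  exists f0 f1 f2 f3 : R -> R,
    (forall x, continuous f0 x) /\ (forall x, continuous f1 x) /\
    (forall x, continuous f2 x) /\ (forall x, continuous f3 x) /\
    (forall x, - PI <= x <= PI -> f0 x = a0 x) /\
    (forall x, - PI < x < PI ->
       is_derive f0 x (f1 x) /\ is_derive f1 x (f2 x) /\ is_derive f2 x (f3 x) /\ Derive_n a0 2 x = f2 x).
Proof.
  intros H.
  destruct (H 0%nat ltac:(lia)) as [f0 [C0 [_ E0]]].
  destruct (H 1%nat ltac:(lia)) as [f1 [C1 [D1 _]]].
  destruct (H 2%nat ltac:(lia)) as [f2 [C2 [D2 _]]].
  destruct (H 3%nat ltac:(lia)) as [f3 [C3 [D3 _]]].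
  specialize (E0 eq_refl).
  exists f0, f1, f2, f3. do 5 (split; [assumption|]).
  intros x Hx. split; [|split; [|split]].
  - apply (is_derive_ext_loc a0).
    + apply (locally_Ioo (- PI) PI); auto. intros u Hu. symmetry. apply E0. lra.
    + destruct (D1 x Hx) as [X Y]. simpl in X, Y. rewrite <- Y. now apply Derive_correct.
  - apply (is_derive_ext_loc (Derive_n a0 1)).
    + apply (locally_Ioo (- PI) PI); auto. intros u Hu. now apply D1.
    + destruct (D2 x Hx) as [X Y]. rewrite <- Y. now apply Derive_correct.
  - apply (is_derive_ext_loc (Derive_n a0 2)).
    + apply (locally_Ioo (- PI) PI); auto. intros u Hu. now apply D2.
    + destruct (D3 x Hx) as [X Y]. rewrite <- Y. now apply Derive_correct.
  - now apply D2.
Qed.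

(** The continuous extensions supplied by [CkI] are clamped and divided by [mu]; bounds known on the
    open interval pass to its closure by continuity. *)
Lemma normalized_datum a0 mu sigma :
  0 < mu -> CkI 3 a0 -> RInt a0 (- PI) PI = 0 ->
  CkNorm 3 (fun x => a0 x - mu * cos x) = Finite sigma -> sigma <= delta0 * mu ->
  exists G g1 g2 g3, cos_perturbation G g1 g2 g3 (sigma / mu) /\
    (forall x, - PI <= x <= PI -> a0 x = mu * G x) /\
    (forall x, - PI < x < PI -> Derive_n a0 2 x = mu * g2 x).
Proof.
  intros Hmu HC Hmean HN Hsig. pose proof PI_gt_3.
  destruct (CkNorm_bound _ _ _ HN) as [Hs0 HB].
  destruct (CkI_3_derivatives a0 HC) as [f0 [f1 [f2 [f3 [C0 [C1 [C2 [C3 [E0 HD]]]]]]]]].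
  set (F := fun x => a0 x - mu * cos x) in *.
  assert (D0 : forall x, - PI < x < PI -> is_derive F x (f1 x + mu * sin x)).
  { intros x Hx. apply (is_derive_ext_loc (fun x => f0 x - mu * cos x)).
    - apply (locally_Ioo (- PI) PI); auto. intros u Hu. unfold F. rewrite E0 by lra. reflexivity.
    - destruct (HD x Hx) as [D _]. assert (ex_derive f0 x) by (eexists; exact D).
      auto_derive; [auto|]. rewrite_Derive f0 D. ring. }
  assert (D1 : forall x, - PI < x < PI -> is_derive (fun x => f1 x + mu * sin x) x (f2 x + mu * cos x)).
  { intros x Hx. destruct (HD x Hx) as [_ [D _]]. assert (ex_derive f1 x) by (eexists; exact D).
    auto_derive; [auto|]. rewrite_Derive f1 D. ring. }
  assert (D2 : forall x, - PI < x < PI -> is_derive (fun x => f2 x + mu * cos x) x (f3 x - mu * sin x)).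
  { intros x Hx. destruct (HD x Hx) as [_ [_ [D _]]]. assert (ex_derive f2 x) by (eexists; exact D).
    auto_derive; [auto|]. rewrite_Derive f2 D. ring. }
  pose proof (Derive_n_chain F _ _ _ (- PI) PI D0 D1 D2) as CH.
  assert (B0 : forall x, - PI <= x <= PI -> Rabs (f0 x - mu * cos x) <= sigma).
  { apply bound_closure; [intros; cont; auto|]. intros x Hx. rewrite E0 by lra.
    apply (HB 0%nat ltac:(lia) x Hx). }
  assert (B1 : forall x, - PI <= x <= PI -> Rabs (f1 x + mu * sin x) <= sigma).
  { apply bound_closure; [intros; cont; auto|]. intros x Hx.
    destruct (CH x Hx) as [[_ <-] _]. apply HB; [lia | exact Hx]. }
  assert (B2 : forall x, - PI <= x <= PI -> Rabs (f2 x + mu * cos x) <= sigma).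
  { apply bound_closure; [intros; cont; auto|]. intros x Hx.
    destruct (CH x Hx) as [_ [[_ <-] _]]. apply HB; [lia | exact Hx]. }
  assert (B3 : forall x, - PI <= x <= PI -> Rabs (f3 x - mu * sin x) <= sigma).
  { apply bound_closure; [intros; cont; auto|]. intros x Hx.
    destruct (CH x Hx) as [_ [_ [_ <-]]]. apply HB; [lia | exact Hx]. }
  assert (DIV : forall u v, Rabs u <= sigma -> u = mu * v -> Rabs v <= sigma / mu).
  { intros u v Hu ->. rewrite Rabs_mult, (Rabs_pos_eq mu) in Hu by lra.
    apply (proj1 (Rle_div_r _ _ _ Hmu)). lra. }
  assert (CC : forall f : R -> R, (forall x, continuous f x) -> forall x, continuous (fun x => f (clamp x) / mu) x).
  { intros f Hf x. cont; [|lra]. apply (continuous_comp1 f clamp); [|apply Hf].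
    apply (continuous_clamp (fun x => x)). cont. }
  assert (DD : forall f df : R -> R, (forall x, - PI < x < PI -> is_derive f x (df x)) ->
    forall x, - PI < x < PI -> is_derive (fun x => f (clamp x) / mu) x (df (clamp x) / mu)).
  { intros f df Hf x Hx. rewrite clamp_id by lra.
    apply (is_derive_ext_loc (fun x => / mu * f x)).
    - apply (locally_Ioo (- PI) PI); auto. intros u Hu. rewrite clamp_id by lra.
      unfold Rdiv. apply Rmult_comm.
    - unfold Rdiv. rewrite (Rmult_comm (df x)). apply is_derive_scal. now apply Hf. }
  exists (fun x => f0 (clamp x) / mu), (fun x => f1 (clamp x) / mu),
         (fun x => f2 (clamp x) / mu), (fun x => f3 (clamp x) / mu).
  split; [constructor; auto|split].
  - apply DD. intros; now apply HD.
  - apply DD. intros; now apply HD.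
  - apply DD. intros; now apply HD.
  - intros x Hx. rewrite clamp_id by lra. apply (DIV _ _ (B0 x Hx)). field. lra.
  - intros x Hx. rewrite clamp_id by lra. apply (DIV _ _ (B1 x Hx)). field. lra.
  - intros x Hx. rewrite clamp_id by lra. apply (DIV _ _ (B2 x Hx)). field. lra.
  - intros x Hx. rewrite clamp_id by lra. apply (DIV _ _ (B3 x Hx)). field. lra.
  - intros x. rewrite (clamp_id (clamp x)); [reflexivity | apply clamp_range].
  - rewrite (RInt_ext_le _ (fun x => / mu * f0 x)).
    + rewrite RInt_scale by auto. rewrite (RInt_ext_le f0 a0), Hmean by (auto; lra). apply Rmult_0_r.
    + lra.
    + intros x Hx. rewrite clamp_id by lra. unfold Rdiv. apply Rmult_comm.
  - split; [apply Rdiv_le_0_compat; lra|]. apply Rle_div_l; lra.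
  - intros x Hx. rewrite clamp_id, E0 by lra. field. lra.
  - intros x Hx. rewrite clamp_id by lra. destruct (HD x Hx) as [_ [_ [_ ->]]]. field. lra.
Qed.

(** Compactness gives a maximum; it is interior because [G] is near -1 at both ends and near 1 at
    0. *)
Lemma max_point_exists G g1 g2 g3 eta :
  cos_perturbation G g1 g2 g3 eta -> exists x0, - PI < x0 < PI /\ forall x, G x <= G x0.
Proof.
  intros HP. pose proof PI_gt_3. pose proof (cp_eta _ _ _ _ _ HP) as He. unfold delta0 in He.
  destruct (continuity_ab_maj G (- PI) PI) as [x0 [HM Hx0]]; [lra | |].
  - intros x _. apply continuous_pt, (cp_c0 _ _ _ _ _ HP).
  - exists x0. split.
    + pose proof (HM 0 ltac:(lra)) as M.
      pose proof (cp_b0 _ _ _ _ _ HP 0 ltac:(lra)) as B. rewrite cos_0 in B. apply Rabs_le_between in B.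
      pose proof (cp_b0 _ _ _ _ _ HP x0 Hx0) as B'. apply Rabs_le_between in B'.
      destruct Hx0 as [[L|E] [R|E']]; try lra.
      * rewrite E', cos_PI in B'. rewrite E' in M. lra.
      * rewrite <- E, cos_neg, cos_PI in B'. rewrite <- E in M. lra.
    + intros x. rewrite <- (cp_clamp _ _ _ _ _ HP x). apply HM, clamp_range.
Qed.

Lemma filterlim_at_right_0 (f : R -> R) l :
  filterlim f (at_right 0) (locally l) <->
  (forall eps, 0 < eps -> exists d, 0 < d /\ forall h, 0 < h < d -> Rabs (f h - l) < eps).
Proof.
  split.
  - intros H eps He. destruct (proj1 (filterlim_locally f l) H (mkposreal eps He)) as [d Hd].
    exists d. split; [apply cond_pos|]. intros h Hh. apply (Hd h); [|lra].
    change (Rabs (h - 0) < d). rewrite Rminus_0_r, Rabs_pos_eq; lra.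
  - intros H. apply filterlim_locally. intros eps.
    destruct (H eps (cond_pos eps)) as [d [Hd0 Hd]].
    exists (mkposreal d Hd0). intros h Hh Hp. apply Hd.
    change (Rabs (h - 0) < d) in Hh. rewrite Rminus_0_r, Rabs_pos_eq in Hh; lra.
Qed.

(** The right side of the equation is homogeneous of degree two in [a], so amplitude and inverse
    time scale together. *)
Lemma PJ_solution_scale G b a0 mu :
  0 < mu -> PJ_solution G b -> (forall x, - PI <= x <= PI -> a0 x = mu * G x) ->
  PJ_solution a0 (fun t x => mu * b (mu * t) x).
Proof.
  intros Hmu [HC [Hm [Hi Ht]]] E. pose proof PI_RGT_0 as Hpi.
  destruct (HC 0%nat ltac:(lia)) as [H0 [C0 [_ E0]]]. specialize (E0 eq_refl).
  assert (cH0 : forall t x, continuous (H0 t) x) by (intros; now apply cont2_slice).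
  assert (P : forall t, 0 <= t -> 0 <= mu * t) by (intros; nra).
  assert (I1 : forall t x, 0 <= t -> - PI <= x <= PI ->
     RInt (fun y => mu * b t y) (- PI) x = mu * RInt (b t) (- PI) x).
  { intros t x Ht0 Hx. rewrite (RInt_ext_le (b t) (H0 t)), <- RInt_scale by (auto; try lra; intros; symmetry; apply E0; lra).
    apply RInt_ext_le; [lra|]. intros y Hy. rewrite E0 by lra. reflexivity. }
  assert (I2 : forall t, 0 <= t ->
     RInt (fun y => (mu * b t y) ^ 2) (- PI) PI = mu ^ 2 * RInt (fun y => b t y ^ 2) (- PI) PI).
  { intros t Ht0. rewrite (RInt_ext_le (fun y => b t y ^ 2) (fun y => H0 t y ^ 2)).
    - rewrite <- RInt_scale by (intros; cont; auto).
      apply RInt_ext_le; [lra|]. intros y Hy. rewrite E0 by lra. ring.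
    - lra.
    - intros y Hy. rewrite E0 by lra. reflexivity. }
  assert (R : forall t x, 0 <= t -> - PI <= x <= PI ->
     PJ_rhs (fun t x => mu * b (mu * t) x) t x = mu ^ 2 * PJ_rhs b (mu * t) x).
  { intros t x Ht0 Hx. unfold PJ_rhs. rewrite I1, I2, Derive_scal by auto. ring. }
  split; [|split; [|split]].
  - intros j Hj. destruct (HC j Hj) as [H [C [D E1]]].
    exists (fun t x => mu * H (mu * t) x). split; [|split].
    + intros p. cont. apply (cont2_comp H (fun q => mu * fst q) snd); [cont | cont | apply C].
    + intros t x Ht0 Hx. destruct (D (mu * t) x (P t Ht0) Hx) as [X Y]. split.
      * now apply ex_derive_n_scal_l.
      * rewrite Derive_n_scal_l, Y. reflexivity.
    + intros Ej t x Ht0 Hx. rewrite E1; auto.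
  - intros t Ht0. rewrite I1, Hm by (auto; lra). apply Rmult_0_r.
  - intros x Hx. rewrite Rmult_0_r, E, Hi by exact Hx. reflexivity.
  - intros x Hx. destruct (Ht x Hx) as [D L]. split.
    + intros t Ht0. rewrite R by (auto; lra).
      assert (D' : is_derive (fun s => b (mu * s) x) t (mu * PJ_rhs b (mu * t) x)).
      { apply (is_derive_comp (fun s => b s x) (fun s => mu * s)).
        - apply D. nra.
        - auto_derive; auto. ring. }
      apply (is_derive_scal _ _ mu) in D'.
      apply (is_derive_val _ _ _ _ D'). ring.
    + rewrite R by (auto; lra). rewrite !Rmult_0_r.
      apply filterlim_at_right_0. intros eps He.
      assert (Hmu2 : 0 < mu ^ 2) by (apply pow_lt; lra).
      destruct (proj1 (filterlim_at_right_0 _ _) L (eps / mu ^ 2) ltac:(apply Rdiv_lt_0_compat; lra))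
        as [d [Hd Hlim]].
      exists (d / mu). split; [apply Rdiv_lt_0_compat; lra|].
      intros h Hh. specialize (Hlim (mu * h)).
      replace ((mu * b (mu * h) x - mu * b 0 x) / h - mu ^ 2 * PJ_rhs b 0 x)
        with (mu ^ 2 * ((b (mu * h) x - b 0 x) / (mu * h) - PJ_rhs b 0 x)) by (field; lra).
      rewrite Rabs_mult, (Rabs_pos_eq (mu ^ 2)) by lra.
      apply Rmult_lt_reg_r with (/ mu ^ 2); [apply Rinv_0_lt_compat; lra|].
      replace (mu ^ 2 * Rabs ((b (mu * h) x - b 0 x) / (mu * h) - PJ_rhs b 0 x) * / mu ^ 2)
        with (Rabs ((b (mu * h) x - b 0 x) / (mu * h) - PJ_rhs b 0 x)) by (field; lra).
      apply Hlim. split; [nra|]. destruct Hh as [_ Hh]. apply Rlt_div_r in Hh; lra.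
Qed.

Theorem theorem1p3 :
  exists delta : R, 0 < delta /\
  forall mu : R, 0 < mu ->
  exists C K : R, 0 < C /\ 0 < K /\
  forall (a0 : R -> R) (sigma : R),
    CkI 3 a0 ->
    RInt a0 (-PI) PI = 0 ->
    CkNorm 3 (fun x => a0 x - mu * cos x) = Finite sigma ->
    sigma <= delta * mu ->
    (exists a : R -> R -> R, PJ_solution a0 a) /\
    (forall a b : R -> R -> R, PJ_solution a0 a -> PJ_solution a0 b ->
       forall t x, 0 <= t -> -PI <= x <= PI -> a t x = b t x) /\
    (forall x0 : R, -PI < x0 < PI ->
       (forall x, -PI <= x <= PI -> a0 x <= a0 x0) ->
       Rabs (- Derive_n a0 2 x0 - mu) <= K * sigma /\
       forall a : R -> R -> R, PJ_solution a0 a ->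
       forall t : R, 0 <= t ->
         Rbar_le (CkNorm 1 (fun x => a t x - (- Derive_n a0 2 x0) * cos x))
                 (Finite (C * sigma * exp (- (mu * t / 2))))).
Proof.
  exists delta0. split; [unfold delta0; lra|].
  (* The first constant is twice that of [perturbation_decay], once for the function and once for
     its derivative; the second is the 3 in [|kap - 1| <= 3 eta]. Neither depends on [mu]. *)
  intros mu Hmu. exists 8000000000, 3. split; [lra|]. split; [lra|].
  intros a0 sigma HC Hmean HN Hsig. pose proof PI_gt_3.
  destruct (normalized_datum a0 mu sigma Hmu HC Hmean HN Hsig)
    as [G [g1 [g2 [g3 [HP [EG E2]]]]]].
  split; [|split].
  - destruct (max_point_exists _ _ _ _ _ HP) as [x0 [Hx0 Hmax]].
    eexists. apply (PJ_solution_scale G (sol G (G x0)) a0 mu Hmu); [|exact EG].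
    apply (perturbation_PJ G g1 g2 g3 (sigma / mu) x0 (G x0) (- g2 x0)); auto.
  - intros a b Ha Hb. now apply (PJ_unique a0).
  - intros x0 Hx0 Hmax0.
    assert (Hmax : forall x, G x <= G x0).
    { intros x. rewrite <- (cp_clamp _ _ _ _ _ HP x). pose proof (clamp_range x) as Hr.
      pose proof (Hmax0 _ Hr) as M. rewrite !EG in M by lra. nra. }
    set (kap := - g2 x0).
    assert (Ekap : - Derive_n a0 2 x0 = mu * kap) by (rewrite E2 by exact Hx0; unfold kap; ring).
    rewrite Ekap. split.
    + destruct (max_point_bounds G g1 g2 g3 (sigma / mu) x0 (G x0) kap HP Hx0 Hmax eq_refl eq_refl)
        as [_ [_ [_ B]]].
      replace (mu * kap - mu) with (mu * (kap - 1)) by ring.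
      rewrite Rabs_mult, (Rabs_pos_eq mu) by lra.
      apply Rle_trans with (mu * (3 * (sigma / mu))); [apply Rmult_le_compat_l; lra|].
      right. field. lra.
    + intros a Ha t Ht.
      (* The given maximum point also serves to build an explicit solution; by uniqueness the
         arbitrary solution [a] coincides with it and inherits its decay. *)
      assert (Hb : PJ_solution a0 (fun t x => mu * sol G (G x0) (mu * t) x)).
      { apply (PJ_solution_scale G); auto.
        apply (perturbation_PJ G g1 g2 g3 (sigma / mu) x0 (G x0) kap); auto. }
      assert (EQ : forall x, - PI <= x <= PI -> a t x = mu * sol G (G x0) (mu * t) x)
        by (intros x Hx; now apply (PJ_unique a0 a _ Ha Hb)).
      set (M := 4000000000 * sigma * exp (- (mu * t / 2))).
      assert (EM : mu * (4000000000 * (sigma / mu) * exp (- (mu * t / 2))) = M)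
        by (unfold M; field; lra).
      assert (DEC : forall x, - PI < x < PI -> _)
        by (intros x; exact (perturbation_decay G g1 g2 g3 (sigma / mu) x0 (G x0) kap HP Hx0 Hmax
              eq_refl eq_refl (mu * t) x ltac:(nra))).
      replace (8000000000 * sigma * exp (- (mu * t / 2))) with (M + M) by (unfold M; ring).
      change (Finite (M + M)) with (Rbar_plus (Finite M) (Finite M)).
      apply Rbar_plus_le_compat; apply supI_le; intros x Hx.
      * destruct (DEC x Hx) as [B _]. rewrite EQ by lra.
        replace (mu * sol G (G x0) (mu * t) x - mu * kap * cos x)
          with (mu * (sol G (G x0) (mu * t) x - kap * cos x)) by ring.
        rewrite Rabs_mult, (Rabs_pos_eq mu), <- EM by lra.
        apply Rmult_le_compat_l; lra.
      * destruct (DEC x Hx) as [_ [d [D B]]].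
        assert (D' : is_derive (fun x => a t x - mu * kap * cos x) x (mu * (d + kap * sin x))).
        { apply (is_derive_ext_loc (fun x => mu * sol G (G x0) (mu * t) x - mu * kap * cos x)).
          - apply (locally_Ioo (- PI) PI); auto. intros u Hu. rewrite EQ by lra. reflexivity.
          - set (v := sol G (G x0) (mu * t)) in *.
            assert (ex_derive v x) by (eexists; exact D).
            auto_derive; [auto|]. rewrite_Derive v D. ring. }
        cut (Rabs (mu * (d + kap * sin x)) <= M).
        { intros Q. rewrite <- (is_derive_unique _ _ _ D') in Q. exact Q. }
        rewrite Rabs_mult, (Rabs_pos_eq mu), <- EM by lra.
        apply Rmult_le_compat_l; lra.
Qed.
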